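(* For every primitive idempotent $e\in\mathbb{C}[W(B_n)]$, the $\widetilde{\mathcal D}_Y$-module $e\,\widetilde{\mathcal O}_X$ is simple, generated by a higher Specht polynomial $F_{S,T}$ (for some $\lambda\in\mathcal P_{2,n}$ and $S,T\in\mathrm{STab}(\lambda)$), and $$\widetilde{\mathcal O}_X=\bigoplus_{\lambda\in\mathcal P_{2,n}}f_\lambda\,\widetilde{\mathcal D}_YF_{\lambda,1},$$ the sum running over all $\lambda\in\mathcal P_{2,n}$ (with no quotient by a shift equivalence $\sim$ and no auxiliary index $l$, since $p=1$ forces $e(\lambda)=1$ throughout, unlike the case of $W(D_n)=G(2,2,n)$, where $p=r=2$ forces a nontrivial shift identification). Here $f_\lambda\,\widetilde{\mathcal D}_YF_{\lambda,1}$ stands for $f_\lambda$ copies of $\widetilde{\mathcal D}_YF_{\lambda,1}$.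
   Context: **Group and rings.** For $p\mid r$, $G(r,p,n)$ is the group of $n\times n$ monomial matrices whose nonzero entries are $r$-th roots of unity and such that the $(r/p)$-th power of their product is $1$. $W=W(B_n)=G(2,1,n)$ is thus the group of all $n\times n$ signed permutation matrices, of order $2^nn!$. Its elements are written $(\epsilon_1,\dots,\epsilon_n;\sigma)$, $\epsilon_k\in\{\pm1\}$, $\sigma\in\mathcal S_n$; it acts on $\mathcal O_X=\mathbb{C}[x_1,\dots,x_n]$ by $(\epsilon_1,\dots,\epsilon_n;\sigma)f=f(\epsilon_{\sigma(1)}x_{\sigma(1)},\dots,\epsilon_{\sigma(n)}x_{\sigma(n)})$. Put $y_j=\sum_ix_i^{2j}$ ($1\le j\le n-1$) and $y_n=(x_1\cdots x_n)^2$; the invariant ring is $\mathbb{C}[y_1,\dots,y_n]$. Let $\Delta=c_0\big(\prod_ix_i\big)\prod_{i<j}(x_j^2-x_i^2)$ with $c_0$ a nonzero constant, $\widetilde{\mathcal O}_X=\mathbb{C}[x_1,\dots,x_n,\Delta^{-1}]$ and $\widetilde{\mathcal D}_Y=\mathbb{C}\langle y_1,\dots,y_n,\partial/\partial y_1,\dots,\partial/\partial y_n,\Delta^{-2}\rangle$, where $\partial/\partial y_j$ acts on $\widetilde{\mathcal O}_X$ as the derivation extending $\partial/\partial y_j$ on $\mathbb{C}[y_1,\dots,y_n]$. **Shift equivalence (general case).** For $G(r,p,n)$ with $d=r/p$, $r$-tuples $\lambda,\mu$ of Young diagrams with $n$ cells in total satisfy $\lambda\sim\mu$ if $\mu$ is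 obtained from $\lambda$ by cyclically shifting the components by $dj$ places for some $0\le j\le p-1$; $e(\lambda)$ is $p$ divided by the size of the class of $\lambda$, and $l$ is an index with $0\le l<e(\lambda)$. **Higher Specht polynomials.** $\mathcal P_{2,n}$ is the set of pairs $\lambda=(\lambda^1,\lambda^2)$ of Young diagrams with $n$ cells in total. A $2$-tableau $T=(T^1,T^2)$ of shape $\lambda$ fills the cells with $1,\dots,n$, each once; $k\in T^\nu$ means that $k$ occurs in $T^\nu$. It is standard if entries increase along rows and columns of each component; $\mathrm{STab}(\lambda)$ is the set of standard ones. For $S\in\mathrm{STab}(\lambda)$ the word $w(S)$ is obtained by reading each column of $S^1$ from bottom to top, starting from the left, then $S^2$ likewise. The number $1$ has index $0$; if $k$ has index $q$, then $k+1$ has index $q+1$ if it sits to the left of $k$ in $w(S)$, and $q$ if to the right. $i(S)^\nu(c)$ is the index of the entry of $S^\nu$ in cell $c$. $e_{T^\nu}=\frac1{\alpha_{T^\nu}}\sum_{\sigma\in R(T^\nu)}\sum_{\tau\in C(T^\nu)}\mathrm{sgn}(\tau)\,\tau\sigma$, with $\alpha_{T^\nu}$ the product of the hook lengths of $\lambda^\nu$ and $R(T^\nu),C(T^\nu)$ the row and column stabilizers. For $S,T\in\mathrm{STab}(\lambda)$ the higher Specht polynomial is $$F_{S,T}=\prod_{\nu=1}^2\Big(e_{T^\nu}\Big(\prod_{c\in\lambda^\nu}x_{T^\nu(c)}^{2\,i(S)^\nu(c)}\Big)\prod_{k\in T^\nu}x_k^{\nu-1}\Big).$$ For fixed $S$,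 the $F_{S,T}$, $T\in\mathrm{STab}(\lambda)$, span an irreducible representation $V_S(\lambda)$ of $W$ inside the quotient $\Lambda_0$ of $\mathcal O_X$ by the ideal generated by the invariants of positive degree; its dimension is $f_\lambda$ and its isomorphism class does not depend on $S$. One has $\mathbb{C}[W]=\bigoplus_{\lambda}\bigoplus_{S\in\mathrm{STab}(\lambda)}V_S(\lambda)$. **The generator $F_{\lambda,1}$.** Enumerate $\mathrm{STab}(\lambda)=\{S_1,\dots,S_{f_\lambda}\}$. Fix a matrix realization $\rho_\lambda:W\to\mathrm{GL}_{f_\lambda}(\mathbb{C})$ of $V_S(\lambda)$ for one choice of $S$, and put $e^\lambda_i=\frac{f_\lambda}{|W|}\sum_{g\in W}\overline{\rho_\lambda(g)_{ii}}\,g$, the primitive idempotent corresponding to $S_i$ (the summand $V_{S_i}(\lambda)$ of $\mathbb{C}[W]$ being matched with the minimal left ideal $\mathbb{C}[W]e^\lambda_i$). Then $F_{\lambda,1}=F_{S_1,T}$, for some $T\in\mathrm{STab}(\lambda)$, denotes the higher Specht polynomial with $e^\lambda_1\widetilde{\mathcal O}_X=\widetilde{\mathcal D}_YF_{S_1,T}$.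
   Formalization: For arbitrary primitive e, e·O_X is generated by e·F_{S,T} and isomorphic to D_Y F_{S,T} via e; it equals D_Y F_{S,T} itself when e fixes F_{S,T}, and for all e_i^λ of a suitable realization. F_{λ,1} is shown to exist for a suitable realization, not for every one. *)

(* Defs.v *)
(* MathComp, with multinomials and real-closed: the complex field is R[i] for
   R : realType, and the algebra is done inside the field of rational functions
   {fraction {mpoly R[i][n]}}. *)
From HB Require Import structures.
From mathcomp Require Import all_boot all_order all_fingroup all_algebra.
From mathcomp Require Import mxrepresentation.
From mathcomp Require Import reals complex mpoly ring.

Set Implicit Arguments.
Unset Strict Implicit.
Unset Printing Implicit Defensive.

Import Order.TTheory GRing.Theory Num.Theory.
Local Open Scope ring_scope.
Local Open Scope complex_scope.

Local Notation "x %:F" := (@FracField.tofrac _ x) : ring_scope.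

(* The group W(B_n) of signed permutation matrices.  The pair g = (eps, sigma)
   stands for the matrix [Bmx g] below; g.1 k = true means eps_k = -1.        *)

Definition Bn (n : nat) : Type := ({ffun 'I_n -> bool} * {perm 'I_n})%type.

Section Hyperoctahedral.
Variable n : nat.

HB.instance Definition _ := Finite.on (Bn n).

Definition Bone : Bn n := ([ffun => false], 1%g).
(* MathComp composes permutations from left to right, so that
   (h.2 * g.2)%g x = g.2 (h.2 x). *)
Definition Bmul (g h : Bn n) : Bn n :=
  ([ffun k => g.1 k (+) h.1 ((g.2)^-1%g k)], (h.2 * g.2)%g).
Definition Binv (g : Bn n) : Bn n :=
  ([ffun k => g.1 (g.2 k)], (g.2)^-1%g).

Lemma BmulA : associative Bmul.
Proof.
move=> g h l; congr (_, _); last by rewrite /= mulgA.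
by apply/ffunP => k; rewrite !ffunE /= addbA invMg permM.
Qed.

Lemma Bmul1 : left_id Bone Bmul.
Proof.
case=> e s; congr (_, _); last by rewrite /= mulg1.
by apply/ffunP => k; rewrite !ffunE /= invg1 perm1.
Qed.

Lemma BmulV : left_inverse Bone Binv Bmul.
Proof.
move=> g; congr (_, _); last by rewrite /= mulgV.
by apply/ffunP => k; rewrite !ffunE /= invgK addbb.
Qed.

HB.instance Definition _ := Finite_isGroup.Build (Bn n) BmulA Bmul1 BmulV.

End Hyperoctahedral.

Definition Bmx (A : pzRingType) (n : nat) (g : Bn n) : 'M[A]_n :=
  \matrix_(k, i) (if k == g.2 i then (-1) ^+ g.1 k else 0).

Lemma BmxM (A : pzRingType) (n : nat) (g h : Bn n) :
  Bmx A (g * h)%g = Bmx A g *m Bmx A h.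
Proof.
apply/matrixP => k i; rewrite !mxE (bigD1 (h.2 i)) //= !mxE eqxx permM.
rewrite big1 ?addr0 => [|j /negPf nj]; last by rewrite !mxE nj mulr0.
case: eqP => [->|_]; last by rewrite mul0r.
by rewrite !ffunE permK signr_addb.
Qed.

(* The extensions of an injective endomorphism w and of a derivation D of a
   domain A to its field of fractions, by their formulas on a representing
   fraction; see [fmap_frac] and [fder_frac]. *)

Section FractionDerivation.

Lemma mul_leibniz (A : comPzRingType) (x a b c d : A) :
  x * (a * b + c * d) = x * a * b + c * (x * d).
Proof. by rewrite mulrDr mulrA [x * (c * d)]mulrCA. Qed.

Lemma quotD (F : fieldType) (a b c d a' b' c' d' : F) : b != 0 -> d != 0 ->
  ((a' * d + a * d' + (c' * b + c * b')) * (b * d)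
     - (a * d + c * b) * (b' * d + b * d')) / (b * d) ^+ 2 =
  (a' * b - a * b') / b ^+ 2 + (c' * d - c * d') / d ^+ 2.
Proof. by move=> b0 d0; field; rewrite b0 d0. Qed.

Lemma quotM (F : fieldType) (a b c d a' b' c' d' : F) : b != 0 -> d != 0 ->
  ((a' * c + a * c') * (b * d) - a * c * (b' * d + b * d')) / (b * d) ^+ 2 =
  (a' * b - a * b') / b ^+ 2 * (c / d) + a / b * ((c' * d - c * d') / d ^+ 2).
Proof. by move=> b0 d0; field; rewrite b0 d0. Qed.

Variables (A : idomainType).
Local Notation K := {fraction A}.

Lemma fracE (f : K) :
  f = (\n_(generic_quotient.repr f))%:F / (\d_(generic_quotient.repr f))%:F.
Proof.
have dF : (\d_(generic_quotient.repr f))%:F != 0 :> K by rewrite tofrac_eq0 denom_ratioP.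
apply: (mulIf dF); rewrite divfK //.
rewrite -{1}[f]generic_quotient.reprK; case: (generic_quotient.repr f) => -[a b] /= b0.
unlock FracField.tofrac; rewrite -[LHS]FracField.pi_mul.
apply/generic_quotient.eqmodP; rewrite /= FracField.equivfE /FracField.mulf !numden_Ratio
  ?mulr1 ?oner_eq0 //=.
by rewrite mulrC.
Qed.

Lemma fracP (f : K) : exists a b, b != 0 /\ f = a%:F / b%:F.
Proof.
exists (\n_(generic_quotient.repr f)), (\d_(generic_quotient.repr f)).
split; last exact: fracE.
exact: denom_ratioP.
Qed.

Definition fder (D : A -> A) (f : K) : K :=
  let r := generic_quotient.repr f in
  (D \n_r * \d_r - \n_r * D \d_r)%:F / (\d_r ^+ 2)%:F.

Definition fmap (w : A -> A) (f : K) : K :=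
  let r := generic_quotient.repr f in (w \n_r)%:F / (w \d_r)%:F.

Lemma fmap_frac (w : A -> A) (a b : A) :
  (forall c d, w (c * d) = w c * w d) -> (forall c, c != 0 -> w c != 0) ->
  b != 0 -> fmap w (a%:F / b%:F) = (w a)%:F / (w b)%:F.
Proof.
move=> wM w0 b0; rewrite /fmap; set r := generic_quotient.repr _.
have d0 : \d_r != 0 by exact: denom_ratioP.
have /eqP := fracE (a%:F / b%:F); rewrite -/r.
rewrite eqr_div ?tofrac_eq0 // -!tofracM tofrac_eq => /eqP E.
by apply/eqP; rewrite eqr_div ?tofrac_eq0 ?w0 // -!tofracM -!wM E.
Qed.

Variable D : A -> A.
Hypothesis DD : forall a b, D (a + b) = D a + D b.
Hypothesis DM : forall a b, D (a * b) = D a * b + a * D b.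

Lemma fder_frac (a b : A) : b != 0 ->
  fder D (a%:F / b%:F) = (D a * b - a * D b)%:F / (b ^+ 2)%:F.
Proof.
move=> b0; rewrite /fder; set r := generic_quotient.repr _.
have d0 : \d_r != 0 by exact: denom_ratioP.
have : a * \d_r = \n_r * b.
  apply/eqP; rewrite -(tofrac_eq (a * _)) !tofracM -(@eqr_div K) ?tofrac_eq0 //.
  by apply/eqP; exact: fracE.
move: (\n_r) (\d_r) d0 => c d d0 E.
have E' := congr1 D E; move: E'; rewrite !DM => E'.
apply/eqP; rewrite eqr_div ?tofrac_eq0 ?expf_neq0 // -!tofracM tofrac_eq -subr_eq0.
move: (D a) (D b) (D c) (D d) E' => a' b' c' d' E'.
have -> : (c' * d - c * d') * b ^+ 2 - (a' * b - a * b') * d ^+ 2 =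
  (a * d - c * b) * (b * d' + b' * d) - d * b * (a' * d + a * d' - (c' * b + c * b')) by ring.
by rewrite E E' !subrr mul0r mulr0 subr0.
Qed.

Lemma D1 : D 1 = 0.
Proof. by apply: (addIr (D 1)); rewrite add0r -{3}(mulr1 1) DM mul1r mulr1. Qed.

Lemma fder_poly (p : A) : fder D p%:F = (D p)%:F.
Proof.
have := fder_frac p (oner_neq0 A); rewrite tofrac1 divr1 => ->.
by rewrite D1 mulr1 mulr0 subr0 expr1n tofrac1 divr1.
Qed.

Lemma fderD (f g : K) : fder D (f + g) = fder D f + fder D g.
Proof.
have [a [b [b0 ->]]] := fracP f; have [c [d [d0 ->]]] := fracP g.
have bF : b%:F != 0 :> K by rewrite tofrac_eq0.
have dF : d%:F != 0 :> K by rewrite tofrac_eq0.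
rewrite addf_div // -!tofracM -tofracD !fder_frac ?mulf_neq0 // !(DD, DM).
rewrite !(tofracD, tofracN, tofracM, tofracXn).
exact: quotD.
Qed.

Lemma fderM (f g : K) : fder D (f * g) = fder D f * g + f * fder D g.
Proof.
have [a [b [b0 ->]]] := fracP f; have [c [d [d0 ->]]] := fracP g.
have bF : b%:F != 0 :> K by rewrite tofrac_eq0.
have dF : d%:F != 0 :> K by rewrite tofrac_eq0.
rewrite mulf_div // -!tofracM !fder_frac ?mulf_neq0 // !DM.
rewrite !(tofracD, tofracN, tofracM, tofracXn).
exact: quotM.
Qed.
End FractionDerivation.

Section Tableaux.
Variable n : nat.

(* A Young diagram is a set of cells (row, column) closed towards the corner
   (0, 0); one with at most n cells lies in the n x n square. *)
Definition is_young (D : {set 'I_n * 'I_n}) : bool :=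
  [forall c in D, forall d : 'I_n * 'I_n,
     (d.1 <= c.1)%N && (d.2 <= c.2)%N ==> (d \in D)].

(* P_{2,n} *)
Definition bipart : Type :=
  {lam : {ffun 'I_2 -> {set 'I_n * 'I_n}}
   | [forall nu, is_young (lam nu)] && ((\sum_nu #|lam nu|)%N == n)}.

(* A filling is recorded by the position (component, (row, column)) of each
   entry; the entries 1, ..., n are the ordinals 0, ..., n - 1. *)
Definition bitab : Type := {ffun 'I_n -> 'I_2 * ('I_n * 'I_n)}.

Definition is_tableau (lam : bipart) (T : bitab) : bool :=
  injectiveb T &&
  [forall nu, forall c, (c \in sval lam nu) == [exists k, T k == (nu, c)]].

Definition is_standard (T : bitab) : bool :=
  [forall k : 'I_n, forall l : 'I_n,
    ((T k).1 == (T l).1) &&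
    (((T k).2.1 == (T l).2.1) && ((T k).2.2 < (T l).2.2)%N ||
     ((T k).2.2 == (T l).2.2) && ((T k).2.1 < (T l).2.1)%N)
    ==> (k < l)%N].

Definition STab (lam : bipart) : {set bitab} :=
  [set T | is_tableau lam T && is_standard T].

Definition ftab (lam : bipart) : nat := #|STab lam|.

(* The word w(T): components in order, columns from left to right, each column
   from bottom to top. *)
Definition word (T : bitab) : seq nat :=
  pmap (fun c => omap val [pick k | T k == c])
    [seq (p.1, (r, p.2)) | p <- [seq (nu, c) | nu <- enum 'I_2, c <- enum 'I_n],
                           r <- rev (enum 'I_n)].

Fixpoint tindex (T : bitab) (k : nat) : nat :=
  if k is k'.+1 then
    (tindex T k' + (index k (word T) < index k' (word T))%N)%N
  else 0%N.

(* i(S)^nu(c) for the cell p = (nu, c) *)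
Definition cell_index (S : bitab) (p : 'I_2 * ('I_n * 'I_n)) : nat :=
  if [pick k | S k == p] is Some k then tindex S k else 0%N.

Definition hook (D : {set 'I_n * 'I_n}) (c : 'I_n * 'I_n) : nat :=
  #|[set d in D | (d.1 == c.1) && (c.2 <= d.2)%N
                  || (d.2 == c.2) && (c.1 < d.1)%N]|.

Definition hookprod (D : {set 'I_n * 'I_n}) : nat :=
  (\prod_(c in D) hook D c)%N.

Definition rowstab (T : bitab) (nu : 'I_2) : {set {perm 'I_n}} :=
  [set s : {perm 'I_n} | [forall k, if (T k).1 == nu
     then ((T (s k)).1 == nu) && ((T (s k)).2.1 == (T k).2.1) else s k == k]].

Definition colstab (T : bitab) (nu : 'I_2) : {set {perm 'I_n}} :=
  [set s : {perm 'I_n} | [forall k, if (T k).1 == nu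
     then ((T (s k)).1 == nu) && ((T (s k)).2.2 == (T k).2.2) else s k == k]].

End Tableaux.

Section Polynomials.
Variables (R : realType) (n : nat).
Local Notation C := R[i].
Local Notation P := {mpoly C[n]}.

(* x_i |-> eps_{sigma(i)} x_{sigma(i)} *)
Definition wact (g : Bn n) (f : P) : P :=
  f \mPo [tuple (-1) ^+ g.1 (g.2 i) *: 'X_(g.2 i) | i < n].

Lemma wactD (g : Bn n) (p q : P) : wact g (p + q) = wact g p + wact g q.
Proof. exact: comp_mpolyD. Qed.

Lemma wactZ (g : Bn n) (c : C) (p : P) : wact g (c *: p) = c *: wact g p.
Proof. exact: comp_mpolyZ. Qed.

Lemma wact_Xm (g : Bn n) (m : 'X_{1..n}) :
  wact g 'X_[m] = \prod_i ((-1) ^+ g.1 (g.2 i) *: 'X_(g.2 i)) ^+ m i.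
Proof.
by rewrite /wact comp_mpolyX; apply: eq_bigr => i _; rewrite tnth_mktuple.
Qed.

Lemma wact_X (g : Bn n) (i : 'I_n) :
  wact g 'X_i = (-1) ^+ g.1 (g.2 i) *: 'X_(g.2 i).
Proof. by rewrite /wact comp_mpolyXU -tnth_nth tnth_mktuple. Qed.

Lemma wactM (g h : Bn n) (f : P) : wact (g * h)%g f = wact g (wact h f).
Proof.
have mono (m : 'X_{1..n}) : wact (g * h)%g 'X_[m] = wact g (wact h 'X_[m]).
  rewrite (wact_Xm h) [RHS]rmorph_prod wact_Xm /=.
  apply: eq_bigr => i _; rewrite [RHS]rmorphXn /=; congr (_ ^+ _).
  apply/esym/(etrans (wactZ _ _ _)); rewrite wact_X scalerA permM ffunE.
  by rewrite permK addbC signr_addb.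
pose Q (f : P) := wact (g * h)%g f = wact g (wact h f).
apply: (@mpolyind _ _ Q) => [|c m p _ _ IH]; rewrite /Q.
  by rewrite /wact !comp_mpoly0.
transitivity (c *: wact (g * h)%g 'X_[m] + wact (g * h)%g p).
  by apply: (etrans (wactD _ _ _)); congr (_ + _); apply: wactZ.
transitivity (wact g (c *: wact h 'X_[m] + wact h p)).
  apply/esym; apply: (etrans (wactD _ _ _)); apply: f_equal2 (esym IH).
  by apply: (etrans (wactZ _ _ _)); apply: f_equal (esym (mono m)).
apply: f_equal; apply/esym; apply: (etrans (wactD _ _ _)).
exact: f_equal2 (wactZ _ _ _) (erefl _).
Qed.

Lemma wact1 (f : P) : wact 1%g f = f.
Proof.
transitivity (f \mPo [tuple 'X_i | i < n]); last exact: comp_mpoly_id.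
apply: (f_equal (fun t => f \mPo t)); apply: eq_from_tnth => i.
by rewrite !tnth_mktuple ffunE perm1 scale1r.
Qed.

Lemma wact_neq0 g (f : P) : f != 0 -> wact g f != 0.
Proof.
apply: contraNneq => E; have : wact g^-1%g (wact g f) = 0.
  by rewrite E; exact: comp_mpoly0.
have <- := wactM g^-1%g g f; rewrite mulVg => E0; apply/eqP.
exact: (etrans (esym (wact1 f)) E0).
Qed.

Definition sact (s : {perm 'I_n}) : P -> P := wact ([ffun => false], s).

Definition young_symm (lam : bipart n) (T : bitab n) (nu : 'I_2) (f : P) : P :=
  (hookprod (sval lam nu))%:R^-1 *:
    \sum_(s in rowstab T nu) \sum_(t in colstab T nu)
       ((-1) ^+ odd_perm t : C) *: sact t (sact s f).

(* F_{S,T}.  Components are numbered 0 and 1, so that the exponent nu - 1 reads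
   nu; the first product runs over the cells of T through their entries. *)
Definition specht (lam : bipart n) (S T : bitab n) : P :=
  \prod_(nu < 2)
    (young_symm lam T nu
       (\prod_(k < n | (T k).1 == nu) 'X_k ^+ (2 * cell_index S (T k))) *
     \prod_(k < n | (T k).1 == nu) 'X_k ^+ nu).

Definition gconv (a b : {ffun Bn n -> C}) : {ffun Bn n -> C} :=
  [ffun g => \sum_h a h * b (h^-1 * g)%g].

Definition orth_idempotents (a b : {ffun Bn n -> C}) : Prop :=
  [/\ gconv a a = a, gconv b b = b, gconv a b = 0 & gconv b a = 0].

Definition primitive_idempotent (e : {ffun Bn n -> C}) : Prop :=
  [/\ e != 0, gconv e e = e &
      forall a b, orth_idempotents a b -> e = a + b -> a = 0 \/ b = 0].

Definition invariant (f : P) : Prop := forall g : Bn n, wact g f = f.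

(* The ideal generated by the invariants without constant term; Lambda_0 is the
   quotient by it, and equalities in Lambda_0 are congruences modulo it. *)
Definition coinv_ideal (f : P) : Prop :=
  exists (m : nat) (a h : 'I_m -> P),
    (forall k, invariant (h k) /\ (h k)@_0%MM = 0) /\ f = \sum_k a k * h k.

Definition specht_span (lam : bipart n) (S : bitab n) (f : P) : Prop :=
  exists c : bitab n -> C, f = \sum_(T in STab lam) c T *: specht lam S T.

(* rho is the matrix of the action of W on V_S(lam) in some basis v of V_S(lam),
   for some S. *)
Definition realizes (lam : bipart n)
    (rho : mx_representation C [set: Bn n]%G (ftab lam)) : Prop :=
  exists2 S, S \in STab lam & exists v : 'I_(ftab lam) -> P,
  [/\ forall i, specht_span lam S (v i),
      forall c : 'I_(ftab lam) -> C,
        coinv_ideal (\sum_i c i *: v i) -> forall i, c i = 0,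
      forall f, specht_span lam S f ->
        exists c : 'I_(ftab lam) -> C, coinv_ideal (f - \sum_i c i *: v i) &
      forall g j, coinv_ideal (wact g (v j) - \sum_i rho g i j *: v i)].

(* e^lam_i *)
Definition mx_idem (lam : bipart n)
    (rho : mx_representation C [set: Bn n]%G (ftab lam)) (i : 'I_(ftab lam)) :
    {ffun Bn n -> C} :=
  [ffun g => (ftab lam)%:R / #|[set: Bn n]|%:R * (rho g i i)^*].

Local Notation K := {fraction P}.

Definition cstK (c : C) : K := (c%:MP_[n])%:F.

Definition wactK (g : Bn n) : K -> K := fmap (wact g).

Lemma wactK_frac g (a b : P) :
  b != 0 -> wactK g (a%:F / b%:F) = (wact g a)%:F / (wact g b)%:F.
Proof. exact: (fmap_frac a (fun c d => rmorphM _ c d) (@wact_neq0 g)). Qed.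

Definition aact (a : {ffun Bn n -> C}) (f : K) : K :=
  \sum_g cstK (a g) * wactK g f.

Definition dX (i : 'I_n) : K -> K := fder (mderiv i).

(* y_{j+1} *)
Definition yB (j : 'I_n) : P :=
  if (j.+1 < n)%N then \sum_i 'X_i ^+ (2 * j.+1) else (\prod_i 'X_i) ^+ 2.

Definition jacobian : 'M[K]_n := \matrix_(k, i) ((yB k)^`M(i))%:F.

(* The partial derivative with respect to y_{j+1}, by the chain rule; it is
   characterized by [dYP] and [dY_ext]. *)
Definition dY (j : 'I_n) (f : K) : K := \sum_i invmx jacobian i j * dX i f.

Lemma mderiv_monom (i : 'I_n) (m : 'X_{1..n}) :
  ('X_[m])^`M(i) * 'X_i = (m i)%:R *: 'X_[m] :> P.
Proof.
rewrite mderivX -scalerAl -mpolyXD; have [->|m0] := eqVneq (m i) 0%N.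
  by rewrite !scale0r.
by rewrite submK // lep1mP.
Qed.

Definition yexp (k : 'I_n) : nat := if (k.+1 < n)%N then k.+1 else 0%N.

Lemma yexp_ltn k : (yexp k < n)%N.
Proof.
by rewrite /yexp; case: ifP => // _; apply: leq_ltn_trans (ltn_ord k).
Qed.

Lemma yexp_inj : injective yexp.
Proof.
move=> k l; rewrite /yexp.
case: ltnP => hk; case: ltnP => hl //; first by case=> /val_inj.
move=> _; apply: val_inj => /=.
have le (i j : 'I_n) : (n <= j.+1)%N -> (i <= j)%N.
  by rewrite -ltnS; apply: leq_trans (ltn_ord i).
by apply/eqP; rewrite eqn_leq !le.
Qed.

Lemma sum_distinct_Xn (F : fieldType) (w : 'I_n -> F) (e : 'I_n -> nat) :
  injective e -> \sum_k w k *: 'X^(e k) = 0 -> forall k, w k = 0.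
Proof.
move=> e_inj /polyP s0 k; have := s0 (e k).
rewrite coef0 coef_sum (bigD1 k) //= big1 ?addr0 => [|l lk].
  by rewrite coefZ coefXn eqxx mulr1.
by rewrite coefZ coefXn eq_sym (inj_eq e_inj) (negPf lk) mulr0.
Qed.

Lemma yB_deriv (k : 'I_n) : exists2 c : P, c != 0 &
  forall i, (yB k)^`M(i) * 'X_i = c * ('X_i ^+ 2) ^+ yexp k.
Proof.
rewrite /yB /yexp; case: ifP => kn.
  exists (2 * k.+1)%:R%:MP => [|i]; first by rewrite mpolyC_eq0 pnatr_eq0.
  rewrite raddf_sum mulr_suml (bigD1 i) //= big1 ?addr0 => [|l li].
    by rewrite mpolyXn mderiv_monom mulmnE mnm1E eqxx mul1n -mpolyXn -exprM mul_mpolyC.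
  by rewrite mpolyXn mderiv_monom mulmnE mnm1E (negPf li) mul0n scale0r.
have E : (\prod_i 'X_i) ^+ 2 = 'X_[[multinom 2%N | _ < n]] :> P.
  by rewrite -prodrXl mpolyXE_id; apply: eq_bigr => j _; rewrite mnmE.
exists (2%:R%:MP * 'X_[[multinom 2%N | _ < n]]) => [|i].
  by rewrite mulf_neq0 ?mpolyC_eq0 ?pnatr_eq0 // -E expf_neq0 // prodf_seq_neq0;
    apply/allP => j _; rewrite /= -msize_poly_eq0 msizeX.
by rewrite E mderiv_monom mnmE expr0 mulr1 mul_mpolyC.
Qed.

Lemma mpolyX_inj (i j : 'I_n) : ('X_i ^+ 2 == 'X_j ^+ 2 :> P) = (i == j).
Proof.
apply/eqP/eqP => [E|->//]; apply/eqP/negPn/negP => ij.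
have := congr1 (meval (fun l => (l == i)%:R)) E.
rewrite !rmorphXn /= !mevalXU eqxx eq_sym (negPf ij) => /eqP.
by rewrite expr1n expr0n oner_eq0.
Qed.

Lemma jacobian_unit : jacobian \in unitmx.
Proof.
rewrite -row_free_unit; apply: inj_row_free => u uJ.
have [c c0 Ec] := fin_all_exists2 yB_deriv.
pose p : {poly K} := \sum_k (u 0 k * (c k)%:F) *: 'X^(yexp k).
have rp (i : 'I_n) : root p ('X_i ^+ 2)%:F.
  have := congr1 (fun v : 'rV_n => v 0 i * ('X_i)%:F) uJ.
  rewrite !mxE mul0r mulr_suml => uJi; apply/eqP; rewrite -[RHS]uJi horner_sum.
  apply: eq_bigr => k _; rewrite !mxE -[RHS]mulrA -tofracM Ec.
  by rewrite hornerZ hornerXn -tofracXn -mulrA -tofracM.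
have p0 : p = 0.
  apply/eqP/negPn/negP => p0.
  pose rs : seq K := [seq ('X_i ^+ 2)%:F | i <- enum 'I_n].
  have : (size rs < size p)%N.
    apply: max_poly_roots p0 _ _; first by apply/allP => _ /mapP [i _ ->].
    rewrite map_inj_uniq ?enum_uniq // => i j /eqP.
    by rewrite tofrac_eq mpolyX_inj => /eqP.
  rewrite size_map size_enum_ord ltnNge => /negP; apply.
  apply: (leq_trans (size_sum _ _ _)); apply/bigmax_leqP => k _.
  by apply: (leq_trans (size_scale_leq _ _)); rewrite size_polyXn yexp_ltn.
apply/rowP => k; rewrite mxE; apply/eqP.
have /eqP := sum_distinct_Xn yexp_inj p0 k.
by rewrite mulf_eq0 tofrac_eq0 (negPf (c0 k)) orbF.
Qed.

Lemma dXc i (c : C) : dX i (cstK c) = 0.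
Proof.
by rewrite /dX /cstK (fder_poly (mderivM i)) mderivC tofrac0.
Qed.

Lemma dYP (j : 'I_n) :
  [/\ forall f g : K, dY j (f + g) = dY j f + dY j g,
      forall f g : K, dY j (f * g) = dY j f * g + f * dY j g &
      forall c : C, dY j (cstK c) = 0].
Proof.
split=> [f g|f g|c]; rewrite /dY.
- rewrite -big_split; apply: eq_bigr => i _ /=.
  by rewrite /dX (fderD (@mderivD _ _ i) (mderivM i)) mulrDr.
- rewrite mulr_suml mulr_sumr -big_split; apply: eq_bigr => i _ /=.
  exact: (etrans (f_equal _ (fderM (mderivM i) f g)) (mul_leibniz _ _ _ _ _)).
- by apply: big1 => i _; rewrite dXc mulr0.
Qed.

Lemma dY_y (j k : 'I_n) : dY j (yB k)%:F = (k == j)%:R.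
Proof.
have /matrixP /(_ k j) := mulmxV jacobian_unit.
rewrite !mxE => <-; apply: eq_bigr => i _.
by rewrite mxE /dX (fder_poly (mderivM i)) mulrC.
Qed.

Lemma dY_ext (j : 'I_n) (f : P) :
  dY j (f \mPo [tuple yB k | k < n])%:F =
  (f^`M(j) \mPo [tuple yB k | k < n])%:F.
Proof.
have [dD dM dc] := dYP j; set y := [tuple _ | k < n].
pose Q (f : P) := dY j (f \mPo y)%:F = (f^`M(j) \mPo y)%:F.
have QC c : Q c%:MP by rewrite /Q mderivC !comp_mpolyC [LHS]dc mpolyC0 tofrac0.
have QM p q : Q p -> Q q -> Q (p * q).
  rewrite /Q mderivM !(rmorphM, rmorphD) /= => Qp Qq.
  apply: (etrans (dM _ _)).
  exact: (f_equal2 _ (f_equal (fun z => z * _) Qp) (f_equal (fun z => _ * z) Qq)).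
have QX i : Q 'X_i.
  rewrite /Q comp_mpolyXU -tnth_nth tnth_mktuple dY_y mderivX mnm1E.
  case: eqP => [->|_]; last by rewrite scale0r !rmorph0.
  have -> : (U_(j) - U_(j))%MM = 0%MM :> 'X_{1..n}.
    by apply/mnmP => l; rewrite mnmBE mnm0E subnn.
  by rewrite scale1r mpolyX0 !rmorph1.
have QXm m : Q 'X_[m].
  rewrite mpolyXE_id; apply: (big_ind Q) => [|p q|i _]; [exact: (QC 1)|exact: (QM p q)|].
  elim: (m i) => [|k IH]; first by rewrite expr0; exact: (QC 1).
  by rewrite exprS; exact: (QM _ _ (QX i) IH).
have QZ c m : Q (c *: 'X_[m]).
  by rewrite -mul_mpolyC; exact: (QM _ _ (QC c) (QXm m)).
have QD p q : Q p -> Q q -> Q (p + q).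
  rewrite /Q mderivD !rmorphD /= => Qp Qq; apply: (etrans (dD _ _)).
  exact: (f_equal2 _ Qp Qq).
have Q0 : Q 0 by have := QC 0; rewrite mpolyC0.
exact: (@mpolyind _ _ Q Q0 (fun c m p _ _ => QD _ _ (QZ c m))).
Qed.

Variable c0 : C.

Definition Delta : P :=
  c0 *: ((\prod_i 'X_i) *
    \prod_(p : 'I_n * 'I_n | (p.1 < p.2)%N) ('X_(p.2) ^+ 2 - 'X_(p.1) ^+ 2)).

Definition Otil (f : K) : Prop :=
  exists (p : P) (m : nat), f = p%:F / Delta%:F ^+ m.

Inductive Dtil : (K -> K) -> Prop :=
| Dtil_cst c : Dtil (fun f => cstK c * f)
| Dtil_y j : Dtil (fun f => (yB j)%:F * f)
| Dtil_d j : Dtil (dY j)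
| Dtil_Delta : Dtil (fun f => Delta%:F ^- 2 * f)
| Dtil_add Q1 Q2 : Dtil Q1 -> Dtil Q2 -> Dtil (fun f => Q1 f + Q2 f)
| Dtil_comp Q1 Q2 : Dtil Q1 -> Dtil Q2 -> Dtil (fun f => Q1 (Q2 f)).

Definition eO (e : {ffun Bn n -> C}) (f : K) : Prop :=
  exists2 h, Otil h & f = aact e h.

Definition sameset (M N : K -> Prop) : Prop := forall f, M f <-> N f.

Definition Dsubmod (M : K -> Prop) : Prop :=
  [/\ forall f, M f -> Otil f, M 0, forall f g, M f -> M g -> M (f + g) &
      forall Q f, Dtil Q -> M f -> M (Q f)].

Definition Dsimple (M : K -> Prop) : Prop :=
  [/\ Dsubmod M, exists2 f, M f & f != 0 &
      forall N, Dsubmod N -> (forall f, N f -> M f) ->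
        (forall f, N f -> f = 0) \/ sameset N M].

Definition Dgen (F : K) (f : K) : Prop := exists2 Q, Dtil Q & f = Q F.

Definition Diso (M N : K -> Prop) (phi : K -> K) : Prop :=
  [/\ forall f, M f -> N (phi f),
      forall f g, M f -> M g -> phi (f + g) = phi f + phi g,
      forall Q f, Dtil Q -> M f -> phi (Q f) = Q (phi f),
      forall f g, M f -> M g -> phi f = phi g -> f = g &
      forall h, N h -> exists2 f, M f & phi f = h].

(* Otil is the internal direct sum of the N lam i. *)
Definition Otil_direct_sum
    (N : forall lam : bipart n, 'I_(ftab lam) -> K -> Prop) : Prop :=
  forall f, Otil f ->
  exists u : forall lam : bipart n, 'I_(ftab lam) -> K,
  [/\ forall lam i, N lam i (u lam i),
      f = \sum_lam \sum_i u lam i &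
      forall u' : forall lam : bipart n, 'I_(ftab lam) -> K,
        (forall lam i, N lam i (u' lam i)) ->
        f = \sum_lam \sum_i u' lam i -> forall lam i, u' lam i = u lam i].

(* Otil is isomorphic to the direct sum, over all lam, of ftab lam copies of the
   submodule M lam. *)
Definition Otil_decomposition (M : bipart n -> K -> Prop) : Prop :=
  exists N : forall lam : bipart n, 'I_(ftab lam) -> K -> Prop,
    (forall lam i, Dsubmod (N lam i) /\ exists phi, Diso (M lam) (N lam i) phi)
    /\ Otil_direct_sum N.

End Polynomials.

Arguments specht {R n} lam S T.

(* Main.v *)
From HB Require Import structures.
Require Import Defs.
From mathcomp Require Import all_boot all_order all_fingroup all_algebra.
From mathcomp Require Import mxrepresentation.
From mathcomp Require Import reals complex mpoly ring zify.
From mathcomp Require boolp.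

Set Implicit Arguments.
Unset Strict Implicit.
Unset Printing Implicit Defensive.

Import Order.TTheory GRing.Theory Num.Theory.
Local Open Scope ring_scope.
Local Open Scope complex_scope.

Local Notation "x %:F" := (@FracField.tofrac _ x) : ring_scope.
Local Notation "m # s" := [multinom m (s i) | i < _]
  (at level 40, left associativity, format "m # s").

(** Write A for the group algebra of W = W(B_n), K for the field of rational
    functions, O for the ring of fractions p / Delta^m and D for the algebra of
    differential operators in y_1, ..., y_n.

    The theorem is the double centralizer property of A and D acting on O.
    Operators in D commute with W, so e O is a D-module for every e in A.
    Conversely, if f and h lie in O and every element of A that kills f kills
    h, then Q f = h for some Q in D ([transfer]).  Indeed, the translates of a
    polynomial f are combinations, with constant coefficients X g j, of finitely
    many monomials; the hypothesis on h gives elements b_j of O whose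
    combinations, with the same coefficients, are the translates of h.  Operators
    with coefficients in O extract the coefficient of one monomial
    ([separate_monomial]), since x_i d/dx_i - k does so one exponent at a time
    and d/dx_i is a combination of the d/dy_j.  Averaging sum_j b_j L_j over W
    produces W-invariant coefficients, which are polynomials in the y_k up to a
    power of Delta^2 ([invariant_in_Y], by Newton's identities).

    If e is primitive and e f = f <> 0, then the annihilator of f in A is the
    annihilator of e, by Maschke's theorem ([primitive_annihilator]).  Hence any
    nonzero f in e O generates e O, which is therefore simple, and it remains to
    provide enough primitive idempotents that fix higher Specht polynomials.

    For this, let DT T be the sum of sgn t . t x^m over the column stabilizer of
    T, where m k = 2 row(k) + component(k).  It has the least degree among the
    polynomials on which the column stabilizer and the sign changes act by the
    same character as on it, and those of the same degree are its multiples
    ([anti_mdeg], [anti_scalar]).  So DT T generates an irreducible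
    representation, representations of different shapes are not isomorphic
    ([distinct_shapes]), and DT T has nonzero image modulo the coinvariant ideal
    ([DT_notin_coinv]).  A higher Specht polynomial F_{S,T} is, up to a nonzero
    constant, an image of DT T under a W-map ([annle_specht]), and the two are
    proportional when S is the tableau read row by row, for which the index is
    the row number ([specht_rowtab]).

    The DT T for standard T are independent, by comparison of the leading
    monomials, so the representation attached to lambda has dimension at least
    f_lambda.  The orthogonality relations bound the sum of the squares of these
    dimensions by the order of W, and sum_lambda f_lambda^2 = 2^n n!, because a
    bipartition has exactly two more addable cells than removable ones
    ([corners], [nlinext_up], [sum_ftab_sqr]).  Thus the dimensions are the
    f_lambda and the matrix coefficients are a basis of A: they give matrix
    units [munit] whose diagonal elements are the idempotents e^lambda_i, with
    sum 1 ([munit_complete]).  Applying this decomposition of 1 to e on one side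
    finds, for each primitive e, an e^lambda_i with e e^lambda_i <> 0, hence a
    polynomial F_{S,T} with e F_{S,T} <> 0; applying it to O gives the direct
    sum. *)

(** * The group algebra *)

Section GroupAlgebra.
Variables (R : realType) (n : nat).
Local Notation C := R[i].
Local Notation W := (Bn n).
Local Notation A := {ffun W -> C}.

Definition gone : A := [ffun g => (g == 1%g)%:R].
Definition gdelta (h : W) : A := [ffun g => (g == h)%:R].

Lemma gconvA : associative (@gconv R n).
Proof.
move=> a b c; apply/ffunP => x; rewrite !ffunE.
transitivity (\sum_h \sum_k a h * (b k * c (k^-1 * (h^-1 * x))%g)).
  by apply: eq_bigr => h _; rewrite ffunE mulr_sumr.
transitivity (\sum_h \sum_k a h * (b (h^-1 * k)%g * c (k^-1 * x)%g)).
  apply: eq_bigr => h _; rewrite (reindex_inj (mulgI h^-1%g)) /=.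
  by apply: eq_bigr => k _; rewrite invMg invgK -!mulgA mulKVg.
rewrite exchange_big /=; apply: eq_bigr => k _; rewrite ffunE mulr_suml.
by apply: eq_bigr => h _; rewrite mulrA.
Qed.

Lemma gconvDl (a b c : A) : gconv (a + b) c = gconv a c + gconv b c.
Proof.
by apply/ffunP => x; rewrite !ffunE -big_split; apply: eq_bigr => h _ /=;
  rewrite ffunE mulrDl.
Qed.

Lemma gconvDr (a b c : A) : gconv a (b + c) = gconv a b + gconv a c.
Proof.
by apply/ffunP => x; rewrite !ffunE -big_split; apply: eq_bigr => h _ /=;
  rewrite ffunE mulrDr.
Qed.

Lemma gconvNl (a b : A) : gconv (- a) b = - gconv a b.
Proof.
by apply/ffunP => x; rewrite !ffunE -sumrN; apply: eq_bigr => h _ /=;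
  rewrite ffunE mulNr.
Qed.

Lemma gconvNr (a b : A) : gconv a (- b) = - gconv a b.
Proof.
by apply/ffunP => x; rewrite !ffunE -sumrN; apply: eq_bigr => h _ /=;
  rewrite ffunE mulrN.
Qed.

Lemma gconv0l (a : A) : gconv 0 a = 0.
Proof. by apply: (addIr (gconv 0 a)); rewrite -gconvDl !add0r. Qed.

Lemma gconv0r (a : A) : gconv a 0 = 0.
Proof. by apply: (addIr (gconv a 0)); rewrite -gconvDr !add0r. Qed.

Lemma gconvZl (c : C) (a b : A) : gconv (c *: a) b = c *: gconv a b.
Proof.
apply/ffunP => x; rewrite !ffunE scaler_sumr.
by apply: eq_bigr => h _; rewrite !ffunE -scalerAl.
Qed.

Lemma gconvZr (c : C) (a b : A) : gconv a (c *: b) = c *: gconv a b.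
Proof.
apply/ffunP => x; rewrite !ffunE scaler_sumr.
by apply: eq_bigr => h _; rewrite !ffunE; exact: mulrCA.
Qed.

Lemma gconv_sumr (I : finType) (b : A) (G : I -> A) :
  gconv b (\sum_i G i) = \sum_i gconv b (G i).
Proof. exact: (big_morph (gconv b) (gconvDr b) (gconv0r b)). Qed.

Lemma gconv_suml (I : finType) (b : A) (G : I -> A) :
  gconv (\sum_i G i) b = \sum_i gconv (G i) b.
Proof.
apply/ffunP => x; rewrite ffunE sum_ffunE.
under [RHS]eq_bigr do rewrite ffunE.
rewrite exchange_big; apply: eq_bigr => h _ /=.
by rewrite sum_ffunE mulr_suml.
Qed.

Lemma gconv_deltal (h : W) (a : A) x : gconv (gdelta h) a x = a (h^-1 * x)%g.
Proof.
rewrite ffunE (bigD1 h) //= big1 ?addr0 => [|k /negPf kh].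
  by rewrite ffunE eqxx mul1r.
by rewrite ffunE kh mul0r.
Qed.

Lemma gconv_deltar (h : W) (a : A) x : gconv a (gdelta h) x = a (x * h^-1)%g.
Proof.
rewrite ffunE (bigD1 (x * h^-1)%g) //= big1 ?addr0 => [|k kh].
  by rewrite ffunE invMg invgK -mulgA mulVg mulg1 eqxx mulr1.
rewrite ffunE; case: eqP => [E|_]; last by rewrite mulr0.
by case/eqP: kh; rewrite -E invMg invgK mulKVg.
Qed.

Lemma gone_delta : gone = gdelta 1%g.
Proof. by []. Qed.

Lemma gconv1l : left_id gone (@gconv R n).
Proof. by move=> a; apply/ffunP => x; rewrite gone_delta gconv_deltal invg1 mul1g. Qed.

Lemma gconv1r : right_id gone (@gconv R n).
Proof. by move=> a; apply/ffunP => x; rewrite gone_delta gconv_deltar invg1 mulg1. Qed.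

Lemma gdeltaM g h : gconv (gdelta g) (gdelta h) = gdelta (g * h)%g.
Proof.
apply/ffunP => x; rewrite gconv_deltal !ffunE; congr (_%:R).
by rewrite -(inj_eq (mulgI g)) mulKVg.
Qed.

Lemma ffun_delta (a : A) : a = \sum_g a g *: gdelta g.
Proof.
apply/ffunP => x; rewrite sum_ffunE (bigD1 x) //= big1 ?addr0 => [|k /negPf kx].
  by rewrite !ffunE eqxx [RHS]mulr1.
by rewrite !ffunE eq_sym kx; exact: mulr0.
Qed.

(** A module over the group algebra is an additive group with scalars and a
    linear action of the group; polynomials and rational functions are both
    treated as such. *)
Variables (M : zmodType) (scal : C -> M -> M) (act : W -> M -> M).
Hypotheses (scalDr : forall c, {morph scal c : u v / u + v})
           (scalDl : forall c d u, scal (c + d) u = scal c u + scal d u)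
           (scalA : forall c d u, scal c (scal d u) = scal (c * d) u)
           (scal1 : forall u, scal 1 u = u)
           (actD : forall g, {morph act g : u v / u + v})
           (actZ : forall g c u, act g (scal c u) = scal c (act g u))
           (actM : forall g h u, act (g * h)%g u = act g (act h u))
           (act1 : forall u, act 1%g u = u).

Definition lact (a : A) (u : M) : M := \sum_g scal (a g) (act g u).

Lemma scal0l u : scal 0 u = 0.
Proof. by apply: (addIr (scal 0 u)); rewrite -scalDl !add0r. Qed.

Lemma scal0r c : scal c 0 = 0.
Proof. by apply: (addIr (scal c 0)); rewrite -scalDr !add0r. Qed.

Lemma scal_sumr c (I : finType) (F : I -> M) :
  scal c (\sum_i F i) = \sum_i scal c (F i).
Proof. exact: (big_morph (scal c) (scalDr c) (scal0r c)). Qed.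

Lemma scal_suml (I : finType) (F : I -> C) u :
  scal (\sum_i F i) u = \sum_i scal (F i) u.
Proof. exact: (big_morph (scal^~ u) (fun c d => scalDl c d u) (scal0l u)). Qed.

Lemma act_sum g (I : finType) (F : I -> M) :
  act g (\sum_i F i) = \sum_i act g (F i).
Proof.
have act0 : act g 0 = 0 by apply: (addIr (act g 0)); rewrite -actD !add0r.
exact: (big_morph (act g) (actD g) act0).
Qed.

Lemma lactD a : {morph lact a : u v / u + v}.
Proof.
by move=> u v; rewrite /lact -big_split; apply: eq_bigr => g _;
  rewrite actD scalDr.
Qed.

Lemma lactZ a c u : lact a (scal c u) = scal c (lact a u).
Proof.
rewrite /lact scal_sumr; apply: eq_bigr => g _.
by rewrite actZ !scalA mulrC.
Qed.

Lemma lactDl a b u : lact (a + b) u = lact a u + lact b u.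
Proof.
by rewrite /lact -big_split; apply: eq_bigr => g _; rewrite ffunE scalDl.
Qed.

Lemma lact0l u : lact 0 u = 0.
Proof. by apply: (addIr (lact 0 u)); rewrite -lactDl !add0r. Qed.

Lemma lactNl a u : lact (- a) u = - lact a u.
Proof. by apply/eqP; rewrite -addr_eq0 -lactDl addNr lact0l. Qed.

Lemma lactZl c a u : lact (c *: a) u = scal c (lact a u).
Proof.
by rewrite /lact scal_sumr; apply: eq_bigr => g _; rewrite ffunE scalA.
Qed.

Lemma lact_suml (I : finType) (F : I -> A) u :
  lact (\sum_i F i) u = \sum_i lact (F i) u.
Proof. exact: (big_morph (lact^~ u) (fun a b => lactDl a b u) (lact0l u)). Qed.

Lemma lact_conv a b u : lact (gconv a b) u = lact a (lact b u).
Proof.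
rewrite /lact; transitivity (\sum_g \sum_h scal (a h * b (h^-1 * g)%g) (act g u)).
  by apply: eq_bigr => g _; rewrite ffunE scal_suml.
rewrite exchange_big /=; apply: eq_bigr => h _; rewrite act_sum scal_sumr.
rewrite (reindex_inj (mulgI h)) /=; apply: eq_bigr => g _.
by rewrite mulKg actZ scalA actM.
Qed.

Lemma lact_delta h u : lact (gdelta h) u = act h u.
Proof.
rewrite /lact (bigD1 h) //= big1 ?addr0 => [|k /negPf kh].
  by rewrite ffunE eqxx scal1.
by rewrite ffunE kh scal0l.
Qed.

Lemma lact_gone u : lact gone u = u.
Proof. by rewrite gone_delta lact_delta act1. Qed.

End GroupAlgebra.

(** * The action on fractions and on polynomials *)

Section FractionMorphism.
Variables (A : idomainType) (w : {rmorphism A -> A}).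
Hypothesis w0 : forall c, c != 0 -> w c != 0.
Local Notation K := {fraction A}.

Let fmapE (a b : A) : b != 0 -> fmap w (a%:F / b%:F) = (w a)%:F / (w b)%:F.
Proof. exact: (fmap_frac a (rmorphM w) w0). Qed.

Lemma fmap_poly (a : A) : fmap w a%:F = (w a)%:F.
Proof.
by have := fmapE a (oner_neq0 A); rewrite !rmorph1 !divr1.
Qed.

Lemma fmapB : GRing.zmod_morphism (fmap w).
Proof.
move=> f h; have [a [b [b0 ->]]] := fracP f; have [c [d [d0 ->]]] := fracP h.
have [wb0 wd0] : w b != 0 /\ w d != 0 by split; exact: w0.
have F0 (p : A) : p != 0 -> p%:F != 0 :> K by rewrite tofrac_eq0.
rewrite -mulNr addf_div ?F0 // -tofracN -!tofracM -tofracD.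
rewrite !fmapE ?mulf_neq0 // -mulNr addf_div ?F0 //.
by rewrite rmorphD !rmorphM /= rmorphN tofracD !tofracM tofracN.
Qed.

Lemma fmapM : GRing.monoid_morphism (fmap w).
Proof.
split=> [|f h]; first by rewrite -tofrac1 fmap_poly rmorph1.
have [a [b [b0 ->]]] := fracP f; have [c [d [d0 ->]]] := fracP h.
rewrite mulf_div -!tofracM !fmapE ?mulf_neq0 //.
by rewrite mulf_div !rmorphM.
Qed.

End FractionMorphism.

(** The action on polynomials, handled through its laws and its effect on
    coefficients rather than as a substitution. *)
HB.lock Definition wa (R : realType) (n : nat) (g : Bn n) : {mpoly R[i][n]} -> {mpoly R[i][n]} :=
  wact g.

Section Actions.
Variables (R : realType) (n : nat).
Local Notation C := R[i].
Local Notation P := {mpoly C[n]}.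
Local Notation W := (Bn n).
Local Notation A := {ffun W -> C}.
Local Notation K := {fraction P}.

Lemma wa_wact g (p : P) : wact g p = wa g p.
Proof. by rewrite wa.unlock. Qed.
Lemma waD (g : W) : {morph @wa R n g : p q / p + q}.
Proof. by rewrite wa.unlock; exact: wactD. Qed.
Lemma waZ (g : W) (c : C) (p : P) : wa g (c *: p) = c *: wa g p.
Proof. by rewrite wa.unlock; exact: wactZ. Qed.
Lemma waM (g h : W) (p : P) : wa (g * h)%g p = wa g (wa h p).
Proof. by rewrite wa.unlock; exact: wactM. Qed.
Lemma wa1 (p : P) : wa 1%g p = p.
Proof. by rewrite wa.unlock; exact: wact1. Qed.

Lemma wa_is_additive (g : W) : GRing.zmod_morphism (@wa R n g).
Proof. by move=> p q; rewrite wa.unlock /wact comp_mpolyB. Qed.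
HB.instance Definition _ g :=
  GRing.isZmodMorphism.Build P P (@wa R n g) (wa_is_additive g).
HB.instance Definition _ g :=
  GRing.isScalable.Build C P P _ (@wa R n g) (@waZ g).
Lemma wa_is_multiplicative (g : W) : GRing.monoid_morphism (@wa R n g).
Proof.
rewrite wa.unlock; split; first by rewrite /wact; exact: (@comp_mpoly1 _ _ _ _).
by move=> p q; rewrite /wact; exact: rmorphM.
Qed.
HB.instance Definition _ g :=
  GRing.isMonoidMorphism.Build P P (@wa R n g) (wa_is_multiplicative g).

Lemma waC (g : W) (c : C) : wa g c%:MP = c%:MP.
Proof. by rewrite wa.unlock; exact: comp_mpolyC. Qed.

Lemma wa_mul (g : W) (p q : P) : wa g (p * q) = wa g p * wa g q.
Proof. exact: (wa_is_multiplicative g).2. Qed.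

Lemma waB (g : W) (p q : P) : wa g (p - q) = wa g p - wa g q.
Proof. exact: wa_is_additive. Qed.

Lemma waX (g : W) (p : P) m : wa g (p ^+ m) = wa g p ^+ m.
Proof. exact: (rmorphXn (wa g)). Qed.

Lemma wa_prod (g : W) (I : finType) (Q : pred I) (F : I -> P) :
  wa g (\prod_(i | Q i) F i) = \prod_(i | Q i) wa g (F i).
Proof. exact: (rmorph_prod (wa g)). Qed.

Lemma wa_sum (g : W) (I : finType) (Q : pred I) (F : I -> P) :
  wa g (\sum_(i | Q i) F i) = \sum_(i | Q i) wa g (F i).
Proof. exact: (raddf_sum (wa g)). Qed.

Lemma wa_XU (g : W) (i : 'I_n) :
  wa g 'X_i = (-1) ^+ g.1 (g.2 i) *: 'X_(g.2 i) :> P.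
Proof. by rewrite wa.unlock wact_X. Qed.

Lemma wa_neq0 g (p : P) : p != 0 -> wa g p != 0.
Proof. by rewrite wa.unlock; exact: wact_neq0. Qed.

Lemma waVK (g : W) (p : P) : wa g^-1%g (wa g p) = p.
Proof. by rewrite -waM mulVg wa1. Qed.

Definition gsign (g : W) (m : 'X_{1..n}) : C := \prod_k (-1) ^+ (g.1 k * m k).

Lemma wa_Xm (g : W) (m : 'X_{1..n}) :
  wa g 'X_[m] = gsign g (m#((g.2)^-1)%g) *: 'X_[m#((g.2)^-1)%g].
Proof.
rewrite wa.unlock wact_Xm /gsign mpolyXE_id -scaler_prod.
rewrite [RHS](reindex_inj (@perm_inj _ g.2)) /=.
by apply: eq_bigr => i _; rewrite mnmE permK exprZn -exprM.
Qed.

(** A group element permutes the monomials up to sign; everything about the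
    action is read off this formula for coefficients. *)
Lemma mcoeff_wa (g : W) (f : P) (m : 'X_{1..n}) :
  (wa g f)@_m = gsign g m * f@_(m#(g.2)).
Proof.
elim/mpolyind: f => [|c m' p _ _ IH]; first by rewrite raddf0 !mcoeff0 mulr0.
rewrite raddfD /= linearZ /= !mcoeffD IH mulrDr; congr (_ + _).
rewrite wa_Xm !mcoeffZ !mcoeffX [RHS]mulrCA; congr (_ * _).
have [->|ne] := eqVneq m' (m#(g.2)); first by rewrite mpermKV eqxx.
rewrite mulr0; case: eqP => [E|_]; last by rewrite mulr0.
by rewrite -E mpermK eqxx in ne.
Qed.

Definition pact : A -> P -> P := lact *:%R (@wa R n).

Let scDr (c : C) : {morph ( *:%R c : P -> P) : u v / u + v}.
Proof. exact: scalerDr. Qed.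
Let scDl (c d : C) (u : P) : (c + d) *: u = c *: u + d *: u.
Proof. exact: scalerDl. Qed.
Let scA (c d : C) (u : P) : c *: (d *: u) = (c * d) *: u.
Proof. exact: scalerA. Qed.
Let sc1 (u : P) : 1 *: u = u.
Proof. exact: scale1r. Qed.

Lemma pact_is_additive (a : A) : GRing.zmod_morphism (pact a).
Proof.
move=> u v; apply: (canRL (addrK _)).
by rewrite /pact -(lactD scDr (@waD)) subrK.
Qed.
HB.instance Definition _ a :=
  GRing.isZmodMorphism.Build P P (pact a) (pact_is_additive a).
Lemma pact_is_scalable (a : A) : scalable (pact a).
Proof. by move=> c u; rewrite /pact (lactZ scDr scA (@waZ)). Qed.
HB.instance Definition _ a :=
  GRing.isScalable.Build C P P _ (pact a) (pact_is_scalable a).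

Lemma pact_conv (a b : A) f : pact (gconv a b) f = pact a (pact b f).
Proof. exact: (lact_conv scDr scDl scA (@waD) (@waZ) (@waM)). Qed.
Lemma pactDl (a b : A) f : pact (a + b) f = pact a f + pact b f.
Proof. exact: (lactDl _ scDl). Qed.
Lemma pact0l f : pact 0 f = 0.
Proof. exact: (lact0l _ scDl). Qed.
Lemma pactNl (a : A) f : pact (- a) f = - pact a f.
Proof. exact: (lactNl _ scDl). Qed.
Lemma pactZl (c : C) (a : A) f : pact (c *: a) f = c *: pact a f.
Proof. exact: (lactZl _ scDr scA). Qed.
Lemma pact_suml (I : finType) (F : I -> A) f :
  pact (\sum_i F i) f = \sum_i pact (F i) f.
Proof. exact: (lact_suml _ scDl). Qed.
Lemma pact_delta h f : pact (gdelta _ h) f = wa h f.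
Proof. exact: (lact_delta _ scDl sc1). Qed.
Lemma pact1 f : pact (gone _ _) f = f.
Proof. exact: (lact_gone scDl sc1 (@wa1)). Qed.

(** Invariants act as scalars for the group algebra. *)
Lemma pact_inv (a : A) (b f : P) : (forall g, wa g b = b) -> pact a (b * f) = b * pact a f.
Proof.
move=> bI; rewrite /pact /lact mulr_sumr; apply: eq_bigr => g _ /=.
by rewrite wa_mul bI scalerAr.
Qed.

End Actions.

(** * Invariants are polynomials in y *)

Section MpolyInd.
Variables (C : comNzRingType) (n : nat).

Lemma mpoly_alg_ind (Q : {mpoly C[n]} -> Prop) :
  (forall c, Q c%:MP) -> (forall i, Q 'X_i) ->
  (forall p q, Q p -> Q q -> Q (p + q)) ->
  (forall p q, Q p -> Q q -> Q (p * q)) -> forall p, Q p.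
Proof.
move=> QC QX QD QM; elim/mpolyind => [|c m p _ _ IH]; first by rewrite -mpolyC0.
apply: (QD) => //; rewrite -mul_mpolyC; apply: (QM) => //; rewrite mpolyXE_id.
apply: (big_ind Q) => [||i _]; [by rewrite -mpolyC1 | exact: (QM) |].
by elim: (m i) => [|k IHk]; rewrite ?expr0 -?mpolyC1 // exprS; apply: (QM).
Qed.
End MpolyInd.

Section Comp.
Variables (C : comNzRingType) (n k : nat) (t : n.-tuple {mpoly C[k]}).
Lemma compM (p q : {mpoly C[n]}) : (p * q) \mPo t = (p \mPo t) * (q \mPo t).
Proof. exact: rmorphM. Qed.
Lemma compX (p : {mpoly C[n]}) m : (p ^+ m) \mPo t = (p \mPo t) ^+ m.
Proof. exact: rmorphXn. Qed.
Lemma comp_prod (I : finType) (F : I -> {mpoly C[n]}) :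
  (\prod_i F i) \mPo t = \prod_i (F i \mPo t).
Proof. exact: rmorph_prod. Qed.
Lemma comp_sum (I : finType) (F : I -> {mpoly C[n]}) :
  (\sum_i F i) \mPo t = \sum_i (F i \mPo t).
Proof. exact: raddf_sum. Qed.
Lemma compXU i : 'X_i \mPo t = tnth t i.
Proof. by rewrite comp_mpolyXU -tnth_nth. Qed.
End Comp.

Lemma comp_comp (C : comNzRingType) n k l (p : {mpoly C[n]})
    (t : n.-tuple {mpoly C[k]}) (u : k.-tuple {mpoly C[l]}) :
  (p \mPo t) \mPo u = p \mPo [tuple tnth t i \mPo u | i < n].
Proof.
elim/mpoly_alg_ind: p => [c|i|p q IHp IHq|p q IHp IHq].
- by rewrite !comp_mpolyC.
- by rewrite !compXU tnth_mktuple.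
- by rewrite !comp_mpolyD IHp IHq.
by rewrite !compM IHp IHq.
Qed.

Section Invariants.
Variables (R : realType) (n : nat).
Local Notation C := R[i].
Local Notation P := {mpoly C[n]}.

Let cM (t : n.-tuple P) (p q : P) : (p * q) \mPo t = (p \mPo t) * (q \mPo t).
Proof. exact: compM. Qed.

Lemma mcoeff_euler (l : 'I_n) (f : P) m : (f^`M(l) * 'X_l)@_m = f@_m *+ m l.
Proof.
elim/mpolyind: f => [|c k p _ _ IH]; first by rewrite mderiv0 mul0r !mcoeff0 mul0rn.
rewrite mderivD mulrDl !mcoeffD IH mulrnDl; congr (_ + _).
rewrite mderivZ -scalerAl mderiv_monom !mcoeffZ mcoeffX.
by case: eqP => [->|_]; rewrite ?mulr1 ?mulr_natr ?mulr0 ?mul0rn.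
Qed.

(** Write e_r = e_r' + x_l e_(r-1)', where the polynomials with a prime do not
    involve x_l; then e_(r-1)' is the derivative of e_r. *)
Lemma mesym_deriv (l : 'I_n) r :
  (mesym n C r.+1)^`M(l) = mesym n C r - (mesym n C r)^`M(l) * 'X_l.
Proof.
apply/mpolyP => m; rewrite mcoeff_deriv mcoeffB mcoeff_euler !mcoeff_mesym.
have E : mechar r.+1 (m + U_(l)) = mechar r m && (m l == 0%N).
  rewrite /mechar mdegD mdeg1 addn1 eqSS -andbA; congr (_ && _).
  apply/forallP/andP => [H|[/forallP H /eqP l0] i].
    split; first by apply/forallP => i; have := H i; rewrite mnmDE; apply: leq_trans (leq_addr _ _).
    by have := H l; rewrite mnmDE mnm1E eqxx addn1 ltnS leqn0.
  by rewrite mnmDE mnm1E; case: eqP => [<-|_]; rewrite ?l0 ?addn0.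
rewrite E; case: (boolP (mechar r m)) => [/andP[_ /forallP /(_ l)]|_] /=; last first.
  by rewrite !mul0rn subr0.
by case: (m l) => [|[|]] //=; rewrite ?mulr1n ?mulr0n ?subr0 ?subrr ?mul0rn.
Qed.

Lemma mesym_euler r : \sum_l (mesym n C r)^`M(l) * 'X_l = r%:R *: mesym n C r.
Proof.
apply/mpolyP => m; rewrite raddf_sum /= mcoeffZ.
under eq_bigr do rewrite mcoeff_euler.
rewrite sumrMnr -mdegE mcoeff_mesym.
case: (boolP (mechar r m)) => [/andP[/eqP -> _]|_]; rewrite ?mulr0 ?mul0rn //.
by rewrite mulr1.
Qed.

(** Newton's identities: by [mesym_deriv] the sums of e_r^`M(l) x_l^i over l
    reduce, by induction on r, to products of e_j with power sums, and for
    i = 1 such a sum is r e_r. *)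
Lemma newton_mesym (S : P -> Prop) k :
  (forall c, S c%:MP) -> (forall p q, S p -> S q -> S (p + q)) ->
  (forall p q, S p -> S q -> S (p * q)) ->
  (forall i, (0 < i <= k)%N -> S (\sum_l 'X_l ^+ i)) -> S (mesym n C k).
Proof.
move=> SC SD SM Sq.
have SZ c p : S p -> S (c *: p) by rewrite -mul_mpolyC; apply: SM.
have SB p q : S p -> S q -> S (p - q).
  by move=> Sp Sq'; rewrite -scaleN1r; apply: SD => //; apply: SZ.
have [m] := ubnP k; elim: m k Sq => // m IH [|k] Sq km.
  by rewrite mesym0E -mpolyC1.
have Se r : (r <= k)%N -> S (mesym n C r).
  by move=> rk; apply: IH; [move=> i ik; apply: Sq; lia | lia].
have Ss r i : (0 < i)%N -> (r + i <= k.+2)%N ->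
    S (\sum_l (mesym n C r)^`M(l) * 'X_l ^+ i).
  elim: r i => [|r IHr] i i0 ri.
    rewrite big1 => [|l _]; first by rewrite -mpolyC0.
    by rewrite mesym0E -mpolyC1 mderivC mul0r.
  have -> : \sum_l (mesym n C r.+1)^`M(l) * 'X_l ^+ i =
      mesym n C r * (\sum_l 'X_l ^+ i) - \sum_l (mesym n C r)^`M(l) * 'X_l ^+ i.+1.
    rewrite mulr_sumr -sumrB; apply: eq_bigr => l _.
    by rewrite mesym_deriv mulrBl -mulrA -exprS.
  apply: SB; last by apply: IHr => //; rewrite addnS -addSn.
  by apply: SM; [apply: Se | apply: Sq]; lia.
have k2 : (k.+1 + 1 <= k.+2)%N by lia.
have /(SZ k.+1%:R^-1) := Ss k.+1 1%N isT k2.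
under eq_bigr do rewrite expr1.
by rewrite mesym_euler scalerA mulVf ?scale1r // pnatr_eq0.
Qed.

Definition in_Y (p : P) := exists q : P, p = q \mPo [tuple yB R k | k < n].

Lemma in_YC c : in_Y c%:MP.
Proof. by exists c%:MP; rewrite comp_mpolyC. Qed.
Lemma in_YD p q : in_Y p -> in_Y q -> in_Y (p + q).
Proof. by move=> [a ->] [b ->]; exists (a + b); rewrite comp_mpolyD. Qed.
Lemma in_YM p q : in_Y p -> in_Y q -> in_Y (p * q).
Proof. by move=> [a ->] [b ->]; exists (a * b); rewrite rmorphM. Qed.
Lemma in_Y_y k : in_Y (yB R k).
Proof. by exists 'X_k; rewrite comp_mpolyXU -tnth_nth tnth_mktuple. Qed.

Let sq : n.-tuple P := [tuple 'X_i ^+ 2 | i < n].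

(** The last y is the square of the product of the variables, that is e_n of
    the squares, rather than a power sum; the others are power sums of the
    squares. *)
Lemma in_Y_mesym k : (0 < k <= n)%N -> in_Y (mesym n C k \mPo sq).
Proof.
case/andP => k0; rewrite leq_eqVlt => /orP[/eqP Ek|kn].
  rewrite Ek; have n0 : (n.-1 < n)%N by lia.
  have -> : mesym n C n \mPo sq = yB R (Ordinal n0).
    rewrite /yB ifF; last by rewrite /=; lia.
    rewrite -prodrXl mesymnnE comp_prod.
    by apply: eq_bigr => i _; rewrite compXU tnth_mktuple.
  exact: in_Y_y.
apply: (@newton_mesym (fun p => in_Y (p \mPo sq))) => [c|p q|p q|i ik].
- by rewrite comp_mpolyC; exact: in_YC.
- by move=> Hp Hq; rewrite comp_mpolyD; exact: in_YD.
- by move=> Hp Hq; have H := in_YM Hp Hq; rewrite cM.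
have i0 : (i.-1 < n)%N by lia.
have -> : (\sum_l 'X_l ^+ i) \mPo sq = yB R (Ordinal i0).
  rewrite /yB ifT; last by rewrite /=; lia.
  rewrite comp_sum; apply: eq_bigr => l _ /=.
  rewrite compX compXU tnth_mktuple -exprM.
  by congr (_ ^+ _); lia.
exact: in_Y_y.
Qed.

Lemma in_Y_comp k (t : {mpoly C[k]}) (T : k.-tuple P) :
  (forall i, in_Y (tnth T i)) -> in_Y (t \mPo T).
Proof.
move=> YT; rewrite comp_mpolyE.
have Y0 : in_Y 0 by rewrite -mpolyC0; exact: in_YC.
have Y1 : in_Y 1 by rewrite -mpolyC1; exact: in_YC.
apply: (big_ind in_Y) => [//||m _]; first exact: in_YD.
rewrite -mul_mpolyC; apply: in_YM; first exact: in_YC.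
apply: (big_ind in_Y) => [//||i _]; first exact: in_YM.
by elim: (m i) => [|j IH]; rewrite ?expr0 // exprS; apply: in_YM.
Qed.

Lemma comp_sq_perm (s : 'S_n) (h : P) :
  msym s h \mPo sq = wa ([ffun => false], s) (h \mPo sq).
Proof.
elim/mpoly_alg_ind: h => [c|i|p q IHp IHq|p q IHp IHq].
- by rewrite -[c%:MP]mulr1 mul_mpolyC msymZ msym1 comp_mpolyZ waZ -mpolyC1 comp_mpolyC waC.
- have E : (U_(i)#(s^-1)%g = U_(s i))%MM.
    by apply/mnmP => j; rewrite mnmE !mnm1E -(inj_eq (@perm_inj _ s)) permKV.
  rewrite msymX E !compXU !tnth_mktuple [RHS]rmorphXn.
  by rewrite /= wa_XU ffunE expr0 scale1r.
- by rewrite msymD comp_mpolyD [in RHS]comp_mpolyD waD; exact: (f_equal2 +%R IHp IHq).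
by rewrite msymM cM [in RHS]cM wa_mul; exact: (f_equal2 *%R IHp IHq).
Qed.

(** Invariance under the sign changes makes all exponents even, and a
    polynomial in the squares that is invariant under permutations is the
    substitution of the squares in a symmetric polynomial. *)
Lemma invariant_in_Y (p : P) : (forall g, wa g p = p) -> in_Y p.
Proof.
move=> pI.
pose h : P := \sum_(m <- msupp p) p@_m *: 'X_[[multinom (m i)./2 | i < n]].
have ph : p = h \mPo sq.
  rewrite /h raddf_sum {1}[p]mpolyE big_seq_cond [RHS]big_seq_cond /=.
  apply: eq_bigr => m; rewrite andbT mcoeff_msupp => pm.
  rewrite comp_mpolyZ comp_mpolyX mpolyXE_id; congr (_ *: _).
  apply: eq_bigr => i _; rewrite tnth_mktuple mnmE -exprM mul2n.
  have -> : (m i)./2.*2 = m i; last by [].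
  rewrite even_halfK //; apply: contraNN pm => odd_m.
  have := mcoeff_wa ([ffun k => k == i], 1%g) p m.
  rewrite pI /gsign (bigD1 i) //= big1 => [|k /negPf ki]; last by rewrite ffunE ki.
  rewrite ffunE eqxx mul1n mulr1 -signr_odd odd_m mulN1r.
  have -> : m#(1%g : 'S_n) = m by apply/mnmP => k; rewrite mnmE perm1.
  by move/eqP; rewrite -addr_eq0 -mulr2n mulrn_eq0.
pose h' : P := (#|[set: 'S_n]|)%:R^-1 *: \sum_(s : 'S_n) msym s h.
have h'S : h' \is symmetric.
  apply/issymP => s; rewrite /h' msymZ; congr (_ *: _); rewrite raddf_sum.
  rewrite [RHS](reindex_inj (mulIg s)); apply: eq_bigr => t _.
  exact: (esym (msymMm h t s)).
have -> : p = h' \mPo sq.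
  rewrite comp_mpolyZ comp_sum (eq_bigr (fun=> p)) => [|t _]; last first.
    by rewrite comp_sq_perm -ph.
  rewrite sumr_const -[p *+ _]scaler_nat scalerA cardsT mulVf ?scale1r //.
  by rewrite pnatr_eq0 -lt0n; apply/card_gt0P; exists 1%g.
have [t [<- _]] := sym_fundamental h'S.
set S := [tuple _ | i < n].
rewrite comp_comp.
apply: in_Y_comp => i; rewrite !tnth_mktuple; apply: in_Y_mesym.
by rewrite /= ltn_ord.
Qed.

End Invariants.

(** * Annihilators in the group algebra *)

Section Coordinates.
Variables (F : fieldType).

(** Finitely many polynomials live in the span of finitely many monomials, on
    which linear algebra with matrices is available. *)
Lemma mpoly_coords n (I : finType) (f : I -> {mpoly F[n]}) :
  exists (N : nat) (mon : 'I_N -> 'X_{1..n}) (X : I -> 'I_N -> F),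
    injective mon /\ forall i, f i = \sum_j X i j *: 'X_[mon j].
Proof.
pose ms := undup (flatten [seq msupp (f i) | i <- enum I]).
exists (size ms), (fun j => nth 0%MM ms j), (fun i j => (f i)@_(nth 0%MM ms j)).
split=> [j k /eqP|i].
  by rewrite nth_uniq ?undup_uniq // => /eqP/val_inj.
have -> : \sum_(j < size ms) (f i)@_(nth 0%MM ms j) *: 'X_[nth 0%MM ms j] =
    \sum_(m <- ms) (f i)@_m *: 'X_[m].
  by rewrite [RHS](big_nth 0%MM) big_mkord.
apply/mpolyP => m; rewrite raddf_sum /=.
under eq_bigr do rewrite mcoeffZ mcoeffX.
have [mms|nms] := boolP (m \in ms).
  rewrite (bigD1_seq m) ?undup_uniq //= eqxx mulr1 big1 ?addr0 // => k /negPf km.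
  by rewrite km mulr0.
rewrite memN_msupp_eq0 => [|].
  rewrite big_seq big1 // => k kms; case: eqP => [E|_]; last by rewrite mulr0.
  by rewrite -E kms in nms.
apply: contra nms => mf; rewrite mem_undup; apply/flattenP.
by exists (msupp (f i)) => //; apply: map_f; rewrite mem_enum.
Qed.

Lemma mcoeff_sumX n N (mon : 'I_N -> 'X_{1..n}) (c : 'I_N -> F) l :
  injective mon -> (\sum_j c j *: 'X_[mon j])@_(mon l) = c l.
Proof.
move=> mon_inj; rewrite raddf_sum (bigD1 l) //= mcoeffZ mcoeffX eqxx mulr1.
rewrite big1 ?addr0 // => j /negPf jl.
by rewrite mcoeffZ mcoeffX (inj_eq mon_inj) jl mulr0.
Qed.

(** The pseudo-inverse of the matrix X: the rows of 1 - X Y span the linear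
    relations between the rows of X. *)
Lemma generalized_inverse (I : finType) N (X : I -> 'I_N -> F) :
  exists Y : 'I_N -> I -> F,
    forall i l, \sum_k (\sum_j X i j * Y j k) * X k l = X i l.
Proof.
pose M : 'M[F]_(#|I|, N) := \matrix_(i, j) X (enum_val i) j.
exists (fun j k => pinvmx M j (enum_rank k)) => i l.
have -> : X i l = M (enum_rank i) l by rewrite mxE enum_rankK.
rewrite -[in RHS](mulmxKpV (submx_refl M)) [RHS]mxE.
rewrite [RHS](reindex (@enum_rank I)) /=; last exact/onW_bij/enum_rank_bij.
apply: eq_bigr => k _; rewrite !mxE enum_rankK; congr (_ * _).
by apply: eq_bigr => j _; congr (_ * _); rewrite mxE enum_rankK.
Qed.

End Coordinates.

Section Annihilators.
Variables (R : realType) (n : nat).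
Local Notation C := R[i].
Local Notation P := {mpoly C[n]}.
Local Notation W := (Bn n).
Local Notation A := {ffun W -> C}.

Lemma pactE (a : A) (p : P) : pact a p = \sum_g a g *: wa g p.
Proof. by []. Qed.

(** Maschke: the annihilator of p is a left ideal, so it is generated by an
    idempotent, obtained by averaging a linear projection onto it. *)
Lemma annihilator_idempotent (p : P) :
  exists j : A, pact j p = 0 /\ forall a, pact a p = 0 -> gconv a j = a.
Proof.
have [N [mon [X [mon_inj EX]]]] := mpoly_coords (fun g : W => wa g p).
have [Y EY] := generalized_inverse X.
have pactX (a : A) : pact a p = \sum_l (\sum_g a g * X g l) *: 'X_[mon l].
  rewrite pactE (eq_bigr (fun g => \sum_l (a g * X g l) *: 'X_[mon l])) => [|g _]; last first.
    by rewrite EX scaler_sumr; apply: eq_bigr => l _; rewrite scalerA.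
  by rewrite exchange_big /=; apply: eq_bigr => l _; rewrite scaler_suml.
have pact0 (a : A) : pact a p = 0 <-> forall l, \sum_g a g * X g l = 0.
  split=> [E l|E]; last by rewrite pactX big1 // => l _; rewrite E scale0r.
  by have := mcoeff_sumX (fun l => \sum_g a g * X g l) l mon_inj; rewrite -pactX E mcoeff0 => <-.
pose pr (a : A) : A := [ffun k => a k - \sum_g a g * \sum_j X g j * Y j k].
have pr_ann a : pact (pr a) p = 0.
  apply/pact0 => l; under eq_bigr do rewrite ffunE mulrBl mulr_suml.
  rewrite sumrB exchange_big /= -sumrB big1 // => g _.
  under eq_bigr do rewrite -mulrA.
  by rewrite -mulr_sumr EY subrr.
have pr_id a : pact a p = 0 -> pr a = a.
  move/pact0 => E; apply/ffunP => k; rewrite ffunE.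
  under eq_bigr do rewrite mulr_sumr.
  rewrite exchange_big /= big1 ?subr0 // => j _.
  under eq_bigr do rewrite mulrA.
  by rewrite -mulr_suml E mul0r.
have prD a b : pr (a + b) = pr a + pr b.
  apply/ffunP => k; rewrite !ffunE addrACA -opprD -big_split; congr (_ - _).
  by apply: eq_bigr => g _; rewrite ffunE mulrDl.
have prZ c a : pr (c *: a) = c *: pr a.
  apply/ffunP => k; rewrite !ffunE scalerBr; congr (_ - _).
  by rewrite scaler_sumr; apply: eq_bigr => g _; rewrite ffunE -scalerAl.
pose N1 : C := (#|[set: W]|)%:R^-1.
have N0 : (#|[set: W]|)%:R != 0 :> C.
  by rewrite pnatr_eq0 -lt0n; apply/card_gt0P; exists 1%g.
(* the image of 1 under the average of the conjugates of pr, which commutes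
   with left multiplication *)
pose j : A := N1 *: \sum_h gconv (gdelta _ h^-1%g) (pr (gdelta _ h)).
exists j; split.
  rewrite /j pactZl pact_suml big1 ?scaler0 // => h _.
  by rewrite pact_conv pr_ann raddf0.
move=> a ap0.
have prS (I : finType) (G : I -> A) : pr (\sum_i G i) = \sum_i pr (G i).
  have pr0 : pr 0 = 0 by apply: (addIr (pr 0)); rewrite -prD !add0r.
  exact: (big_morph pr prD pr0).
have dj g : gconv (gdelta _ g) j =
    N1 *: \sum_h gconv (gdelta _ h^-1%g) (pr (gdelta _ (h * g)%g)).
  rewrite /j gconvZr gconv_sumr; congr (_ *: _); rewrite (reindex_inj (mulIg g)) /=.
  by apply: eq_bigr => h _; rewrite gconvA gdeltaM invMg mulKVg.
rewrite {1}[a]ffun_delta gconv_suml.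
have -> : \sum_g gconv (a g *: gdelta _ g) j =
   N1 *: \sum_h gconv (gdelta _ h^-1%g) (pr (gconv (gdelta _ h) a)).
  transitivity (N1 *: \sum_g \sum_h a g *: gconv (gdelta _ h^-1%g) (pr (gdelta _ (h * g)%g))).
    rewrite scaler_sumr; apply: eq_bigr => g _; rewrite gconvZl dj !scaler_sumr.
    by apply: eq_bigr => h _; rewrite !scalerA mulrC.
  congr (_ *: _); rewrite exchange_big; apply: eq_bigr => h _ /=.
  rewrite [in RHS](ffun_delta a) gconv_sumr prS gconv_sumr; apply: eq_bigr => g _.
  by rewrite gconvZr gdeltaM prZ gconvZr.
rewrite (eq_bigr (fun=> a)) => [|h _].
  rewrite sumr_const -[a *+ _]scaler_nat scalerA -[#|_|]cardsT mulVf //.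
  by rewrite scale1r.
by rewrite pr_id ?pact_conv ?ap0 ?raddf0 // gconvA gdeltaM mulVg -gone_delta gconv1l.
Qed.

(** With 1 - q the idempotent generating the annihilator of p, the element q e
    is an idempotent below e that fixes p, hence equals e. *)
Lemma primitive_annihilator (e : A) (p : P) (a : A) :
  primitive_idempotent e -> pact e p = p -> p != 0 -> pact a p = 0 -> gconv a e = 0.
Proof.
move=> [e0 ee eprim] ep p0 ap.
have [j [jp jid]] := annihilator_idempotent p.
have jj : gconv j j = j by exact: jid.
pose q : A := gone R n - j.
have qp : pact q p = p by rewrite /q pactDl pactNl pact1 jp subr0.
have qq : gconv q q = q.
  by rewrite /q gconvDl !gconvDr !gconvNl !gconvNr !gconv1l !gconv1r jj opprK addNr addr0.
have aq b : pact b p = 0 -> gconv b q = 0.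
  by move/jid => bj; rewrite /q gconvDr gconvNr gconv1r bj subrr.
have eq : gconv e q = q.
  have : gconv (gone R n - e) q = 0.
    by apply: aq; rewrite pactDl pactNl pact1 ep subrr.
  by rewrite gconvDl gconvNl gconv1l => /eqP; rewrite subr_eq0 => /eqP.
pose x : A := gconv q e.
have xx : gconv x x = x.
  by rewrite /x -gconvA [gconv e _]gconvA eq gconvA qq.
have ex : gconv e x = x by rewrite /x gconvA eq.
have xe : gconv x e = x by rewrite /x -gconvA ee.
have orth : orth_idempotents x (e - x).
  split=> //.
  - by rewrite gconvDl gconvDr [gconv (- x) _]gconvDr !gconvNl !gconvNr
      ee xx ex xe opprK addNr addr0.
  - by rewrite gconvDr gconvNr xe xx subrr.
  by rewrite gconvDl gconvNl ex xx subrr.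
have [x0|/eqP] := eprim _ _ orth (esym (subrKC _ _)).
  have : pact x p = p by rewrite /x pact_conv ep qp.
  by rewrite x0 pact0l => E; rewrite -E eqxx in p0.
rewrite subr_eq0 => /eqP E.
by rewrite {1}E /x gconvA aq // gconv0l.
Qed.

End Annihilators.

(** * Transfer by differential operators *)

Section InvariantGenerators.
Variables (R : realType) (n : nat).
Local Notation C := R[i].
Local Notation P := {mpoly C[n]}.

Lemma wa_sqX (g : Bn n) (i : 'I_n) : wa g ('X_i ^+ 2) = 'X_(g.2 i) ^+ 2 :> P.
Proof. by rewrite [LHS]rmorphXn /= wa_XU exprZn sqrr_sign scale1r. Qed.

Lemma yB_inv (g : Bn n) (k : 'I_n) : wa g (yB R k) = yB R k.
Proof.
rewrite /yB; case: ifP => _.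
  rewrite wa_sum [RHS](reindex_inj (@perm_inj _ g.2)); apply: eq_bigr => i _.
  by rewrite !exprM waX wa_sqX.
rewrite -prodrXl wa_prod [RHS](reindex_inj (@perm_inj _ g.2)).
by apply: eq_bigr => i _; rewrite /= wa_sqX.
Qed.

(** The matrix J is, up to factors on its rows and columns, a Vandermonde
    matrix with permuted rows; for the Jacobian matrix of y this computes the
    determinant. *)
Lemma det_monomial_rows (A : comNzRingType) (J : 'M[A]_n) (x c z : 'I_n -> A) (s : 'S_n) :
  (forall k i, J k i * x i = c k * z i ^+ s k) ->
  \det J * \prod_i x i = \prod_k c k * ((-1) ^+ s *
    \prod_(p : 'I_n * 'I_n | (p.1 < p.2)%N) (z p.2 - z p.1)).
Proof.
move=> E; pose a : 'rV[A]_n := \row_i z i.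
have EM : J *m diag_mx (\row_i x i) =
    diag_mx (\row_k c k) *m (row_perm s (Vandermonde n a)).
  by apply/matrixP => k i; rewrite mul_mx_diag mul_diag_mx !mxE E.
have := congr1 determinant EM; rewrite !det_mulmx !det_diag row_permE det_mulmx det_perm.
rewrite det_Vandermonde pair_big_dep /= => Ed.
transitivity (\det J * \prod_i (\row_i x i) 0 i).
  by congr (_ * _); apply: eq_bigr => i _; rewrite mxE.
rewrite Ed; congr (_ * (_ * _)); apply: eq_bigr => i _; by rewrite !mxE.
Qed.

Lemma sq_vandermonde_perm (A : comNzRingType) (z : 'I_n -> A) (s : 'S_n) :
  \prod_(p : 'I_n * 'I_n | (p.1 < p.2)%N) (z (s p.2) - z (s p.1)) ^+ 2 =
  \prod_(p : 'I_n * 'I_n | (p.1 < p.2)%N) (z p.2 - z p.1) ^+ 2.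
Proof.
(* the product over all ordered pairs p.1 != p.2 is visibly symmetric, and
   equals the product of the squares up to a sign not depending on z *)
have E (y : 'I_n -> A) :
    \prod_(p : 'I_n * 'I_n | (p.1 < p.2)%N) (y p.2 - y p.1) ^+ 2 =
    (\prod_(p : 'I_n * 'I_n | (p.1 < p.2)%N) (-1)) *
    \prod_(p : 'I_n * 'I_n | p.1 != p.2) (y p.2 - y p.1).
  have E1 : \prod_(p : 'I_n * 'I_n | (p.1 != p.2) && (p.1 < p.2)%N) (y p.2 - y p.1) =
      \prod_(p : 'I_n * 'I_n | (p.1 < p.2)%N) (y p.2 - y p.1).
    by apply: eq_bigl => p; rewrite -val_eqE neq_ltn; case: ltngtP.
  have E2 : \prod_(p : 'I_n * 'I_n | (p.1 != p.2) && ~~ (p.1 < p.2)%N) (y p.2 - y p.1) =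
      \prod_(p : 'I_n * 'I_n | (p.1 < p.2)%N) - (y p.2 - y p.1).
    have sw : injective (fun p : 'I_n * 'I_n => (p.2, p.1)) by move=> [? ?] [? ?] [-> ->].
    rewrite (reindex_inj sw) /=; apply: eq_big => p.
      by rewrite -val_eqE neq_ltn; case: ltngtP.
    by rewrite opprB.
  rewrite [X in _ = _ * X](bigID (fun p : 'I_n * 'I_n => (p.1 < p.2)%N)) /= E1 E2.
  rewrite -!big_split /=; apply: eq_bigr => p _.
  by rewrite mulN1r mulrN opprK expr2.
rewrite (E (fun i => z (s i))) (E z); congr (_ * _).
have inj2 : injective (fun p : 'I_n * 'I_n => (s p.1, s p.2)).
  by move=> [i j] [k l] [/perm_inj -> /perm_inj ->].
rewrite [RHS](reindex_inj inj2) /=; apply: eq_bigl => p.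
by rewrite (inj_eq perm_inj).
Qed.

Lemma Delta_sq_inv (c0 : C) (g : Bn n) :
  wa g (Delta n c0 ^+ 2) = Delta n c0 ^+ 2.
Proof.
rewrite /Delta exprZn exprMn -!prodrXl waZ wa_mul; congr (_ *: (_ * _)).
  rewrite wa_prod [RHS](reindex_inj (@perm_inj _ g.2)).
  by apply: eq_bigr => i _; rewrite /= wa_sqX.
rewrite wa_prod -[RHS](sq_vandermonde_perm (fun i => 'X_i ^+ 2) g.2).
apply: eq_bigr => p _.
by rewrite waX waB !wa_sqX.
Qed.

Lemma Delta_neq0 (c0 : C) : c0 != 0 -> Delta n c0 != 0.
Proof.
move=> c00; rewrite /Delta -mul_mpolyC !mulf_neq0 ?mpolyC_eq0 //.
  rewrite prodf_seq_neq0; apply/allP => j _.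
  by rewrite /= -msize_poly_eq0 msizeX.
rewrite prodf_seq_neq0; apply/allP => p _; apply/implyP => lt_p.
by rewrite subr_eq0 mpolyX_inj; apply: contraTneq lt_p => ->; rewrite ltnn.
Qed.

Lemma Delta_X (c0 : C) (i : 'I_n) : exists r, Delta n c0 = 'X_i * r.
Proof.
exists (c0 *: ((\prod_(j | j != i) 'X_j) *
  \prod_(p : 'I_n * 'I_n | (p.1 < p.2)%N) ('X_(p.2) ^+ 2 - 'X_(p.1) ^+ 2))).
by rewrite /Delta (bigD1 i) //= -scalerAr mulrA.
Qed.

End InvariantGenerators.

Section Derivations.
Variables (R : realType) (n : nat).
Local Notation C := R[i].
Local Notation P := {mpoly C[n]}.
Local Notation W := (Bn n).
Local Notation A := {ffun W -> C}.
Variables (K : fieldType) (io : {rmorphism P -> K}).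
Hypothesis io_inj : injective io.
Hypothesis io_frac : forall f, exists a b, b != 0 /\ f = io a / io b.
Variable act : W -> {rmorphism K -> K}.
Hypothesis act_io : forall g p, act g (io p) = io (wa g p).
Variable dx : 'I_n -> K -> K.
Hypothesis dxD : forall i, {morph dx i : f h / f + h}.
Hypothesis dxM : forall i f h, dx i (f * h) = dx i f * h + f * dx i h.
Hypothesis dx_io : forall i p, dx i (io p) = io p^`M(i).

Definition cst (c : C) : K := io c%:MP.
Definition jac : 'M[K]_n := \matrix_(k, i) io (yB R k)^`M(i).
Hypothesis jac_unit : jac \in unitmx.
Definition dy (j : 'I_n) (f : K) : K := \sum_i invmx jac i j * dx i f.

Lemma io_eq0 p : (io p == 0) = (p == 0).
Proof. by rewrite -(inj_eq io_inj) rmorph0. Qed.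

Lemma ioZ c p : io (c *: p) = cst c * io p.
Proof. by rewrite -mul_mpolyC rmorphM. Qed.

Lemma act_cst g c : act g (cst c) = cst c.
Proof. by rewrite /cst act_io waC. Qed.

Lemma act_mul g h f : act (g * h)%g f = act g (act h f).
Proof.
have [a [b [b0 ->]]] := io_frac f.
by rewrite !fmorph_div /= !act_io !waM.
Qed.

Lemma act_1 f : act 1%g f = f.
Proof. by have [a [b [b0 ->]]] := io_frac f; rewrite fmorph_div /= !act_io !wa1. Qed.

Lemma act_KV g f : act g (act g^-1%g f) = f.
Proof. by rewrite -act_mul mulgV act_1. Qed.

Lemma dx_cst i c : dx i (cst c) = 0.
Proof. by rewrite dx_io mderivC rmorph0. Qed.

Lemma dx_0 i : dx i 0 = 0.
Proof. by apply: (addIr (dx i 0)); rewrite -dxD !add0r. Qed.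

Lemma dx_dy i f : dx i f = \sum_j io (yB R j)^`M(i) * dy j f.
Proof.
have E : \sum_l (invmx jac *m jac) l i * dx l f = dx i f.
  rewrite mulVmx // (bigD1 i) //= big1 ?addr0 => [|l li]; first by rewrite mxE eqxx mul1r.
  by rewrite mxE (negPf li) mul0r.
rewrite -E; transitivity (\sum_l \sum_j io (yB R j)^`M(i) * (invmx jac l j * dx l f)).
  apply: eq_bigr => l _; rewrite mxE mulr_suml; apply: eq_bigr => j _.
  by rewrite mxE mulrA; congr (_ * _); rewrite mulrC.
by rewrite exchange_big /=; apply: eq_bigr => j _; rewrite mulr_sumr.
Qed.

Lemma dyD j : {morph dy j : f h / f + h}.
Proof.
by move=> f h; rewrite /dy -big_split; apply: eq_bigr => i _; rewrite dxD mulrDr.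
Qed.

Lemma dyM j f h : dy j (f * h) = dy j f * h + f * dy j h.
Proof.
rewrite /dy mulr_suml mulr_sumr -big_split; apply: eq_bigr => i _ /=.
by rewrite dxM mulrDr mulrA [f * (_ * _)]mulrCA.
Qed.

Lemma dy_cst j c : dy j (cst c) = 0.
Proof. by apply: big1 => i _; rewrite dx_cst mulr0. Qed.

Lemma dy_y j k : dy j (io (yB R k)) = (k == j)%:R.
Proof.
have /matrixP /(_ k j) := mulmxV jac_unit; rewrite !mxE => <-.
by apply: eq_bigr => i _; rewrite mxE dx_io mulrC.
Qed.

(** A derivation is determined by its values on the x_i, and these are
    determined by its values on the y_k since the Jacobian matrix is
    invertible. *)
Lemma der_eq0 (D : K -> K) :
  {morph D : f h / f + h} -> (forall f h, D (f * h) = D f * h + f * D h) ->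
  (forall c, D (cst c) = 0) -> (forall k, D (io (yB R k)) = 0) -> forall f, D f = 0.
Proof.
move=> DD DM Dc Dy.
have D0 : D 0 = 0 by apply: (addIr (D 0)); rewrite -DD !add0r.
have Dp p : D (io p) = \sum_i io p^`M(i) * D (io 'X_i).
  elim/mpoly_alg_ind: p => [c|i|p q IHp IHq|p q IHp IHq].
  - by rewrite [LHS]Dc big1 // => i _; rewrite mderivC rmorph0 mul0r.
  - rewrite (bigD1 i) //= big1 => [|j /negPf ji].
      rewrite mderivX mnm1E eqxx scale1r -{2}[U_(i)%MM]add0m addmK.
      by rewrite mpolyX0 rmorph1 mul1r addr0.
    by rewrite mderivX mnm1E eq_sym ji scale0r rmorph0 mul0r.
  - rewrite rmorphD DD IHp IHq -big_split; apply: eq_bigr => i _ /=.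
    by rewrite mderivD rmorphD mulrDl.
  rewrite rmorphM DM IHp IHq mulr_suml mulr_sumr -big_split; apply: eq_bigr => i _ /=.
  by rewrite mderivM rmorphD !rmorphM /= mulrDl -!mulrA [D _ * _]mulrC.
have J0 : jac *m (\col_i D (io 'X_i)) = 0.
  apply/colP => k; rewrite [RHS]mxE -[RHS](Dy k) Dp mxE.
  by apply: eq_bigr => i _; rewrite !mxE.
have DX i : D (io 'X_i) = 0.
  have : \col_i D (io 'X_i) = 0 by rewrite -(mulKmx jac_unit (\col_i _)) J0 mulmx0.
  by move=> /colP /(_ i); rewrite !mxE.
have Dp0 p : D (io p) = 0 by rewrite Dp big1 // => i _; rewrite DX mulr0.
move=> f; have [a [b [b0 Ef]]] := io_frac f.
have bK : io b != 0 by rewrite io_eq0.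
have : D (f * io b) = 0 by rewrite Ef divfK.
rewrite DM Dp0 mulr0 addr0 => /eqP; rewrite mulf_eq0 (negPf bK) orbF.
by move/eqP.
Qed.

(** Conjugating a derivation by g gives a derivation with the same values on the
    invariants y_k. *)
Lemma act_dy g j f : act g (dy j f) = dy j (act g f).
Proof.
pose D f := act g (dy j (act g^-1%g f)) - dy j f.
have D0 h : D h = 0.
  apply: der_eq0 => {h} [f1 h|f1 h|c|k]; rewrite /D.
  - by rewrite rmorphD !dyD rmorphD opprD addrACA.
  - rewrite rmorphM !dyM rmorphD !rmorphM /= !act_KV opprD addrACA.
    by rewrite mulrBl mulrBr.
  - by rewrite act_cst !dy_cst rmorph0 subr0.
  by rewrite act_io yB_inv !dy_y rmorph_nat subrr.
have := D0 (act g f); rewrite /D -act_mul mulVg act_1 => /eqP.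
by rewrite subr_eq0 => /eqP.
Qed.

Variable c0 : C.
Hypothesis c0_neq0 : c0 != 0.
Let D2 : K := io (Delta n c0).
Let D2_neq0 : D2 != 0.
Proof. by rewrite io_eq0; exact: Delta_neq0. Qed.

(** The functions regular outside the reflection hyperplanes. *)
Definition reg (f : K) := exists (p : P) (m : nat), f = io p / D2 ^+ m.

Lemma reg_io p : reg (io p).
Proof. by exists p, 0%N; rewrite expr0 divr1. Qed.
Lemma reg_cst c : reg (cst c).
Proof. exact: reg_io. Qed.
Lemma reg1 : reg 1.
Proof. by rewrite -(rmorph1 io); exact: reg_io. Qed.
Lemma reg0 : reg 0.
Proof. by rewrite -(rmorph0 io); exact: reg_io. Qed.
Lemma regM f h : reg f -> reg h -> reg (f * h).
Proof.
move=> [p [m ->]] [q [k ->]]; exists (p * q), (m + k)%N.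
by rewrite mulf_div -rmorphM -exprD.
Qed.
Lemma regD f h : reg f -> reg h -> reg (f + h).
Proof.
move=> [p [m ->]] [q [k ->]].
exists (p * Delta n c0 ^+ k + q * Delta n c0 ^+ m), (m + k)%N.
by rewrite addf_div ?expf_neq0 // rmorphD !rmorphM !rmorphXn -exprD.
Qed.
Lemma regN f : reg f -> reg (- f).
Proof. by move=> [p [m ->]]; exists (- p), m; rewrite rmorphN mulNr. Qed.
Lemma reg_sum (I : finType) (F : I -> K) : (forall i, reg (F i)) -> reg (\sum_i F i).
Proof. by move=> rF; apply: (big_ind reg) => //; [exact: reg0 | exact: regD]. Qed.
Lemma reg_prod (I : finType) (F : I -> K) : (forall i, reg (F i)) -> reg (\prod_i F i).
Proof.
by move=> rF; apply: (big_ind reg) => //; [exact: reg1 | exact: regM].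
Qed.
Lemma reg_exp f m : reg f -> reg (f ^+ m).
Proof.
by move=> rf; elim: m => [|m IH]; [exact: reg1 | rewrite exprS; exact: regM].
Qed.
Lemma reg_Dinv : reg D2^-1.
Proof. by exists 1, 1%N; rewrite rmorph1 div1r. Qed.

Lemma reg_Xinv m : reg (io 'X_[m])^-1.
Proof.
have rX i : reg (io 'X_i)^-1.
  have [r Er] := Delta_X c0 i; have EK : D2 = io 'X_i * io r by rewrite /D2 Er rmorphM.
  have /norP[X0 r0] : ~~ ((io 'X_i == 0) || (io r == 0)) by rewrite -mulf_eq0 -EK.
  have -> : (io 'X_i)^-1 = io r / D2 by rewrite EK invfM mulrCA divff ?mulr1.
  by exists r, 1%N.
rewrite mpolyXE_id rmorph_prod -prodfV; apply: reg_prod => i /=.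
by rewrite rmorphXn -exprVn; exact: reg_exp.
Qed.

Lemma act_D2 g : act g (D2 ^+ 2) = D2 ^+ 2.
Proof. by rewrite -rmorphXn act_io; congr (io _); exact: Delta_sq_inv. Qed.

Lemma act_D2X g m : act g (D2 ^+ (2 * m)) = D2 ^+ (2 * m).
Proof. by rewrite exprM rmorphXn /= act_D2. Qed.

(** Even powers of Delta are invariant, odd ones only up to sign. *)
Lemma reg_even f : reg f -> exists p m, f = io p / D2 ^+ (2 * m).
Proof.
move=> [p [m ->]]; exists (p * Delta n c0 ^+ m), m.
by rewrite rmorphM rmorphXn mul2n -addnn exprD -mulf_div divff ?mulr1 // expf_neq0.
Qed.

Lemma reg_act g f : reg f -> reg (act g f).
Proof.
move=> /reg_even[p [m ->]]; rewrite fmorph_div act_io act_D2X.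
by exists (wa g p), (2 * m)%N.
Qed.

Lemma reg_dx i f : reg f -> reg (dx i f).
Proof.
move=> [p [m ->]]; rewrite dxM; apply: regD; apply: regM; try exact: reg_io.
- by rewrite dx_io; exact: reg_io.
- by rewrite -exprVn; apply: reg_exp; exact: reg_Dinv.
rewrite -exprVn; elim: m => [|m IH].
  by rewrite expr0; have -> : dx i 1 = 0; [rewrite -(dx_cst i 1) /cst rmorph1 | exact: reg0].
rewrite exprS dxM; apply: regD; apply: regM => //; try exact: reg_Dinv; last first.
  by apply: reg_exp; exact: reg_Dinv.
(* 0 = d(D D^-1) *)
have : dx i (D2 * D2^-1) = 0 by rewrite divff // -(dx_cst i 1) /cst rmorph1.
rewrite dxM => /eqP; rewrite addr_eq0 => /eqP E.
have -> : dx i D2^-1 = - (D2^-1 * D2^-1 * dx i D2).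
  by rewrite -[LHS](mulKf D2_neq0) -[D2 * dx i _]opprK -E; ring.
apply: regN; apply: regM; first by apply: regM; exact: reg_Dinv.
by rewrite dx_io; exact: reg_io.
Qed.

Variable Dt : (K -> K) -> Prop.
Hypothesis Dt_cst : forall c, Dt (fun f => cst c * f).
Hypothesis Dt_y : forall j, Dt (fun f => io (yB R j) * f).
Hypothesis Dt_d : forall j, Dt (dy j).
Hypothesis Dt_Delta : Dt (fun f => D2 ^- 2 * f).
Hypothesis Dt_add : forall Q1 Q2, Dt Q1 -> Dt Q2 -> Dt (fun f => Q1 f + Q2 f).
Hypothesis Dt_comp : forall Q1 Q2, Dt Q1 -> Dt Q2 -> Dt (fun f => Q1 (Q2 f)).
Hypothesis Dt_ind : forall T : (K -> K) -> Prop,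
  (forall c, T (fun f => cst c * f)) -> (forall j, T (fun f => io (yB R j) * f)) ->
  (forall j, T (dy j)) -> T (fun f => D2 ^- 2 * f) ->
  (forall Q1 Q2, T Q1 -> T Q2 -> T (fun f => Q1 f + Q2 f)) ->
  (forall Q1 Q2, T Q1 -> T Q2 -> T (fun f => Q1 (Q2 f))) -> forall Q, Dt Q -> T Q.

Lemma Dt_act Q g f : Dt Q -> act g (Q f) = Q (act g f).
Proof.
move=> DQ; move: f; elim/Dt_ind: Q / DQ => [c|j|j||Q1 Q2 E1 E2|Q1 Q2 E1 E2] f.
- by rewrite rmorphM /= act_cst.
- by rewrite rmorphM /= act_io yB_inv.
- exact: act_dy.
- by rewrite rmorphM fmorphV /= act_D2.
- by rewrite rmorphD /= E1 E2.
by rewrite E1 E2.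
Qed.

Lemma Dt_clin Q : Dt Q ->
  {morph Q : f h / f + h} /\ forall c f, Q (cst c * f) = cst c * Q f.
Proof.
move=> DQ; elim/Dt_ind: Q / DQ => [c|j|j||Q1 Q2 [A1 Z1] [A2 Z2]|Q1 Q2 [A1 Z1] [A2 Z2]].
- by split=> [f h|k f]; rewrite ?mulrDr // mulrCA.
- by split=> [f h|k f]; rewrite ?mulrDr // mulrCA.
- split=> [f h|k f]; first by rewrite dyD.
  by rewrite dyM dy_cst mul0r add0r.
- by split=> [f h|k f]; rewrite ?mulrDr // mulrCA.
- by split=> [f h|k f]; rewrite ?A1 ?A2 ?Z1 ?Z2 ?mulrDr // addrACA.
by split=> [f h|k f]; rewrite ?A2 ?A1 ?Z2 ?Z1.
Qed.

Let unitP (q : P) := reg (io q)^-1.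

Let unitM p q : unitP p -> unitP q -> unitP (p * q).
Proof. by rewrite /unitP rmorphM invfM; exact: regM. Qed.

Let unitC c : c != 0 -> unitP c%:MP.
Proof.
move=> c00; rewrite /unitP; have cK : io c%:MP != 0 by rewrite io_eq0 mpolyC_eq0.
have E : io c%:MP * cst c^-1 = 1.
  by rewrite -rmorphM -mpolyCM divff // mpolyC1 rmorph1.
by rewrite -[_^-1]mulr1 -E mulKf //; exact: reg_cst.
Qed.

Let unitX m : unitP 'X_[m].
Proof. exact: reg_Xinv. Qed.

Let unit_prod (I : finType) (F : I -> P) : (forall i, unitP (F i)) -> unitP (\prod_i F i).
Proof.
move=> uF; apply: (big_ind unitP) => [|x y ux uy|i _].
- by rewrite /unitP rmorph1 invr1; exact: reg1.
- by have := unitM ux uy.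
exact: uF.
Qed.

Let prodX : \prod_i 'X_i = 'X_[[multinom 1%N | _ < n]] :> P.
Proof. by rewrite mpolyXE_id; apply: eq_bigr => i _; rewrite mnmE. Qed.

Let unit_vdm : unitP (\prod_(p : 'I_n * 'I_n | (p.1 < p.2)%N) ('X_(p.2) ^+ 2 - 'X_(p.1) ^+ 2)).
Proof.
set V := \prod_(p | _) _; rewrite /unitP.
have ED : D2 = cst c0 * (io (\prod_i 'X_i) * io V) by rewrite -rmorphM -ioZ.
have /norP[c0K /norP[X0 V0]] : ~~ ((cst c0 == 0) || ((io (\prod_i 'X_i) == 0) || (io V == 0))).
  by rewrite -!mulf_eq0 -ED.
have -> : (io V)^-1 = cst c0 * io (\prod_i 'X_i) * D2^-1.
  by rewrite ED !invfM; field; rewrite c0K X0 V0.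
by apply: regM reg_Dinv; apply: regM; exact: reg_io.
Qed.

Let yB_deriv_unit k : exists2 c : P, unitP c &
  forall i, (yB R k)^`M(i) * 'X_i = c * ('X_i ^+ 2) ^+ yexp k.
Proof.
rewrite /yB /yexp; case: ifP => kn.
  exists (2 * k.+1)%:R%:MP => [|i]; first by apply: unitC; rewrite pnatr_eq0.
  rewrite raddf_sum mulr_suml (bigD1 i) //= big1 ?addr0 => [|l li].
    by rewrite mpolyXn mderiv_monom mulmnE mnm1E eqxx mul1n -mpolyXn -exprM mul_mpolyC.
  by rewrite mpolyXn mderiv_monom mulmnE mnm1E (negPf li) mul0n scale0r.
exists (2%:R%:MP * 'X_[[multinom 1%N | _ < n] *+ 2]) => [|i].
  by apply: unitM => //; apply: unitC; rewrite pnatr_eq0.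
rewrite prodX [in LHS]mpolyXn [LHS]mderiv_monom mulmnE mnmE mul1n expr0 mulr1.
by rewrite mul_mpolyC.
Qed.

Let jacP : 'M[P]_n := \matrix_(k, i) (yB R k)^`M(i).

(** The Jacobian determinant is Delta up to constants and powers of the x_i,
    hence invertible in the ring of regular functions. *)
Let unit_det : unitP (\det jacP).
Proof.
have [c uc Ec] := fin_all_exists2 yB_deriv_unit.
have s_inj : injective (fun k : 'I_n => Ordinal (yexp_ltn k)).
  by move=> k l /(congr1 val) /= /yexp_inj.
have E k i : jacP k i * 'X_i = c k * ('X_i ^+ 2) ^+ (perm s_inj k).
  by rewrite mxE permE; exact: Ec.
have Ed := det_monomial_rows E.
have u : unitP (\det jacP * \prod_i 'X_i).
  rewrite Ed; apply: unitM; first exact: unit_prod.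
  apply: unitM unit_vdm; case: (odd_perm _).
    by rewrite expr1 -mpolyC1 -mpolyCN; apply: unitC; rewrite oppr_eq0 oner_eq0.
  by rewrite expr0 -mpolyC1; apply: unitC; rewrite oner_eq0.
have X0 : io (\prod_i 'X_i) != 0 by rewrite prodX io_eq0 -msize_poly_eq0 msizeX.
rewrite /unitP; have -> : (io (\det jacP))^-1 =
    io (\prod_i 'X_i) * (io (\det jacP * \prod_i 'X_i))^-1.
  by rewrite rmorphM invfM mulrCA divff ?mulr1.
by apply: regM => //; exact: reg_io.
Qed.

Lemma reg_inv_jac j k : reg (invmx jac j k).
Proof.
have EJ : jac = map_mx io jacP by apply/matrixP => k' i; rewrite !mxE.
rewrite /invmx jac_unit EJ mxE -map_mx_adj mxE det_map_mx.
by apply: regM; [exact: unit_det | exact: reg_io].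
Qed.

Lemma Dt_reg Q f : Dt Q -> reg f -> reg (Q f).
Proof.
move=> DQ; move: f; elim/Dt_ind: Q / DQ => [c|j|j||Q1 Q2 E1 E2|Q1 Q2 E1 E2] f rf.
- by apply: regM => //; exact: reg_cst.
- by apply: regM => //; exact: reg_io.
- by apply: reg_sum => i; apply: regM; [exact: reg_inv_jac | exact: reg_dx].
- by apply: regM => //; rewrite -exprVn; apply: reg_exp; exact: reg_Dinv.
- by apply: regD; [exact: E1 | exact: E2].
by apply: E1; exact: E2.
Qed.

Definition dop (L : K -> K) := exists2 Q, Dt Q & Q =1 L.

Lemma dop_add L1 L2 : dop L1 -> dop L2 -> dop (fun f => L1 f + L2 f).
Proof.
move=> [Q1 D1 E1] [Q2 D2' E2]; exists (fun f => Q1 f + Q2 f); first exact: Dt_add.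
by move=> f; rewrite E1 E2.
Qed.

Lemma dop_comp L1 L2 : dop L1 -> dop L2 -> dop (fun f => L1 (L2 f)).
Proof.
move=> [Q1 D1 E1] [Q2 D2' E2]; exists (fun f => Q1 (Q2 f)); first exact: Dt_comp.
by move=> f; rewrite E2 E1.
Qed.

Lemma dop_in_Y p : in_Y p -> dop (fun f => io p * f).
Proof.
move=> [q ->]; elim/mpoly_alg_ind: q =>
  [c|i|p1 p2 [Q1 D1 E1] [Q2 D2' E2]|p1 p2 [Q1 D1 E1] [Q2 D2' E2]].
- by exists (fun f => cst c * f) => // f; rewrite comp_mpolyC.
- by exists (fun f => io (yB R i) * f) => // f; rewrite compXU tnth_mktuple.
- exists (fun f => Q1 f + Q2 f); first exact: Dt_add.
  by move=> f; rewrite comp_mpolyD rmorphD mulrDl E1 E2.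
exists (fun f => Q1 (Q2 f)); first exact: Dt_comp.
by move=> f; rewrite compM rmorphM -mulrA E1 E2.
Qed.

(** Multiplication by an invariant regular function is one of the operators: its
    numerator over a power of Delta^2 is an invariant polynomial. *)
Lemma dop_inv b : reg b -> (forall g, act g b = b) -> dop (fun f => b * f).
Proof.
move=> /reg_even[p [m Eb]] bI.
have pI g : wa g p = p.
  apply: io_inj; have Ep : io p = b * D2 ^+ (2 * m) by rewrite Eb divfK // expf_neq0.
  by rewrite -act_io Ep rmorphM /= bI act_D2X.
have [Q DQ EQ] := dop_in_Y (invariant_in_Y pI).
have : dop (fun f => D2 ^- (2 * m) * f).
  elim: (m) => [|k [Q' D' E']].
    exists (fun f => cst 1 * f) => // f.
    by rewrite muln0 expr0 invr1 /cst mpolyC1 rmorph1.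
  exists (fun f => D2 ^- 2 * Q' f); first exact: (Dt_comp Dt_Delta).
  by move=> f; rewrite E' mulrA -invfM -exprD mulnS.
move=> [Q' D' E']; exists (fun f => Q' (Q f)); first exact: Dt_comp.
by move=> f; rewrite E' EQ Eb mulrA [_ * io p]mulrC.
Qed.

(** Combinations of the operators with arbitrary regular coefficients, which
    need not commute with the group. *)
Inductive Dreg : (K -> K) -> Prop :=
| Dreg0 : Dreg (fun=> 0)
| DregS b Q L : reg b -> Dt Q -> Dreg L -> Dreg (fun f => b * Q f + L f).

Definition rop (L : K -> K) := exists2 L', Dreg L' & L' =1 L.

Lemma rop_ext L1 L2 : L1 =1 L2 -> rop L1 -> rop L2.
Proof. by move=> E [L' D' E']; exists L' => // f; rewrite E'. Qed.

Lemma rop_add L1 L2 : rop L1 -> rop L2 -> rop (fun f => L1 f + L2 f).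
Proof.
move=> [M1 D1 E1] r2.
apply: (@rop_ext (fun f => M1 f + L2 f)) => [f|]; first by rewrite E1.
elim: D1 => [|b Q L rb DQ _ [L' DL' EL']] {E1}.
  by apply: rop_ext r2 => f; rewrite add0r.
by exists (fun f => b * Q f + L' f); [exact: DregS | move=> f; rewrite EL' addrA].
Qed.

Lemma rop_sum (I : finType) (F : I -> K -> K) :
  (forall i, rop (F i)) -> rop (fun f => \sum_i F i f).
Proof.
move=> rF; rewrite unlock; elim: (index_enum I) => [|i s IH] /=.
  by exists (fun=> 0) => //; exact: Dreg0.
exact: rop_add.
Qed.

Lemma rop_mono b Q : reg b -> dop Q -> rop (fun f => b * Q f).
Proof.
move=> rb [Q' DQ EQ]; exists (fun f => b * Q' f + 0); last by move=> f; rewrite addr0 EQ.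
exact: (DregS rb DQ Dreg0).
Qed.

Lemma rop_id : rop id.
Proof.
apply: (@rop_ext (fun f => 1 * (cst 1 * f))); last first.
  by apply: rop_mono; [exact: reg1 | exists (fun f => cst 1 * f)].
by move=> f; rewrite /cst mpolyC1 rmorph1 !mul1r.
Qed.

Lemma rop_mul b L : reg b -> rop L -> rop (fun f => b * L f).
Proof.
move=> rb [L' D' E']; apply: (@rop_ext (fun f => b * L' f)) => [f|]; first by rewrite E'.
elim: D' {E'} => [|b' Q M rb' DQ _ [M' DM' EM']].
  by exists (fun=> 0); [exact: Dreg0 | move=> f; rewrite mulr0].
exists (fun f => (b * b') * Q f + M' f); first by apply: DregS => //; exact: regM.
by move=> f; rewrite EM' mulrDr mulrA.
Qed.

(** By the chain rule d/dx_i is itself such a combination. *)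
Lemma rop_dx i L : rop L -> rop (fun f => dx i (L f)).
Proof.
move=> [L' D' E']; apply: (@rop_ext (fun f => dx i (L' f))) => [f|]; first by rewrite E'.
elim: D' {E'} => [|b Q M rb DQ _ IH].
  by exists (fun=> 0) => [|f]; [exact: Dreg0 | rewrite dx_0].
apply: (@rop_ext (fun f => (dx i b * Q f +
    \sum_j (b * io (yB R j)^`M(i)) * dy j (Q f)) + dx i (M f))).
  move=> f; rewrite dxD dxM; congr (_ + _ + _); rewrite dx_dy mulr_sumr.
  by apply: eq_bigr => j _; rewrite mulrA.
apply: rop_add IH; apply: rop_add.
  by apply: rop_mono; [exact: reg_dx | exists Q].
apply: rop_sum => j; apply: (@rop_mono _ (fun f => dy j (Q f))).
  by apply: regM => //; exact: reg_io.
by exists (fun f => dy j (Q f)) => //; exact: Dt_comp.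
Qed.

(** Averaging over the group replaces each coefficient by its average, which is
    invariant. *)
Lemma rop_average L : rop L -> exists2 Q, Dt Q &
  forall f, Q f = (#|[set: W]|)%:R^-1 * \sum_g act g (L (act g^-1%g f)).
Proof.
move=> [L' D' E'].
suff [Q [Q' DQ EQ] E] : exists2 Q, dop Q &
    forall f, Q f = (#|[set: W]|)%:R^-1 * \sum_g act g (L' (act g^-1%g f)).
  by exists Q' => // f; rewrite EQ E; congr (_ * _); apply: eq_bigr => g _; rewrite E'.
elim: D' {E'} => [|b Q M rb DQ _ [Q' DQ' EQ']].
  exists (fun f => cst 0 * f) => [|f]; first by exists (fun f => cst 0 * f).
  by rewrite /cst mpolyC0 rmorph0 mul0r big1 ?mulr0 // => g _; rewrite rmorph0.
pose b' := (#|[set: W]|)%:R^-1 * \sum_g act g b.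
have b'I h : act h b' = b'.
  rewrite /b' rmorphM fmorphV rmorph_nat rmorph_sum; congr (_ * _).
  rewrite [RHS](reindex_inj (mulgI h)) /=; apply: eq_bigr => g _.
  by rewrite act_mul.
have rb' : reg b'.
  apply: regM; last by apply: reg_sum => g; exact: reg_act.
  suff -> : (#|[set: W]|)%:R^-1 = cst (#|[set: W]|)%:R^-1 by exact: reg_cst.
  by rewrite -[X in X^-1](rmorph_nat (io \o @mpolyC n C)) -fmorphV.
exists (fun f => b' * Q f + Q' f).
  apply: dop_add => //; apply: (@dop_comp (fun f => b' * f) Q).
    exact: dop_inv.
  by exists Q.
move=> f; rewrite EQ' /b' -mulrA -mulrDr mulr_suml -big_split; congr (_ * _).
apply: eq_bigr => g _ /=; rewrite rmorphD rmorphM; congr (_ * _ + _).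
by rewrite Dt_act // act_KV.
Qed.

Lemma cst_is_additive : GRing.zmod_morphism cst.
Proof. by move=> c d; rewrite /cst mpolyCB rmorphB. Qed.
Lemma cst_is_multiplicative : GRing.monoid_morphism cst.
Proof.
split=> [|c d]; first by rewrite /cst mpolyC1 rmorph1.
by rewrite /cst mpolyCM rmorphM.
Qed.
HB.instance Definition _ := GRing.isZmodMorphism.Build C K cst cst_is_additive.
HB.instance Definition _ := GRing.isMonoidMorphism.Build C K cst cst_is_multiplicative.

Definition clin (L : K -> K) :=
  {morph L : f h / f + h} /\ forall c f, L (cst c * f) = cst c * L f.

Lemma clin_sum L (I : finType) (F : I -> K) : clin L -> L (\sum_i F i) = \sum_i L (F i).
Proof.
move=> [LD LZ]; have L0 := LZ 0 0; rewrite rmorph0 !mul0r in L0.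
exact: (big_morph L LD L0).
Qed.

Lemma dx_monom i m : io 'X_i * dx i (io 'X_[m]) = cst (m i)%:R * io 'X_[m].
Proof. by rewrite dx_io mulrC -rmorphM mderiv_monom ioZ. Qed.

(** The product of the operators x_i d/dx_i - k, where for each monomial of s
    the exponent k of x_i differs from that of x^alpha, kills the monomials of
    s but not x^alpha. *)
Lemma separate_monomial (alpha : 'X_{1..n}) (s : seq 'X_{1..n}) : alpha \notin s ->
  exists (L : K -> K) (c : 'X_{1..n} -> C),
  [/\ rop L, clin L, forall m, L (io 'X_[m]) = cst (c m) * io 'X_[m],
      c alpha != 0 & forall b, b \in s -> c b = 0].
Proof.
elim: s => [_|b s IH].
  exists id, (fun=> 1); split=> //; [exact: rop_id | | exact: oner_neq0].
  by move=> m; rewrite rmorph1 mul1r.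
rewrite inE negb_or => /andP[ab /IH[L [c [rL [LD LZ] Lm ca cs]]]].
have [i abi] : exists i, alpha i != b i.
  apply/existsP; rewrite -negb_forall; apply: contra ab => /forallP E.
  by apply/eqP/mnmP => i; exact/eqP.
exists (fun f => io 'X_i * dx i (L f) + cst (- (b i)%:R) * L f).
exists (fun m : 'X_{1..n} => ((m i)%:R - (b i)%:R) * c m); split.
- by apply: rop_add; apply: rop_mul; [exact: reg_io | exact: rop_dx | exact: reg_cst |].
- split=> [f h|k f]; first by rewrite LD dxD !mulrDr addrACA.
  by rewrite LZ dxM dx_cst mul0r add0r mulrDr !mulrA [cst k * _]mulrC [cst k * cst _]mulrC.
- move=> m; rewrite Lm dxM dx_cst mul0r add0r mulrCA dx_monom !rmorphM rmorphB rmorphN /=.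
  by ring.
- by rewrite mulf_neq0 // subr_eq0 eqr_nat.
by move=> d; rewrite inE => /orP[/eqP ->|/cs ->]; rewrite ?subrr ?mul0r ?mulr0.
Qed.

Let scal c f := cst c * f.
Let ga (a : A) (f : K) : K := lact scal (fun g => act g) a f.

Let W0 : (#|[set: W]|)%:R != 0 :> K.
Proof.
rewrite -(rmorph_nat cst) fmorph_eq0 pnatr_eq0 -lt0n.
by apply/card_gt0P; exists 1%g.
Qed.

(** The translates of p have a matrix X of coefficients.  The rows of 1 - X Y,
    with Y a generalized inverse of X, are relations between these translates,
    hence between those of h; so the translates of h are combinations of
    elements b j with the same matrix X, and sum_j b j L j, where L j
    extracts the coefficient of the j-th monomial, maps each translate of p to
    the corresponding one of h. *)
Lemma transfer_poly (p : P) (h : K) : reg h ->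
  (forall a, ga a (io p) = 0 -> ga a h = 0) -> exists2 Q, Dt Q & Q (io p) = h.
Proof.
move=> rh ann.
have [N [mon [X [mon_inj EX]]]] := mpoly_coords (fun g : W => wa g p).
have [Y EY] := generalized_inverse X.
pose b j := \sum_k cst (Y j k) * act k h.
have rb j : reg (b j).
  by apply: reg_sum => k; apply: regM; [exact: reg_cst | exact: reg_act].
have Eh g : act g h = \sum_j cst (X g j) * b j.
  (* the row 1 - X Y is a relation between the translates of p *)
  pose a : A := [ffun k => (k == g)%:R - \sum_j X g j * Y j k].
  have : ga a h = 0.
    apply: ann; rewrite /ga /lact /scal.
    under eq_bigr do rewrite act_io EX rmorph_sum mulr_sumr.
    rewrite exchange_big big1 // => l _ /=.
    under eq_bigr do rewrite ioZ mulrA -rmorphM.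
    rewrite -mulr_suml -rmorph_sum /=.
    suff -> : \sum_k a k * X k l = 0 by rewrite rmorph0 mul0r.
    under eq_bigr do rewrite ffunE mulrBl.
    rewrite sumrB EY (bigD1 g) //= eqxx mul1r big1 ?addr0 ?subrr // => k /negPf ->.
    by rewrite mul0r.
  rewrite /ga /lact /scal; under eq_bigr do rewrite ffunE rmorphB mulrBl.
  rewrite sumrB (bigD1 g) //= eqxx rmorph1 mul1r big1 ?addr0 => [|k /negPf ->]; last first.
    by rewrite rmorph0 mul0r.
  move/eqP; rewrite subr_eq0 => /eqP ->.
  under eq_bigr do rewrite rmorph_sum mulr_suml.
  rewrite exchange_big; apply: eq_bigr => j _; rewrite /b mulr_sumr.
  by apply: eq_bigr => k _; rewrite /= rmorphM mulrA.
have sepP j : exists L, [/\ rop L, clin L & forall l, L (io 'X_[mon l]) = (l == j)%:R].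
  have nj : mon j \notin [seq mon l | l <- enum 'I_N & l != j].
    by apply/mapP => -[l]; rewrite mem_filter => /andP[/eqP lj _] /mon_inj/esym.
  have [L [c [rL [LD LZ] Lm cj cs]]] := separate_monomial nj.
  exists (fun f => cst (c (mon j))^-1 * (io 'X_[mon j])^-1 * L f); split.
  - by apply: rop_mul => //; apply: regM; [exact: reg_cst | exact: reg_Xinv].
  - by split=> [f1 f2|k f]; [rewrite LD mulrDr | rewrite LZ mulrCA].
  move=> l; rewrite Lm; have [->|lj] := eqVneq l j.
    have X0 : io 'X_[mon j] != 0 by rewrite io_eq0 -msize_poly_eq0 msizeX.
    by rewrite mulrACA -rmorphM mulVf // rmorph1 mul1r mulVf.
  rewrite (cs (mon l)) ?(negPf lj) ?rmorph0 ?mul0r ?mulr0 //.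
  by apply: map_f; rewrite mem_filter lj mem_enum.
have [L LP] := boolp.choice sepP.
have [|Q DQ EQ] := @rop_average (fun f => \sum_j b j * L j f).
  by apply: rop_sum => j; apply: rop_mul => //; case: (LP j).
exists Q => //; rewrite EQ.
rewrite (eq_bigr (fun=> h)) => [|g _].
  by rewrite sumr_const -[h *+ _]mulr_natl mulrA -cardsT mulVf ?mul1r.
rewrite act_io -[RHS](act_KV g) Eh; congr (act g _).
apply: eq_bigr => j _; rewrite mulrC; congr (_ * _).
have [_ linL Ll] := LP j; rewrite EX rmorph_sum clin_sum //.
under eq_bigr do rewrite ioZ linL.2 Ll.
by rewrite (bigD1 j) //= eqxx mulr1 big1 ?addr0 // => l /negPf ->; rewrite mulr0.
Qed.

(** The case of a polynomial is enough: an even power of Delta is invariant, so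
    it clears the denominator of f without changing its annihilator. *)
Lemma transfer (f h : K) : reg f -> reg h ->
  (forall a, ga a f = 0 -> ga a h = 0) -> exists2 Q, Dt Q & Q f = h.
Proof.
move=> /reg_even[p [m Ef]] rh ann.
have D0 : D2 ^+ (2 * m) != 0 by rewrite expf_neq0.
have Ep : io p = D2 ^+ (2 * m) * f by rewrite Ef mulrC divfK.
have gaM a (u : K) : ga a (D2 ^+ (2 * m) * u) = D2 ^+ (2 * m) * ga a u.
  rewrite /ga /lact mulr_sumr; apply: eq_bigr => g _.
  by rewrite rmorphM /= act_D2X /scal mulrCA.
have [a|Q DQ EQ] := transfer_poly (p := p) rh.
  rewrite Ep gaM => /eqP; rewrite mulf_eq0 (negPf D0) => /eqP; exact: ann.
have [|g|Q' DQ' EQ'] := @dop_inv (D2 ^+ (2 * m)); last 1 first.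
- exists (fun u => Q (Q' u)); first exact: Dt_comp.
  by rewrite EQ' -Ep EQ.
- by rewrite -rmorphXn; exact: reg_io.
exact: act_D2X.
Qed.

Lemma ga_Dt (a : A) Q f : Dt Q -> ga a (Q f) = Q (ga a f).
Proof.
move=> DQ; rewrite /ga /lact clin_sum; last exact: Dt_clin.
by apply: eq_bigr => g _; rewrite (Dt_clin DQ).2 Dt_act.
Qed.

Lemma ga_reg (a : A) f : reg f -> reg (ga a f).
Proof.
by move=> rf; apply: reg_sum => g; apply: regM; [exact: reg_cst | exact: reg_act].
Qed.

Lemma ga_io (a : A) p : ga a (io p) = io (pact a p).
Proof.
rewrite pactE rmorph_sum; apply: eq_bigr => g _.
by rewrite /scal act_io -ioZ.
Qed.

Let scDr (c : C) : {morph scal c : u v / u + v}.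
Proof. exact: mulrDr. Qed.
Let scDl (c d : C) (u : K) : scal (c + d) u = scal c u + scal d u.
Proof. by rewrite /scal rmorphD mulrDl. Qed.
Let scA (c d : C) (u : K) : scal c (scal d u) = scal (c * d) u.
Proof. by rewrite /scal rmorphM mulrA. Qed.
Let sc1 (u : K) : scal 1 u = u.
Proof. by rewrite /scal rmorph1 mul1r. Qed.
Let actD' g : {morph act g : u v / u + v}.
Proof. exact: rmorphD. Qed.
Let actZ' g c u : act g (scal c u) = scal c (act g u).
Proof. by rewrite /scal rmorphM /= act_cst. Qed.

Lemma ga_conv a b u : ga (gconv a b) u = ga a (ga b u).
Proof. exact: (lact_conv scDr scDl scA actD' actZ' act_mul). Qed.
Lemma gaD a : {morph ga a : u v / u + v}.
Proof. exact: (lactD scDr actD'). Qed.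
Lemma ga0l u : ga 0 u = 0.
Proof. exact: (lact0l _ scDl). Qed.
Lemma ga_suml (I : finType) (F : I -> A) u : ga (\sum_i F i) u = \sum_i ga (F i) u.
Proof. exact: (lact_suml _ scDl). Qed.
Lemma ga1 u : ga (gone R n) u = u.
Proof. exact: (lact_gone scDl sc1 act_1). Qed.

Lemma primitive_ann (e : A) (f : K) (a : A) : reg f ->
  primitive_idempotent e -> ga e f = f -> f != 0 -> ga a f = 0 -> gconv a e = 0.
Proof.
move=> /reg_even[p [m Ef]] eprim ef f0 af.
have D0 : D2 ^+ (2 * m) != 0 by rewrite expf_neq0.
have Ep : io p = D2 ^+ (2 * m) * f by rewrite Ef mulrC divfK.
have gaM b : io (pact b p) = D2 ^+ (2 * m) * ga b f.
  rewrite -ga_io Ep /ga /lact mulr_sumr; apply: eq_bigr => g _.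
  by rewrite rmorphM /= act_D2X /scal mulrCA.
apply: (@primitive_annihilator _ _ e p) => //.
- by apply: io_inj; rewrite gaM ef.
- by rewrite -io_eq0 Ep mulf_neq0.
by apply: io_inj; rewrite gaM af mulr0 rmorph0.
Qed.

End Derivations.

(** * The rational functions *)

Section Instance.
Variables (R : realType) (n : nat) (c0 : R[i]).
Hypothesis c0_neq0 : c0 != 0.
Local Notation C := R[i].
Local Notation P := {mpoly C[n]}.
Local Notation W := (Bn n).
Local Notation A := {ffun W -> C}.
Local Notation K := {fraction P}.

Let wactKE g : @wactK R n g = fmap (wa g).
Proof. by rewrite /wactK wa.unlock. Qed.

Let wactK_add (g : W) : GRing.zmod_morphism (@wactK R n g).
Proof. rewrite wactKE; exact: (fmapB (@wa_neq0 R n g)). Qed.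
Let wactK_mul (g : W) : GRing.monoid_morphism (@wactK R n g).
Proof. rewrite wactKE; exact: (fmapM (@wa_neq0 R n g)). Qed.

HB.instance Definition _ g :=
  GRing.isZmodMorphism.Build K K (@wactK R n g) (wactK_add g).
HB.instance Definition _ g :=
  GRing.isMonoidMorphism.Build K K (@wactK R n g) (wactK_mul g).

Let io : {rmorphism P -> K} := @tofrac P.
Let actK (g : W) : {rmorphism K -> K} := @wactK R n g.

Let io_inj : injective io.
Proof. by move=> p q /eqP; rewrite tofrac_eq => /eqP. Qed.
Let io_frac (f : K) : exists a b, b != 0 /\ f = io a / io b.
Proof. exact: fracP. Qed.
Let act_io g p : actK g (io p) = io (wa g p).
Proof. rewrite /actK /= wactKE; exact: (fmap_poly (@wa_neq0 R n g)). Qed.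
Let dxD' i : {morph @dX R n i : f h / f + h}.
Proof. exact: (fderD (@mderivD _ _ i) (mderivM i)). Qed.
Let dxM' i f h : @dX R n i (f * h) = dX i f * h + f * dX i h.
Proof. exact: (fderM (mderivM i) f h). Qed.
Let dx_io' i p : @dX R n i (io p) = io p^`M(i).
Proof. exact: (fder_poly (mderivM i)). Qed.
Let junit : jac io \in unitmx.
Proof. exact: jacobian_unit. Qed.

Let Dind (T : (K -> K) -> Prop) :
  (forall c, T (fun f => cst io c * f)) -> (forall j, T (fun f => io (yB R j) * f)) ->
  (forall j, T (dy io (@dX R n) j)) -> T (fun f => (io (Delta n c0)) ^- 2 * f) ->
  (forall Q1 Q2, T Q1 -> T Q2 -> T (fun f => Q1 f + Q2 f)) ->
  (forall Q1 Q2, T Q1 -> T Q2 -> T (fun f => Q1 (Q2 f))) ->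
  forall Q, Dtil c0 Q -> T Q.
Proof.
move=> T1 T2 T3 T4 T5 T6 Q; elim=> [c|j|j||Q1 Q2 _ I1 _ I2|Q1 Q2 _ I1 _ I2].
- exact: T1.
- exact: T2.
- exact: T3.
- exact: T4.
- exact: T5.
exact: T6.
Qed.

Lemma Otil_transfer (f h : K) : Otil c0 f -> Otil c0 h ->
  (forall a, aact a f = 0 -> aact a h = 0) -> exists2 Q, Dtil c0 Q & Q f = h.
Proof.
exact: (transfer io_inj io_frac act_io dxD' dxM' dx_io' junit c0_neq0
  (@Dtil_cst R n c0) (@Dtil_y R n c0) (@Dtil_d R n c0) (@Dtil_Delta R n c0)
  (@Dtil_add R n c0) (@Dtil_comp R n c0) Dind).
Qed.

Lemma aact_Dtil (a : A) Q f : @Dtil R n c0 Q -> aact a (Q f) = Q (aact a f).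
Proof.
exact: (@ga_Dt R n {fraction P} io io_inj io_frac actK act_io (@dX R n) dxD' dxM' dx_io' junit c0
  (Dtil c0) Dind a Q f).
Qed.

Lemma Otil_Dtil Q f : @Dtil R n c0 Q -> Otil c0 f -> Otil c0 (Q f).
Proof. exact: (Dt_reg io_inj dxM' dx_io' junit c0_neq0 Dind). Qed.

Lemma Otil_aact (a : A) (f : K) : Otil c0 f -> Otil c0 (aact a f).
Proof. exact: (ga_reg io_inj act_io c0_neq0 a). Qed.

Lemma OtilD f h : @Otil R n c0 f -> Otil c0 h -> Otil c0 (f + h).
Proof. exact: (regD io_inj c0_neq0). Qed.

Lemma Otil0 : Otil c0 (0 : K).
Proof. exact: (@reg0 R n K io c0). Qed.

Lemma Otil_poly p : Otil c0 (tofrac p : K).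
Proof. exact: (@reg_io R n K io c0 p). Qed.

Lemma aact_poly (a : A) p : aact a (tofrac p) = tofrac (pact a p) :> K.
Proof. exact: (ga_io act_io a p). Qed.

Lemma aact_conv (a b : A) (u : K) : aact (gconv a b) u = aact a (aact b u).
Proof. exact: (ga_conv io_frac act_io). Qed.
Lemma aactD (a : A) : {morph @aact R n a : u v / u + v}.
Proof. exact: (gaD io actK). Qed.
Lemma aact0l (u : K) : aact 0 u = 0.
Proof. exact: (ga0l io actK). Qed.
Lemma aact_suml (I : finType) (F : I -> A) (u : K) :
  aact (\sum_i F i) u = \sum_i aact (F i) u.
Proof. exact: (ga_suml io actK). Qed.
Lemma aact1 (u : K) : aact (gone R n) u = u.
Proof. exact: (ga1 io_frac act_io). Qed.

Lemma primitive_aact (e : A) (f : K) (a : A) : Otil c0 f ->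
  primitive_idempotent e -> aact e f = f -> f != 0 -> aact a f = 0 -> gconv a e = 0.
Proof. exact: (primitive_ann io_inj act_io c0_neq0). Qed.

Lemma tofrac_inj : injective (@tofrac P).
Proof. exact: io_inj. Qed.

End Instance.

(** * Tableaux and their Specht polynomials *)

Section DownClosed.
Variable n : nat.

Lemma downclosed_mem (E : {set 'I_n}) (i : 'I_n) :
  (forall j k : 'I_n, (j <= k)%N -> k \in E -> j \in E) -> (i \in E) = (i < #|E|)%N.
Proof.
move=> dE; rewrite cardE -(size_map val); apply/idP/idP => [iE|].
  have : {subset iota 0 i.+1 <= [seq val j | j <- enum E]}.
    move=> x; rewrite mem_iota add0n ltnS => xi.
    have xn : (x < n)%N by apply: leq_ltn_trans xi _.
    apply/mapP; exists (Ordinal xn) => //; rewrite mem_enum.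
    exact: dE iE.
  by move/(uniq_leq_size (iota_uniq _ _)); rewrite size_iota.
apply: contraTT => iE; rewrite -leqNgt -[X in (_ <= X)%N](size_iota 0).
apply: uniq_leq_size => [|x /mapP[j]]; first by rewrite (map_inj_uniq val_inj) enum_uniq.
rewrite mem_enum mem_iota add0n => jE ->; rewrite ltnNge.
by apply: contra iE => /dE; apply.
Qed.
End DownClosed.

Section Tableau.
Variables (n : nat) (lam : bipart n) (T : bitab n).
Hypothesis tabT : is_tableau lam T.

Lemma tab_inj : injective T.
Proof. by case/andP: tabT => /injectiveP. Qed.

Lemma tab_pos_inj k l : (T k).1 = (T l).1 -> (T k).2.1 = (T l).2.1 ->
  (T k).2.2 = (T l).2.2 -> k = l.
Proof.
move=> e1 e2 e3; apply: tab_inj.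
by move: e1 e2 e3; case: (T k) => a [b c]; case: (T l) => a' [b' c'] /= -> -> ->.
Qed.

Lemma tab_cell nu c : (c \in sval lam nu) = [exists k, T k == (nu, c)].
Proof. by case/andP: tabT => _ /forallP /(_ nu) /forallP /(_ c) /eqP. Qed.

Lemma tab_entry nu c : c \in sval lam nu -> exists k, T k = (nu, c).
Proof. by rewrite tab_cell => /existsP[k /eqP]; exists k. Qed.

Lemma tab_mem k : (T k).2 \in sval lam (T k).1.
Proof. by rewrite tab_cell; apply/existsP; exists k; rewrite -surjective_pairing. Qed.

Lemma bipart_young nu : is_young (sval lam nu).
Proof. by case/andP: (svalP lam) => /forallP. Qed.

Lemma young_closed nu (c d : 'I_n * 'I_n) : c \in sval lam nu ->
  (d.1 <= c.1)%N -> (d.2 <= c.2)%N -> d \in sval lam nu.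
Proof.
move=> cl d1 d2; have /forallP/(_ c) := bipart_young nu.
by rewrite cl => /forallP /(_ d); rewrite d1 d2.
Qed.

Definition samecol (k l : 'I_n) := ((T k).1 == (T l).1) && ((T k).2.2 == (T l).2.2).
Definition samerow (k l : 'I_n) := ((T k).1 == (T l).1) && ((T k).2.1 == (T l).2.1).
Definition colgrp : {set 'S_n} := [set s : 'S_n | [forall k, samecol (s k) k]].
Definition rowgrp : {set 'S_n} := [set s : 'S_n | [forall k, samerow (s k) k]].

Lemma colgrpP (s : 'S_n) : reflect (forall k, (T (s k)).1 = (T k).1 /\ (T (s k)).2.2 = (T k).2.2)
  (s \in colgrp).
Proof.
rewrite inE; apply: (iffP forallP) => H k; first by case/andP: (H k) => /eqP ? /eqP.
by case: (H k) => E1 E2; rewrite /samecol E1 E2 !eqxx.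
Qed.

Lemma rowgrpP (s : 'S_n) : reflect (forall k, (T (s k)).1 = (T k).1 /\ (T (s k)).2.1 = (T k).2.1)
  (s \in rowgrp).
Proof.
rewrite inE; apply: (iffP forallP) => H k; first by case/andP: (H k) => /eqP ? /eqP.
by case: (H k) => E1 E2; rewrite /samerow E1 E2 !eqxx.
Qed.

Lemma colgrp1 : 1%g \in colgrp. Proof. by apply/colgrpP => k; rewrite perm1. Qed.
Lemma rowgrp1 : 1%g \in rowgrp. Proof. by apply/rowgrpP => k; rewrite perm1. Qed.
Lemma colgrpM (s t : 'S_n) : s \in colgrp -> t \in colgrp -> (s * t)%g \in colgrp.
Proof.
move=> /colgrpP Hs /colgrpP Ht; apply/colgrpP => k; rewrite permM.
by case: (Ht (s k)) => -> ->; case: (Hs k).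
Qed.
Lemma rowgrpM (s t : 'S_n) : s \in rowgrp -> t \in rowgrp -> (s * t)%g \in rowgrp.
Proof.
move=> /rowgrpP Hs /rowgrpP Ht; apply/rowgrpP => k; rewrite permM.
by case: (Ht (s k)) => -> ->; case: (Hs k).
Qed.
Lemma colgrpV (s : 'S_n) : s \in colgrp -> (s^-1)%g \in colgrp.
Proof.
by move=> /colgrpP Hs; apply/colgrpP => k; case: (Hs (s^-1 k)%g); rewrite permKV => -> ->.
Qed.
Lemma rowgrpV (s : 'S_n) : s \in rowgrp -> (s^-1)%g \in rowgrp.
Proof.
by move=> /rowgrpP Hs; apply/rowgrpP => k; case: (Hs (s^-1 k)%g); rewrite permKV => -> ->.
Qed.

Lemma colgrp_mulr (s t : 'S_n) : t \in colgrp -> ((s * t)%g \in colgrp) = (s \in colgrp).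
Proof.
move=> Ct; apply/idP/idP => Cs; last exact: colgrpM.
by rewrite -(mulgK t s); apply: colgrpM => //; exact: colgrpV.
Qed.
Lemma rowgrp_mulr (s t : 'S_n) : t \in rowgrp -> ((s * t)%g \in rowgrp) = (s \in rowgrp).
Proof.
move=> Ct; apply/idP/idP => Cs; last exact: rowgrpM.
by rewrite -(mulgK t s); apply: rowgrpM => //; exact: rowgrpV.
Qed.

(** Move k to the cell of its column whose row is the rank of r k among the
    values of r on this column.  The rank is at most r k because these values
    are distinct natural numbers. *)
Lemma column_sort (r : 'I_n -> nat) :
  (forall k l, samecol k l -> r k = r l -> k = l) ->
  exists2 s : 'S_n, s \in colgrp & forall k, ((T (s k)).2.1 <= r k)%N.
Proof.
move=> rinj; pose below k := [set l | samecol l k & (r l < r k)%N].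
pose rho k := #|below k|.
have rho_n k : (rho k < n)%N.
  have /(leq_trans _) : (#|k |: below k| <= n)%N by rewrite -[X in (_ <= X)%N]card_ord max_card.
  by apply; rewrite cardsU1 !inE ltnn andbF.
have rho_r k : (rho k <= r k)%N.
  rewrite /rho cardE -(size_map r) -[X in (_ <= X)%N](size_iota 0).
  apply: uniq_leq_size => [|x /mapP[l]].
    rewrite map_inj_in_uniq ?enum_uniq // => l l'; rewrite !mem_enum !inE.
    move=> /andP[/andP[/eqP a1 /eqP a2] _] /andP[/andP[/eqP b1 /eqP b2] _].
    by apply: rinj; rewrite /samecol a1 a2 b1 b2 !eqxx.
  by rewrite mem_enum inE mem_iota add0n => /andP[_ lt] ->.
have cellP k : exists j, T j = ((T k).1, (Ordinal (rho_n k), (T k).2.2)).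
  apply: tab_entry; have [j /andP[sj rj]] : exists j, samecol j k && (rho k <= (T j).2.1)%N.
    apply/existsP; apply: contraT; rewrite negb_exists => /forallP H.
    have : (#|k |: below k| <= rho k)%N.
      rewrite cardE -(size_map (fun l => val (T l).2.1)) -[X in (_ <= X)%N](size_iota 0).
      have sc l : l \in k |: below k -> samecol l k.
        by rewrite !inE => /orP[/eqP ->|/andP[]//]; rewrite /samecol !eqxx.
      apply: uniq_leq_size => [|x /mapP[l]].
        rewrite map_inj_in_uniq ?enum_uniq // => l l'; rewrite !mem_enum.
        move=> /sc/andP[/eqP a1 /eqP a2] /sc/andP[/eqP b1 /eqP b2] /val_inj e.
        by apply: tab_pos_inj; rewrite ?a1 ?b1 ?a2 ?b2.
      rewrite mem_enum mem_iota add0n => /sc ls ->.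
      by have := H l; rewrite ls -ltnNge.
    by rewrite cardsU1 !inE ltnn andbF ltnn.
  case/andP: sj => /eqP s1 /eqP s2.
  apply: (young_closed (c := (T j).2)) => //=; last by rewrite s2.
  by rewrite -s1; exact: tab_mem.
have [s sE] := fin_all_exists cellP.
have s_inj : injective s.
  move=> k l E; have := sE k; rewrite E sE => -[/esym e1 /esym e3 /esym e2].
  have lt_rho i j : samecol i j -> (r i < r j)%N -> (rho i < rho j)%N.
    move=> sij rij; apply: proper_card; apply/properP; split.
      apply/subsetP => x; rewrite !inE => /andP[/andP[/eqP a1 /eqP a2] xi].
      case/andP: sij => /eqP b1 /eqP b2.
      by rewrite /samecol a1 a2 b1 b2 !eqxx (ltn_trans xi).
    by exists i; rewrite !inE ?sij ?rij // ltnn andbF.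
  have skl : samecol k l by rewrite /samecol -e1 -e2 !eqxx.
  have slk : samecol l k by rewrite /samecol e1 e2 !eqxx.
  case: (ltngtP (r k) (r l)) => [/(lt_rho _ _ skl)|/(lt_rho _ _ slk)|]; rewrite ?e3 ?ltnn //.
  exact: rinj.
exists (perm s_inj); last by move=> k; rewrite permE sE /= rho_r.
by apply/colgrpP => k; rewrite permE sE.
Qed.

(** The smallest exponents that are distinct on each column and have the parity
    of the component. *)
Definition tmon : 'X_{1..n} := [multinom (2 * (T i).2.1 + (T i).1)%N | i < n].

Lemma tmon_colgrp (s : 'S_n) k : s \in colgrp -> tmon (s k) = tmon k -> s k = k.
Proof.
move=> /colgrpP /(_ k)[e1 e2]; rewrite !mnmE e1 => e3.
have e4 : (T (s k)).2.1 = (T k).2.1 by apply: val_inj => /=; lia.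
exact: tab_pos_inj.
Qed.

End Tableau.

Section SpechtPolynomials.
Variables (R : realType) (n : nat).
Local Notation C := R[i].
Local Notation P := {mpoly C[n]}.
Local Notation W := (Bn n).
Local Notation A := {ffun W -> C}.

Definition pe (s : 'S_n) : W := ([ffun => false], s).

Lemma gsign_pe s m : gsign R (pe s) m = 1.
Proof. by rewrite /gsign big1 // => k _; rewrite ffunE mul0n expr0. Qed.

Lemma mcoeff_pe s (f : P) m : (wa (pe s) f)@_m = f@_(m#s).
Proof. by rewrite mcoeff_wa gsign_pe mul1r. Qed.

Lemma peM (s t : 'S_n) : (pe s * pe t = pe (t * s))%g.
Proof. by congr (_, _); apply/ffunP => k; rewrite !ffunE. Qed.

Lemma gsign_sqr g (m : 'X_{1..n}) : gsign R g m * gsign R g m = 1.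
Proof.
rewrite /gsign -big_split big1 // => k _ /=.
by rewrite -expr2 sqrr_sign.
Qed.

Lemma sign_inj (b1 b2 : bool) : (-1) ^+ b1 = (-1) ^+ b2 :> C -> b1 = b2.
Proof.
have N1 : (1 : C) <> -1 by move/eqP; rewrite -addr_eq0 -mulr2n pnatr_eq0.
by case: b1; case: b2; rewrite ?expr0 ?expr1 // => /esym.
Qed.

Definition sgp (s : 'S_n) : C := (-1) ^+ odd_perm s.

Lemma sgpM s t : sgp (s * t)%g = sgp s * sgp t.
Proof. by rewrite /sgp odd_permM signr_addb. Qed.
Lemma sgp_sqr s : sgp s * sgp s = 1.
Proof. by rewrite /sgp -signr_addb addbb. Qed.

(** The linear character by which the group of signed permutations that
    preserve the columns of T acts on [DT T]. *)
Definition theta (T : bitab n) (g : W) : C :=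
  sgp g.2 * \prod_k (-1) ^+ (g.1 k * (T k).1).

Definition anti (T : bitab n) (f : P) :=
  forall g : W, g.2 \in colgrp T -> wa g f = theta T g *: f.

Lemma theta_sqr T (g : W) : theta T g * theta T g = 1.
Proof.
rewrite /theta mulrACA sgp_sqr mul1r -big_split big1 // => k _ /=.
by rewrite -expr2 sqrr_sign.
Qed.

Lemma thetaM T (g h : W) : g.2 \in colgrp T -> h.2 \in colgrp T ->
  theta T (g * h)%g = theta T g * theta T h.
Proof.
move=> /colgrpP Hg Hh; rewrite /theta /= sgpM mulrACA [sgp h.2 * _]mulrC -big_split.
congr (_ * _) => /=.
transitivity (\prod_k ((-1) ^+ (g.1 k * (T k).1) * (-1) ^+ (h.1 ((g.2)^-1%g k) * (T k).1)) : C).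
  apply: eq_bigr => k _; rewrite ffunE.
  by case: (g.1 k); case: (h.1 _); rewrite ?mul0n ?mul1n ?expr0 ?mul1r ?mulr1 //= -expr2 sqrr_sign.
rewrite big_split /= [RHS]big_split /=; congr (_ * _).
rewrite (reindex_inj (@perm_inj _ g.2)); apply: eq_bigr => k _.
by rewrite permK; case: (Hg k) => ->.
Qed.

Lemma theta_pe T s : theta T (pe s) = sgp s.
Proof.
by rewrite /theta big1 ?mulr1 // => k _; rewrite ffunE mul0n expr0.
Qed.

(** Up to a constant, the product of the Vandermonde determinants of the squares
    of the variables in each column, and of the variables in the second
    component. *)
Definition DT (T : bitab n) : P :=
  \sum_(s in colgrp T) sgp s *: wa (pe s) 'X_[tmon T].

Lemma mcoeff_DT T m : (DT T)@_m = \sum_(s in colgrp T) sgp s * (tmon T == m#s)%:R.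
Proof.
rewrite raddf_sum; apply: eq_bigr => s _.
by rewrite /= mcoeffZ mcoeff_pe mcoeffX.
Qed.

Lemma gsign_parity (T : bitab n) g (m : 'X_{1..n}) :
  (forall k, odd (m k) = odd (T k).1) -> gsign R g m = \prod_k (-1) ^+ (g.1 k * (T k).1).
Proof.
move=> E; apply: eq_bigr => k _.
by rewrite -signr_odd -[RHS]signr_odd !oddM E.
Qed.

Lemma tmon_parity (T : bitab n) k : odd (tmon T k) = odd (T k).1.
Proof. by rewrite mnmE oddD oddM. Qed.

Lemma DT_parity T m k : (DT T)@_m != 0 -> odd (m k) = odd (T k).1.
Proof.
move=> D0; have [s Cs /eqP E] : exists2 s : 'S_n, s \in colgrp T & tmon T == m#s.
  apply/exists_inP; apply: contraNT D0 => /exists_inPn H; apply/eqP.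
  by rewrite mcoeff_DT big1 // => s /H /negPf ->; rewrite mulr0.
have := tmon_parity T (s^-1 k)%g; rewrite E mnmE permKV => ->.
by have /colgrpP /(_ k)[->] := colgrpV Cs.
Qed.

Lemma DT_anti T : anti T (DT T).
Proof.
move=> g Hg; apply/mpolyP => m; rewrite mcoeff_wa mcoeffZ.
have E : (DT T)@_(m#(g.2)) = sgp g.2 * (DT T)@_m.
  rewrite !mcoeff_DT mulr_sumr.
  rewrite [RHS](reindex_inj (mulIg (g.2))) /=.
  apply: eq_big => s; first by rewrite colgrp_mulr.
  by move=> _; rewrite sgpM [sgp s * sgp _]mulrC !mulrA sgp_sqr mul1r mpermM.
rewrite E; have [D0|D0] := eqVneq ((DT T)@_m) 0; first by rewrite D0 !mulr0.
rewrite mulrA; congr (_ * _); rewrite /theta mulrC; congr (_ * _).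
by apply: gsign_parity => k; exact: DT_parity D0.
Qed.

Lemma DT_tmon (lam : bipart n) T : is_tableau lam T -> (DT T)@_(tmon T) = 1.
Proof.
move=> tabT; rewrite mcoeff_DT (bigD1 1%g) ?colgrp1 //= big1 => [|s /andP[Cs s1]].
  by rewrite /sgp odd_perm1 mul1r mperm1 eqxx addr0.
case: eqP => [E|_]; last by rewrite mulr0.
case/eqP: s1; apply/permP => k; rewrite perm1; apply: (tmon_colgrp tabT) => //.
by rewrite [in RHS]E mnmE.
Qed.

Section Anti.
Variables (lam : bipart n) (T : bitab n).
Hypothesis tabT : is_tableau lam T.

Lemma anti_perm (f : P) (m : 'X_{1..n}) (s : 'S_n) :
  anti T f -> s \in colgrp T -> f@_(m#s) = sgp s * f@_m.
Proof. by move=> /(_ (pe s)) af /af E; rewrite -mcoeff_pe E mcoeffZ theta_pe. Qed.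

Lemma anti_parity (f : P) (m : 'X_{1..n}) k : anti T f -> f@_m != 0 -> odd (m k) = odd (T k).1.
Proof.
move=> /(_ ([ffun j => j == k], 1%g) (colgrp1 T)) E fm.
have := congr1 (mcoeff m) E; rewrite mcoeff_wa mcoeffZ /theta /gsign /= mperm1 /sgp odd_perm1 mul1r.
have S (x : 'I_n -> nat) : \prod_j (-1) ^+ ([ffun j => j == k] j * x j) = (-1) ^+ odd (x k) :> C.
  rewrite (bigD1 k) //= big1 ?mulr1 => [|j /negPf jk]; last by rewrite ffunE jk.
  by rewrite ffunE eqxx mul1n signr_odd.
by rewrite !S => /(mulIf fm); exact: sign_inj.
Qed.

Lemma anti_column (f : P) (m : 'X_{1..n}) k l :
  anti T f -> f@_m != 0 -> samecol T k l -> m k = m l -> k = l.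
Proof.
move=> af fm skl mkl; apply/eqP; apply: contraTT fm => kl; rewrite negbK.
have Ct : tperm k l \in colgrp T.
  case/andP: skl => /eqP e1 /eqP e2; apply/colgrpP => j.
  by case: tpermP => [->|->|].
have := anti_perm m af Ct; rewrite /sgp odd_tperm kl expr1 mulN1r.
have -> : m#(tperm k l) = m by apply/mnmP => j; rewrite mnmE; case: tpermP => [->|->|].
by move/eqP; rewrite -addr_eq0 -mulr2n mulrn_eq0.
Qed.

(** An exponent in f has the parity of the component of its cell, and on each
    column the exponents are distinct since f is antisymmetric there; hence the
    halves dominate the row numbers after sorting the columns. *)
Lemma anti_mdeg (f : P) (m : 'X_{1..n}) : anti T f -> f@_m != 0 ->
  (mdeg (tmon T) <= mdeg m)%N /\
  (mdeg m = mdeg (tmon T) -> exists2 s : 'S_n, s \in colgrp T & m = (tmon T)#s).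
Proof.
move=> af fm; have par k := anti_parity k af fm.
have c2 (c : 'I_2) : odd c = c :> nat by case: c => -[|[|]].
have Em k : m k = (2 * (m k)./2 + (T k).1)%N.
  by rewrite -{1}(odd_double_half (m k)) par c2 addnC mul2n.
have [k l skl E|s Cs Hs] := @column_sort _ _ _ tabT (fun k => (m k)./2).
  apply: (anti_column af fm skl); rewrite Em [RHS]Em E.
  by case/andP: skl => /eqP ->.
have les k : (((tmon T)#s) k <= m k)%N.
  rewrite !mnmE Em; have /colgrpP /(_ k)[-> _] := Cs.
  by rewrite leq_add2r leq_mul2l Hs orbT.
have dE : mdeg ((tmon T)#s) = mdeg (tmon T) by rewrite mdeg_mperm.
split; first by rewrite -dE !mdegE; apply: leq_sum => k _; exact: les.
rewrite -dE => E; exists s => //; apply/mnmP => k; apply/eqP; rewrite eq_sym.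
have [_] := leqif_sum (fun (j : 'I_n) (_ : true) => leqif_eq (les j)).
by rewrite -!mdegE E eqxx => /esym/forall_inP /(_ k isT).
Qed.
End Anti.

End SpechtPolynomials.

(** * Irreducibility and separation of the shapes *)

Section Irreducibility.
Variables (R : realType) (n : nat).
Local Notation C := R[i].
Local Notation P := {mpoly C[n]}.
Local Notation W := (Bn n).
Local Notation A := {ffun W -> C}.

(** All monomials of f have the same exponents up to order. *)
Definition orb (m0 : 'X_{1..n}) (f : P) := forall m, f@_m != 0 -> exists s : 'S_n, m = m0#s.

Lemma orb_sum m0 (I : finType) (Q : pred I) (F : I -> P) :
  (forall i, orb m0 (F i)) -> orb m0 (\sum_(i | Q i) F i).
Proof.
move=> oF m; rewrite raddf_sum /= => H.
have [i Hi] : exists i, (F i)@_m != 0; last exact: oF Hi.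
apply/existsP; apply: contraNT H => /existsPn H.
by rewrite big1 // => i _; apply/eqP; have := H i; rewrite negbK.
Qed.

Lemma orbZ m0 c f : orb m0 f -> orb m0 (c *: f).
Proof. by move=> of_ m; rewrite mcoeffZ mulf_eq0 negb_or => /andP[_ /of_]. Qed.

Lemma orb_wa m0 g f : orb m0 f -> orb m0 (wa g f).
Proof.
move=> of_ m; rewrite mcoeff_wa mulf_eq0 negb_or => /andP[_ /of_[s E]].
exists ((g.2)^-1 * s)%g; rewrite mpermM -E.
by apply/mnmP => k; rewrite !mnmE permKV.
Qed.

Lemma orb_pact m0 a f : orb m0 f -> orb m0 (pact a f).
Proof. by move=> of_; rewrite pactE; apply: orb_sum => g; apply: orbZ; exact: orb_wa. Qed.

Lemma orb_X m0 : orb m0 'X_[m0].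
Proof.
move=> m; rewrite mcoeffX; have [E _|_] := eqVneq m0 m; last by rewrite eqxx.
by exists 1%g; rewrite mperm1 E.
Qed.

Lemma orb_DT T : orb (tmon T) (DT R T).
Proof. by apply: orb_sum => s; apply: orbZ; apply: orb_wa; exact: orb_X. Qed.

Lemma orb_mdeg m0 f m : orb m0 f -> f@_m != 0 -> mdeg m = mdeg m0.
Proof. by move=> of_ /of_[s ->]; rewrite mdeg_mperm. Qed.

Lemma poly_coeff_neq0 (f : P) : f != 0 -> exists m, f@_m != 0.
Proof. by move=> f0; exists (mlead f); rewrite mleadc_eq0. Qed.

(** The projector onto the polynomials on which the columns act by [theta]. *)
Definition eps (T : bitab n) : A :=
  [ffun g : W => (#|[set h : W | h.2 \in colgrp T]|%:R)^-1 *
     (if g.2 \in colgrp T then theta R T g else 0)].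

Local Notation H T := [set h : W | h.2 \in colgrp T].

Let H0 T : (#|H T|%:R : C) != 0.
Proof.
rewrite pnatr_eq0 -lt0n; apply/card_gt0P; exists 1%g.
by rewrite inE colgrp1.
Qed.

Lemma pact_eps T f :
  pact (eps T) f = (#|H T|%:R)^-1 *: \sum_(g in H T) theta R T g *: wa g f.
Proof.
rewrite pactE scaler_sumr [RHS]big_mkcond; apply: eq_bigr => g _.
by rewrite ffunE inE; case: ifP; rewrite ?mulr0 ?scale0r ?scalerA.
Qed.

Lemma theta_conj T (g : W) : (theta R T g)^*%R = theta R T g.
Proof.
rewrite /theta /sgp rmorphM rmorphXn rmorphN1 rmorph_prod; congr (_ * _).
by apply: eq_bigr => k _; rewrite /= rmorphXn rmorphN1.
Qed.

Lemma eps_anti T f : anti T (pact (eps T) f).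
Proof.
move=> h Ch; rewrite pact_eps waZ wa_sum scalerA mulrC -scalerA; congr (_ *: _).
rewrite scaler_sumr [RHS](reindex_inj (mulgI h)) /=.
apply: eq_big => g.
  rewrite [in LHS]in_set [in RHS]in_set; exact: (esym (colgrp_mulr _ Ch)).
rewrite inE => Cg; rewrite waZ -waM scalerA thetaM // mulrA theta_sqr mul1r.
by [].
Qed.

Lemma anti_eps T f : anti T f -> pact (eps T) f = f.
Proof.
move=> af; rewrite pact_eps (eq_bigr (fun=> f)) => [|g]; last first.
  by rewrite inE => /af ->; rewrite scalerA theta_sqr scale1r.
by rewrite sumr_const -[f *+ _]scaler_nat scalerA mulVf ?scale1r.
Qed.

(** In the smallest degree only the monomials of [DT T] are left, and their
    coefficients are determined by one of them. *)
Lemma anti_scalar (lam : bipart n) T f : is_tableau lam T -> anti T f ->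
  (forall m, f@_m != 0 -> mdeg m = mdeg (tmon T)) -> f = f@_(tmon T) *: DT R T.
Proof.
move=> tabT af df; apply/mpolyP => m; rewrite mcoeffZ.
have key (h : P) : anti T h -> h@_m != 0 -> mdeg m = mdeg (tmon T) ->
    exists2 s : 'S_n, s \in colgrp T & m = (tmon T)#s.
  by move=> ah hm dm; apply: (anti_mdeg tabT ah hm).2.
have val (s : 'S_n) : m = (tmon T)#s -> s \in colgrp T -> f@_m = f@_(tmon T) * (DT R T)@_m.
  move=> -> Cs; rewrite (anti_perm _ af Cs) (anti_perm _ (@DT_anti R n T) Cs).
  by rewrite (DT_tmon R tabT) mulr1 mulrC.
have [fm|fm] := eqVneq (f@_m) 0; last first.
  by have [s Cs Em] := key f af fm (df m fm); exact: val Em Cs.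
have [Dm|Dm] := eqVneq ((DT R T)@_m) 0; first by rewrite fm Dm mulr0.
have [s Cs Em] := key _ (@DT_anti R n T) Dm (orb_mdeg (@orb_DT T) Dm).
exact: val Em Cs.
Qed.

(** The invariant hermitian form for which monomials are orthonormal.  The bound
    N on the degrees makes the sum finite. *)
Definition herm N (f h : P) : C := \sum_(m : 'X_{1..n < N}) f@_m * (h@_m)^*%R.

Lemma herm_wa N g f h : herm N (wa g f) (wa g h) = herm N f h.
Proof.
have bP (s : 'S_n) (m : 'X_{1..n < N}) : (mdeg (m#s) < N)%N.
  by rewrite mdeg_mperm bmdeg.
pose b s m := BMultinom (bP s m).
have b_inj s : injective (b s).
  move=> m m' /(congr1 val) /= /(@mperm_inj n s) E; exact: val_inj.
rewrite /herm [RHS](reindex_inj (@b_inj g.2)); apply: eq_bigr => m _ /=.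
rewrite !mcoeff_wa rmorphM mulrACA.
suff -> : gsign R g m * (gsign R g m)^*%R = 1 by rewrite mul1r.
suff -> : (gsign R g m)^*%R = gsign R g m by exact: gsign_sqr.
by rewrite /gsign rmorph_prod; apply: eq_bigr => k _; rewrite /= rmorphXn rmorphN1.
Qed.

Lemma herm_linl N c f1 f2 h : herm N (c *: f1 + f2) h = c * herm N f1 h + herm N f2 h.
Proof.
rewrite /herm mulr_sumr -big_split; apply: eq_bigr => m _ /=.
by rewrite mcoeffD mcoeffZ mulrDl mulrA.
Qed.
Lemma herm0l N h : herm N 0 h = 0.
Proof. by rewrite /herm big1 // => m _; rewrite mcoeff0 mul0r. Qed.
Lemma hermZl N c f h : herm N (c *: f) h = c * herm N f h.
Proof. by rewrite -[c *: f]addr0 herm_linl herm0l addr0. Qed.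
Lemma hermZr N c f h : herm N f (c *: h) = c^*%R * herm N f h.
Proof.
rewrite /herm mulr_sumr; apply: eq_bigr => m _.
by rewrite mcoeffZ rmorphM mulrCA.
Qed.
Lemma herm_suml N (I : finType) (Q : pred I) (F : I -> P) h :
  herm N (\sum_(i | Q i) F i) h = \sum_(i | Q i) herm N (F i) h.
Proof.
rewrite /herm exchange_big; apply: eq_bigr => m _ /=.
by rewrite raddf_sum mulr_suml.
Qed.
Lemma hermC N f h : herm N f h = (herm N h f)^*%R.
Proof.
rewrite /herm rmorph_sum; apply: eq_bigr => m _.
by rewrite [RHS]rmorphM [X in _ = _ * X]conjCK mulrC.
Qed.

Lemma herm_eq0 N f : (forall m, f@_m != 0 -> (mdeg m < N)%N) -> herm N f f = 0 -> f = 0.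
Proof.
move=> fN /eqP; rewrite psumr_eq0 => [/allP H'|m _]; last exact: mul_conjC_ge0.
apply/mpolyP => m; rewrite mcoeff0; apply/eqP; apply: contraT => fm.
have := H' (BMultinom (fN m fm)) (mem_index_enum _).
by rewrite /= mul_conjC_eq0 (negPf fm).
Qed.

(** The projector [eps T] maps every translate of f to a multiple of [DT T]; if
    all these multiples vanish then f is orthogonal to the translates of
    [DT T], of which it is a combination, so that f = 0. *)
Lemma irreducible (lam : bipart n) T a : is_tableau lam T -> pact a (DT R T) != 0 ->
  exists b, pact b (pact a (DT R T)) = DT R T.
Proof.
move=> tabT; set f := pact a _ => f0.
have of_ : orb (tmon T) f by apply: orb_pact; exact: orb_DT.
have sc g : pact (eps T) (wa g f) = (pact (eps T) (wa g f))@_(tmon T) *: DT R T.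
  apply: anti_scalar tabT (@eps_anti _ _) _ => m; apply: orb_mdeg.
  by apply: orb_pact; exact: orb_wa.
have [/existsP[g cg]|/existsPn c0] :=
    boolP [exists g : W, (pact (eps T) (wa g f))@_(tmon T) != 0].
  exists (((pact (eps T) (wa g f))@_(tmon T))^-1 *: gconv (eps T) (gdelta R g)).
  by rewrite pactZl pact_conv pact_delta [X in _ *: X]sc scalerA mulVf // scale1r.
(* all polynomials involved are homogeneous of the degree of DT T *)
pose N := (mdeg (tmon T)).+1.
have orth g : herm N (wa g f) (DT R T) = 0.
  have E h : h \in H T -> theta R T h * herm N (wa h (wa g f)) (DT R T) =
      herm N (wa g f) (DT R T).
    rewrite inE => Ch; rewrite -[RHS](herm_wa N h) (@DT_anti R n T h Ch).
    by rewrite hermZr theta_conj.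
  have : herm N (pact (eps T) (wa g f)) (DT R T) = 0.
    by rewrite sc; have := c0 g; rewrite negbK => /eqP ->; rewrite scale0r herm0l.
  rewrite pact_eps hermZl herm_suml => /eqP; rewrite mulf_eq0 invr_eq0 (negPf (H0 T)) /=.
  rewrite (eq_bigr (fun=> herm N (wa g f) (DT R T))) => [|h Hh]; last by rewrite hermZl E.
  by rewrite sumr_const -[_ *+ _]mulr_natr mulf_eq0 (negPf (H0 T)) orbF => /eqP.
case/eqP: f0; apply: (@herm_eq0 N) => [m fm|]; first by rewrite (orb_mdeg of_ fm).
rewrite {2}/f pactE hermC herm_suml rmorph_sum big1 // => g _ /=.
rewrite hermZl -(herm_wa N g^-1%g) waVK hermC orth rmorph0 mulr0.
by rewrite rmorph0.
Qed.

(** Inclusion of the annihilators, that is, existence of a W-map from the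
    representation generated by f to that generated by h sending f to h. *)
Definition annle (f h : P) := forall a, pact a f = 0 -> pact a h = 0.

Lemma annle_fix (f h : P) a : annle f h -> pact a f = f -> pact a h = h.
Proof.
move=> fh af; have := fh (a - gone R n).
by rewrite !pactDl !pactNl !pact1 af subrr => /(_ erefl)/eqP; rewrite subr_eq0 => /eqP.
Qed.

Lemma irreducible_ann (lam : bipart n) T h : is_tableau lam T ->
  annle (DT R T) h -> h != 0 -> annle h (DT R T).
Proof.
move=> tabT le_h h0 a ah; apply/eqP; apply: contraNT h0 => aD.
have [b Eb] := irreducible tabT aD.
by rewrite -(annle_fix le_h (a := gconv b a)) pact_conv ?Eb // ah raddf0.
Qed.

Lemma eps_DT T : pact (eps T) (DT R T) = DT R T.
Proof. by apply: anti_eps; exact: DT_anti. Qed.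

Lemma annle_anti T h : annle (DT R T) h -> anti T h.
Proof. by move=> le_h; rewrite -(annle_fix le_h (eps_DT T)); exact: eps_anti. Qed.

Lemma annle_mdeg (lam : bipart n) T m0 h : is_tableau lam T -> annle (DT R T) h ->
  h != 0 -> orb m0 h -> (mdeg (tmon T) <= mdeg m0)%N.
Proof.
move=> tabT le_h h0 oh; have [m hm] := poly_coeff_neq0 h0.
by rewrite -(orb_mdeg oh hm); case: (anti_mdeg tabT (annle_anti le_h) hm).
Qed.

Lemma young_row (lam : bipart n) T nu r c : is_tableau lam T ->
  ((r, c) \in sval lam nu) = (c < #|[set k | ((T k).1 == nu) && ((T k).2.1 == r)]|)%N.
Proof.
move=> tabT; set K := [set k | _].
have -> : #|K| = #|[set d | (r, d) \in sval lam nu]|.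
  have inK k : k \in K -> (T k).1 = nu /\ (T k).2.1 = r.
    by rewrite inE => /andP[/eqP ? /eqP].
  rewrite -(card_in_imset (f := fun k => (T k).2.2)) => [|k l /inK[a1 a2] /inK[b1 b2] e].
    apply: eq_card => d; rewrite [RHS]inE; apply/imsetP/idP => [[k /inK[<- <-] ->]|].
      by have := tab_mem tabT k; case: (T k) => ? [].
    case/(tab_entry tabT) => k Ek; exists k; last by rewrite Ek.
    by rewrite inE Ek /= !eqxx.
  by apply: (tab_pos_inj tabT); rewrite ?a1 ?b1 ?a2 ?b2.
rewrite -downclosed_mem ?inE // => j k jk; rewrite !inE => kl.
exact: (young_closed kl).
Qed.

Lemma tmon_eqE (T T' : bitab n) k l : tmon T k = tmon T' l ->
  (T k).1 = (T' l).1 /\ (T k).2.1 = (T' l).2.1.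
Proof.
rewrite !mnmE => E; have := ltn_ord (T k).1; have := ltn_ord (T' l).1.
by split; apply: val_inj => /=; lia.
Qed.

Lemma tmon_shape (lam mu : bipart n) T T' (s : 'S_n) :
  is_tableau lam T -> is_tableau mu T' -> tmon T = (tmon T')#s -> lam = mu.
Proof.
move=> tabT tabT' /mnmP E; apply: val_inj; apply/ffunP => nu; apply/setP => -[r c].
rewrite (young_row _ _ _ tabT) (young_row _ _ _ tabT'); congr (_ < _)%N.
rewrite -(card_imset _ (@perm_inj _ s)); apply: eq_card => k.
have Ek j : (T j).1 = (T' (s j)).1 /\ (T j).2.1 = (T' (s j)).2.1.
  by apply: tmon_eqE; have := E j; rewrite [in RHS]mnmE.
rewrite [RHS]inE; apply/imsetP/idP => [[j]|].
  by rewrite inE => + ->; have [<- <-] := Ek j.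
move=> Hk; exists (s^-1 k)%g; last by rewrite permKV.
by rewrite inE; have [-> ->] := Ek (s^-1 k)%g; rewrite permKV.
Qed.

(** By irreducibility the map can be reversed, so [DT T] and [DT T'] have the
    same degree by [anti_mdeg]; then the image b (DT T') of the former is a
    multiple of it by [anti_scalar], and a common monomial records the row
    lengths of both shapes. *)
Lemma distinct_shapes (lam mu : bipart n) T T' b :
  is_tableau lam T -> is_tableau mu T' -> annle (DT R T) (pact b (DT R T')) ->
  pact b (DT R T') != 0 -> lam = mu.
Proof.
move=> tabT tabT' le_h h0; set h := pact b _ in le_h h0.
have oh : orb (tmon T') h by apply: orb_pact; exact: orb_DT.
have [b' Eb'] := irreducible tabT' h0.
have le2 : annle (DT R T') (pact b' (DT R T)).
  move=> a aD; rewrite -pact_conv; apply: (irreducible_ann tabT le_h h0).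
  by rewrite pact_conv Eb'.
have D'0 : DT R T' != 0.
  by apply: contraNneq h0 => E; rewrite /h E raddf0.
have h20 : pact b' (DT R T) != 0.
  apply: contraNneq D'0 => E; rewrite -Eb'; apply/eqP; exact: (le_h _ E).
have o2 : orb (tmon T) (pact b' (DT R T)) by apply: orb_pact; exact: orb_DT.
have dE : mdeg (tmon T) = mdeg (tmon T').
  by apply/eqP; rewrite eqn_leq (annle_mdeg tabT le_h h0 oh) (annle_mdeg tabT' le2 h20 o2).
have Eh : h = h@_(tmon T) *: DT R T.
  by apply: (anti_scalar tabT (annle_anti le_h)) => m /(orb_mdeg oh); rewrite dE.
have hT : h@_(tmon T) != 0 by apply: contraNneq h0 => E; rewrite Eh E scale0r.
by have [s Es] := oh _ hT; exact: tmon_shape tabT tabT' Es.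
Qed.

Lemma std_lt (T : bitab n) k l : is_standard T -> (T k).1 = (T l).1 ->
  (T k).2.2 = (T l).2.2 -> ((T k).2.1 < (T l).2.1)%N -> (k < l)%N.
Proof.
move=> /forallP /(_ k) /forallP /(_ l) /implyP std e1 e2 hlt; apply: std.
by rewrite e1 e2 !eqxx hlt orbT.
Qed.

Lemma std_row_lt (T : bitab n) k l : is_standard T -> (T k).1 = (T l).1 ->
  (T k).2.1 = (T l).2.1 -> ((T k).2.2 < (T l).2.2)%N -> (k < l)%N.
Proof.
move=> /forallP /(_ k) /forallP /(_ l) /implyP std e1 e2 hlt; apply: std.
by rewrite e1 e2 !eqxx hlt.
Qed.

(** The first entry moved by s goes to a later entry of its column, which lies
    in a lower row since T is standard. *)
Lemma tmon_min (lam : bipart n) (T : bitab n) s : T \in STab lam -> s \in colgrp T ->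
  s != 1%g -> (tmon T < (tmon T)#s)%O.
Proof.
rewrite inE => /andP[tabT stdT] Cs s1.
have [k0 sk0] : exists k, s k != k.
  apply/existsP; rewrite -negb_forall; apply: contra s1 => /forallP E.
  by apply/eqP/permP => k; rewrite perm1; apply/eqP.
have [k sk kmin] := @arg_minnP _ k0 (fun k => s k != k) val sk0.
apply/ltmcP; first by rewrite mdeg_mperm.
have fixlt (j : 'I_n) : (j < k)%N -> s j = j.
  by move=> jk; apply/eqP; apply: contraTT jk => /kmin; rewrite -leqNgt.
exists k => [j jk|]; first by rewrite [RHS]mnmE fixlt.
rewrite [X in (_ < X)%N]mnmE !mnmE.
have /colgrpP /(_ k)[e1 e2] := Cs; rewrite e1.
suff : ((T k).2.1 < (T (s k)).2.1)%N by lia.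
have ksk : (k < s k)%N.
  rewrite ltn_neqAle eq_sym sk leqNgt; apply/negP => hlt.
  by have := fixlt _ hlt => /perm_inj E; rewrite E eqxx in sk.
rewrite ltnNge leq_eqVlt; apply/negP => /orP[/eqP/val_inj e3|hlt].
  by case/eqP: sk; apply: (tab_pos_inj tabT).
by have := std_lt stdT e1 e2 hlt; rewrite ltnNge ltnW.
Qed.

(** Hence a standard tableau is determined by the row and the component of each
    entry. *)
Lemma std_col (lam : bipart n) (T : bitab n) k : T \in STab lam ->
  (T k).2.2 = #|[set l : 'I_n | (l < k)%N & samerow T l k]| :> nat.
Proof.
rewrite inE => /andP[tabT stdT].
have E : [set l : 'I_n | (l < k)%N & samerow T l k] =
    [set l : 'I_n | ((T l).2.2 < (T k).2.2)%N & samerow T l k].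
  apply/setP => l; rewrite !inE andbC [RHS]andbC.
  case: (boolP (samerow T l k)) => //= /andP[/eqP e1 /eqP e2].
  apply/idP/idP => [lk|]; last exact: std_row_lt.
  rewrite ltnNge leq_eqVlt; apply/negP => /orP[/eqP/val_inj e3|hlt].
    by have := tab_pos_inj tabT e1 e2 (esym e3) => Elk; rewrite Elk ltnn in lk.
  by have := std_row_lt stdT (esym e1) (esym e2) hlt; rewrite ltnNge ltnW.
rewrite E -[LHS](size_iota 0) cardE -(size_map (fun l => val (T l).2.2)).
apply/eqP; rewrite eqn_leq; apply/andP; split; apply: uniq_leq_size => [|x].
- exact: iota_uniq.
- rewrite mem_iota add0n => xk; have xn : (x < n)%N by apply: ltn_trans xk _.
  have /(tab_entry tabT)[l El] : ((T k).2.1, Ordinal xn) \in sval lam (T k).1.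
    apply: (young_closed (tab_mem tabT k)) => //=; exact: ltnW.
  apply/mapP; exists l; last by rewrite El.
  by rewrite mem_enum inE /samerow El /= !eqxx !andbT.
- rewrite map_inj_in_uniq ?enum_uniq // => l l'; rewrite !mem_enum !inE.
  move=> /andP[_ /andP[/eqP a1 /eqP a2]] /andP[_ /andP[/eqP b1 /eqP b2]] /val_inj e.
  by apply: (tab_pos_inj tabT); rewrite ?a1 ?a2 ?b1 ?b2.
case/mapP => l; rewrite mem_enum inE => /andP[hlt _] ->.
by rewrite mem_iota add0n.
Qed.

Lemma tmon_inj (lam : bipart n) : {in STab lam &, injective (@tmon n)}.
Proof.
move=> T T' sT sT' /mnmP E; apply/ffunP => k.
have Ek j : (T j).1 = (T' j).1 /\ (T j).2.1 = (T' j).2.1 by apply: tmon_eqE.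
have [e1 e2] := Ek k; have e3 : (T k).2.2 = (T' k).2.2.
  apply: val_inj; rewrite /= (std_col _ sT) (std_col _ sT'); apply: eq_card => l.
  by rewrite !inE /samerow; have [-> ->] := Ek l; have [-> ->] := Ek k.
by move: e1 e2 e3; case: (T k) => a [b c]; case: (T' k) => a' [b' c'] /= -> -> ->.
Qed.

(** Among the T with nonzero coefficient, one with the smallest [tmon T] has a
    monomial that occurs in none of the other [DT T'], by [tmon_min]. *)
Lemma DT_independent (lam : bipart n) (c : bitab n -> C) :
  \sum_(T in STab lam) c T *: DT R T = 0 -> forall T, T \in STab lam -> c T = 0.
Proof.
move=> E0 T1 sT1; apply/eqP; apply: contraT => c1.
have [T /andP[sT cT] Tmin] := Order.TotalTheory.arg_minP (fun T : bitab n => tmon T)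
  (introT andP (conj sT1 c1) : (fun T => (T \in STab lam) && (c T != 0)) T1).
have := congr1 (mcoeff (tmon T)) E0; rewrite raddf_sum mcoeff0 (bigD1 T) //= mcoeffZ.
have tabT : is_tableau lam T by move: sT; rewrite inE => /andP[].
rewrite (DT_tmon R tabT) mulr1 big1 ?addr0 => [E|T' /andP[sT' TT']].
  by rewrite E eqxx in cT.
rewrite mcoeffZ; have [->|cT'] := eqVneq (c T') 0; first by rewrite mul0r.
rewrite mcoeff_DT big1 ?mulr0 // => s Cs; case: eqP => [E|_]; last by rewrite mulr0.
have le_TT' : (tmon T <= tmon T')%O by apply: Tmin; rewrite sT' cT'.
have Es : tmon T = (tmon T')#(s^-1)%g.
  by rewrite E; apply/mnmP => k; rewrite !mnmE permKV.
have [s1|s1] := eqVneq s 1%g.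
  have ET : tmon T = tmon T' by rewrite Es s1 invg1 mperm1.
  by rewrite (tmon_inj sT sT' ET) eqxx in TT'.
have := tmon_min sT' (colgrpV Cs) _; rewrite invg_eq1 s1 -Es => /(_ isT).
by move=> hlt; rewrite (Order.POrderTheory.lt_geF hlt) in le_TT'.
Qed.

End Irreducibility.

(** * Higher Specht polynomials as symmetrizations *)

Section Stabilizers.
Variables (n : nat) (T : bitab n) (q : 'I_n -> 'I_n).

(** For q giving the row or the column of each entry this is the group of the
    whole tableau, and [pstab] that of one component. *)
Definition fstab : {set 'S_n} :=
  [set s : 'S_n | [forall k, ((T (s k)).1 == (T k).1) && (q (s k) == q k)]].
Definition pstab (nu : 'I_2) : {set 'S_n} :=
  [set s : 'S_n | [forall k, if (T k).1 == nu
     then ((T (s k)).1 == nu) && (q (s k) == q k) else s k == k]].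

Lemma I2E (c : 'I_2) : c = 0 \/ c = 1.
Proof. by case: c => -[|[|]] // i; [left|right]; exact: val_inj. Qed.

Let comp (nu : 'I_2) : {set 'I_n} := [set k | (T k).1 == nu].

Lemma pstabP nu (s : 'S_n) : reflect
  (forall k, if (T k).1 == nu then (T (s k)).1 = nu /\ q (s k) = q k else s k = k)
  (s \in pstab nu).
Proof.
rewrite inE; apply: (iffP forallP) => H k; have := H k; case: ifP => _.
- by case/andP => /eqP ? /eqP.
- by move/eqP.
- by case=> -> ->; rewrite !eqxx.
by move->.
Qed.

Lemma fstabP (s : 'S_n) : reflect (forall k, (T (s k)).1 = (T k).1 /\ q (s k) = q k)
  (s \in fstab).
Proof.
rewrite inE; apply: (iffP forallP) => H k; first by case/andP: (H k) => /eqP ? /eqP.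
by case: (H k) => -> ->; rewrite !eqxx.
Qed.

Lemma pstab_comp nu s k : s \in pstab nu -> (T (s k)).1 = (T k).1.
Proof. by move=> /pstabP /(_ k); case: eqP => [-> []|_ ->]. Qed.

Lemma pstab_commute (q' : 'I_n -> 'I_n) (s t : 'S_n) : s \in pstab 0 ->
  t \in [set t : 'S_n | [forall k, if (T k).1 == 1
     then ((T (t k)).1 == 1) && (q' (t k) == q' k) else t k == k]] -> (s * t = t * s)%g.
Proof.
move=> s0 t1; have t1' k : if (T k).1 == 1 then (T (t k)).1 = 1 else t k = k.
  by move: t1; rewrite inE => /forallP /(_ k); case: ifP => _; [case/andP => /eqP | move/eqP].
have s0' k := pstabP 0 s s0 k.
apply/permP => k; rewrite !permM.
case: (I2E (T k).1) => E.
  have := s0' k; rewrite E eqxx => -[E1 _].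
  by have := t1' (s k); have := t1' k; rewrite E1 E /= => -> ->.
have := t1' k; rewrite E eqxx => E1.
by have := s0' (t k); have := s0' k; rewrite E1 E /= => -> ->.
Qed.

(** A permutation preserving the components is the product of its restrictions
    to them. *)
Lemma fstab_split (V : zmodType) (F : 'S_n -> V) :
  \sum_(s in fstab) F s = \sum_(s0 in pstab 0) \sum_(s1 in pstab 1) F (s1 * s0)%g.
Proof.
rewrite pair_big_dep /=.
pose res nu (s : 'S_n) := restr_perm (comp nu) s.
have nP (s : 'S_n) nu : (forall k, (T (s k)).1 = (T k).1) -> s \in ('N(comp nu | 'P))%g.
  move=> Hs; apply/astabsP => k; rewrite !inE /= apermE Hs //.
have resE (s : 'S_n) nu k : (forall k, (T (s k)).1 = (T k).1) ->
    res nu s k = if (T k).1 == nu then s k else k.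
  move=> Hs; case: eqP => [E|E].
    by rewrite /res restr_permE ?nP // inE E.
  by apply: (out_perm (restr_perm_on _ _)); rewrite inE; apply/eqP.
have neq01 : (0 : 'I_2) == 1 = false by [].
have neq10 : (1 : 'I_2) == 0 = false by [].
rewrite (reindex_onto (fun p : 'S_n * 'S_n => (p.2 * p.1)%g) (fun s => (res 0 s, res 1 s))) /=.
  apply: eq_bigl => -[s0 s1] /=.
  apply/andP/andP => [[/fstabP sf /eqP[Ea Eb]]|[/pstabP p0 /pstabP p1]].
    have Hs k := (sf k).1; move: (s1 * s0)%g sf Ea Eb Hs => s sf <- <- Hs.
    split; apply/pstabP => k; rewrite resE //.
      by case E: ((T k).1 == 0) => //=; have [-> ->] := sf k; rewrite (eqP E).
    by case E: ((T k).1 == 1) => //=; have [-> ->] := sf k; rewrite (eqP E).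
  have E0 k : (T (s0 k)).1 = (T k).1 by exact: (pstab_comp k (introT (pstabP 0 s0) p0)).
  have E1 k : (T (s1 k)).1 = (T k).1 by exact: (pstab_comp k (introT (pstabP 1 s1) p1)).
  have H k : (T ((s1 * s0)%g k)).1 = (T k).1 by rewrite permM E0 E1.
  split.
    apply/fstabP => k; split; first exact: H.
    rewrite permM; have := p0 (s1 k); have := p1 k; rewrite E1.
    case: (I2E (T k).1) => ->; first by rewrite eqxx neq01 => -> [].
    by rewrite eqxx neq10 => -[_ <-] ->.
  apply/eqP; congr (_, _); apply/permP => k; rewrite resE // permM.
    have := p0 k; have := p1 k; case: (I2E (T k).1) => ->; rewrite ?eqxx ?neq01 ?neq10.
      by move=> ->.
    by [].
  have := p0 (s1 k); have := p1 k; rewrite E1.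
  case: (I2E (T k).1) => ->; rewrite ?eqxx ?neq01 ?neq10.
    by [].
  by move=> _ ->.
move=> s /fstabP sf; have Hs k := (sf k).1; apply/permP => k; rewrite permM !resE //.
case: (I2E (T k).1) => E; rewrite E /= ?Hs ?E //.
Qed.

End Stabilizers.

Section SpechtFormula.
Variables (R : realType) (n : nat).
Local Notation C := R[i].
Local Notation P := {mpoly C[n]}.
Local Notation W := (Bn n).
Local Notation A := {ffun W -> C}.

(** The Young symmetrizer of the whole tableau, both components at once. *)
Definition symmetrize (T : bitab n) (e : 'X_{1..n}) : P :=
  \sum_(t in colgrp T) \sum_(s in rowgrp T) sgp R t *: wa (pe t) (wa (pe s) 'X_[e]).

Definition spexp (S T : bitab n) : 'X_{1..n} :=
  [multinom (2 * cell_index S (T k) + (T k).1)%N | k < n].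

Lemma sum_prod4 (B : comNzRingType) (I0 I1 J0 J1 : finType) (Q0 : pred I0) (Q1 : pred I1)
    (S0 : pred J0) (S1 : pred J1) (a : I0 -> J0 -> B) (b : I1 -> J1 -> B) :
  \sum_(t0 | Q0 t0) \sum_(t1 | Q1 t1) \sum_(s0 | S0 s0) \sum_(s1 | S1 s1) a t0 s0 * b t1 s1 =
  (\sum_(s0 | S0 s0) \sum_(t0 | Q0 t0) a t0 s0) * (\sum_(s1 | S1 s1) \sum_(t1 | Q1 t1) b t1 s1).
Proof.
rewrite [X in _ = X * _]exchange_big [X in _ = _ * X]exchange_big big_distrlr /=.
by apply: eq_bigr => t0 _; apply: eq_bigr => t1 _; rewrite big_distrlr.
Qed.

Section Product.
Variables (T : bitab n) (e : 'X_{1..n}).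
Let N (nu : 'I_2) : P := \prod_(k < n | (T k).1 == nu) 'X_k ^+ e k.

Let fixN (q : 'I_n -> 'I_n) (nu nu' : 'I_2) s : nu != nu' -> s \in pstab T q nu ->
  wa (pe s) (N nu') = N nu'.
Proof.
move=> nn /pstabP ps; rewrite /N wa_prod; apply: eq_bigr => k /eqP Ek.
rewrite waX wa_XU ffunE expr0 scale1r /=.
by have := ps k; rewrite Ek eq_sym (negPf nn) => ->.
Qed.

Let waC2 (s t : 'S_n) (f : P) : (s * t = t * s)%g ->
  wa (pe s) (wa (pe t) f) = wa (pe t) (wa (pe s) f).
Proof. by move=> E; rewrite -!waM !peM E. Qed.

(** The stabilizers of the first component fix the variables of the second and
    commute with the stabilizers of the second, and conversely. *)
Lemma symmetrize_split :
  symmetrize T e =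
  (\sum_(s in rowstab T 0) \sum_(t in colstab T 0) sgp R t *: wa (pe t) (wa (pe s) (N 0))) *
  (\sum_(s in rowstab T 1) \sum_(t in colstab T 1) sgp R t *: wa (pe t) (wa (pe s) (N 1))).
Proof.
rewrite -sum_prod4 /symmetrize.
rewrite (fstab_split T (fun k => (T k).2.2)).
apply: eq_bigr => t0 Ht0; apply: eq_bigr => t1 Ht1.
rewrite (fstab_split T (fun k => (T k).2.1)).
apply: eq_bigr => s0 Hs0; apply: eq_bigr => s1 Hs1.
have EN : 'X_[e] = N 0 * N 1 :> P.
  rewrite mpolyXE_id (bigID (fun k => (T k).1 == 0)) /=; congr (_ * _).
  by apply: eq_bigl => k; case: (I2E (T k).1) => ->.
rewrite EN sgpM -!peM !waM !wa_mul -scalerAl -scalerAr scalerA mulrC; congr (_ *: (_ * _)).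
  rewrite (fixN (nu' := 0) _ Hs1) // (waC2 _ (esym (pstab_commute Hs0 Ht1))).
  by rewrite (fixN (nu' := 0) _ Ht1).
rewrite (waC2 _ (pstab_commute Hs0 Hs1)) (fixN (nu' := 1) _ Hs0) //.
rewrite (waC2 _ (pstab_commute Ht0 Ht1)) (waC2 _ (pstab_commute Ht0 Hs1)).
by rewrite (fixN (nu' := 1) _ Ht0).
Qed.

End Product.

Lemma hook_gt0 (D : {set 'I_n * 'I_n}) c : c \in D -> (0 < hook D c)%N.
Proof. by move=> cD; apply/card_gt0P; exists c; rewrite inE cD eqxx leqnn. Qed.

Lemma hookprod_neq0 (D : {set 'I_n * 'I_n}) : (hookprod D)%:R != 0 :> C.
Proof.
rewrite pnatr_eq0 -lt0n /hookprod; apply: prodn_cond_gt0 => c.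
exact: hook_gt0.
Qed.

(** The factor x_k^nu is constant on a component, hence it can be brought inside
    the symmetrizer of that component. *)
Lemma specht_symmetrize (lam : bipart n) (S T : bitab n) : exists2 c : C, c != 0 &
  specht lam S T = c *: symmetrize T (spexp S T).
Proof.
exists ((hookprod (sval lam 0))%:R^-1 * (hookprod (sval lam 1))%:R^-1).
  by rewrite mulf_neq0 ?invr_eq0 ?hookprod_neq0.
have Y nu : young_symm lam T nu
       (\prod_(k < n | (T k).1 == nu) 'X_k ^+ (2 * cell_index S (T k))) *
     \prod_(k < n | (T k).1 == nu) 'X_k ^+ nu = (hookprod (sval lam nu))%:R^-1 *:
    \sum_(s in rowstab T nu) \sum_(t in colstab T nu) sgp R t *: wa (pe t) (wa (pe s)
      (\prod_(k < n | (T k).1 == nu) 'X_k ^+ spexp S T k)).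
  rewrite /young_symm -scalerAl mulr_suml; congr (_ *: _).
  have xI (q : 'I_n -> 'I_n) s : s \in pstab T q nu ->
      wa (pe s) (\prod_(k < n | (T k).1 == nu) 'X_k ^+ nu) =
      \prod_(k < n | (T k).1 == nu) 'X_k ^+ nu :> P.
    move=> Hs; rewrite wa_prod [RHS](reindex_inj (@perm_inj _ s)).
    apply: eq_big => k; first by rewrite (pstab_comp _ Hs).
    by rewrite waX wa_XU ffunE expr0 scale1r.
  apply: eq_bigr => s Hs; rewrite mulr_suml; apply: eq_bigr => t Ht.
  rewrite -scalerAl /sact !wa_wact -/(pe s) -/(pe t); congr (_ *: _).
  rewrite -[X in _ * X](xI _ t Ht) -wa_mul -[X in _ * X](xI _ s Hs) -wa_mul.
  congr (wa _ (wa _ _)); rewrite -big_split; apply: eq_bigr => k /eqP Ek.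
  by rewrite /= mnmE Ek exprD.
have E1 : lift ord0 ord0 = 1 :> 'I_2 by exact: val_inj.
have big2 (F : 'I_2 -> P) : \prod_(nu < 2) F nu = F 0 * F 1.
  by rewrite big_ord_recl big_ord_recl big_ord0 mulr1 E1.
have ES : specht lam S T = _ := eq_bigr _ (fun nu _ => Y nu).
rewrite ES big2 -scalerAl -scalerAr scalerA; congr (_ *: _).
exact: (esym (symmetrize_split T (spexp S T))).
Qed.

Lemma symmetrize_relabel (T T' : bitab n) (w : 'S_n) e :
  (forall k, T' (w k) = T k) -> symmetrize T' e = wa (pe w) (symmetrize T (e#w)).
Proof.
move=> ET; have ET' k : T' k = T (w^-1 k)%g by rewrite -{1}(permKV w k) ET.
have conj_bij : injective (fun s : 'S_n => (s ^ w)%g) by exact: conjg_inj.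
rewrite /symmetrize wa_sum (reindex_inj conj_bij) /=.
apply: eq_big => t.
  apply/colgrpP/colgrpP => Ht k.
    have := Ht (w k); rewrite !ET' /conjg !permM !permK; by [].
  by rewrite !ET' /conjg !permM permK; exact: Ht.
move=> _; rewrite wa_sum (reindex_inj conj_bij) /=; apply: eq_big => s.
  apply/rowgrpP/rowgrpP => Ht k.
    have := Ht (w k); rewrite !ET' /conjg !permM !permK; by [].
  by rewrite !ET' /conjg !permM permK; exact: Ht.
move=> _; rewrite waZ; congr (_ *: _).
  by rewrite /sgp odd_permJ.
have EX : 'X_[e#w] = wa (pe w^-1%g) 'X_[e] :> P.
  by rewrite wa_Xm gsign_pe scale1r invgK.
by rewrite EX -!waM !peM; congr (wa (pe _) _); rewrite !conjgE !mulgA mulgK.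
Qed.

Lemma annle_pact (b : A) (f h : P) : annle f h -> annle (pact b f) (pact b h).
Proof. by move=> fh a; rewrite -!pact_conv; exact: fh. Qed.

(** Grouping the translates of x^m0 by the monomial they are proportional to
    shows that a relation between them is a sum of relations inside the cosets
    of the stabilizer, which u satisfies. *)
Lemma annle_monomial (m0 : 'X_{1..n}) (u : P) :
  (forall h : W, m0#(h.2) = m0 -> wa h u = gsign R h m0 *: u) -> annle 'X_[m0] u.
Proof.
move=> Hu x x0; pose H := [set h : W | m0#(h.2) == m0].
have xg g : \sum_(h in H) x (g * h)%g * gsign R h m0 = 0.
  pose m1 := m0#((g.2)^-1)%g.
  have := congr1 (mcoeff m1) x0; rewrite pactE raddf_sum mcoeff0 /=.
  rewrite (reindex_inj (mulgI g)) /=.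
  have E h : (x (g * h)%g *: wa (g * h)%g 'X_[m0])@_m1 =
      gsign R g m1 * (if h \in H then x (g * h)%g * gsign R h m0 else 0).
    rewrite mcoeffZ waM mcoeff_wa mcoeff_wa mcoeffX.
    have -> : m1#(g.2) = m0 by apply/mnmP => k; rewrite !mnmE permK.
    rewrite inE eq_sym; case: eqP => _; rewrite ?mulr1 ?mulr0 ?mulr0 //.
    by rewrite mulrCA.
  rewrite (eq_bigr _ (fun h _ => E h)) -mulr_sumr -big_mkcond => /eqP.
  rewrite mulf_eq0 => /orP[/eqP g0|/eqP //].
  by have /eqP := gsign_sqr R g m1; rewrite g0 mul0r eq_sym oner_eq0.
have HN : (#|H|%:R : C) != 0.
  rewrite pnatr_eq0 -lt0n; apply/card_gt0P; exists 1%g; rewrite inE; apply/eqP.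
  by apply/mnmP => k; rewrite mnmE perm1.
apply: (scalerI HN); rewrite scaler0 scaler_nat -sumr_const.
transitivity (\sum_(h in H) \sum_g (x (g * h)%g * gsign R h m0) *: wa g u).
  apply: eq_bigr => h; rewrite inE => /eqP Hh; rewrite pactE (reindex_inj (mulIg h)).
  by apply: eq_bigr => g _; rewrite waM (Hu h Hh) waZ scalerA.
rewrite exchange_big big1 // => g _ /=.
by rewrite -scaler_suml xg scale0r.
Qed.

Let colsum (T : bitab n) : A :=
  \sum_(t : 'S_n) (if t \in colgrp T then sgp R t else 0) *: gdelta R (pe t).

Let pact_colsum (T : bitab n) f :
  pact (colsum T) f = \sum_(t in colgrp T) sgp R t *: wa (pe t) f.
Proof.
rewrite pact_suml [RHS]big_mkcond; apply: eq_bigr => t _.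
by rewrite pactZl pact_delta; case: ifP; rewrite ?scale0r.
Qed.

(** Both sides are the column antisymmetrization of a polynomial: x^(tmon T) for
    the left one, and the row symmetrization of x^e for the right one.  The
    stabilizer of x^(tmon T) is the row group with the sign changes, which acts
    on the row symmetrization by the same character. *)
Lemma annle_symmetrize (T : bitab n) (e : 'X_{1..n}) : (forall k, odd (e k) = odd (T k).1) ->
  annle (DT R T) (symmetrize T e).
Proof.
move=> epar; rewrite /DT -pact_colsum.
have -> : symmetrize T e = pact (colsum T) (\sum_(s in rowgrp T) wa (pe s) 'X_[e]).
  by rewrite pact_colsum; apply: eq_bigr => t _; rewrite wa_sum scaler_sumr.
apply: annle_pact; apply: annle_monomial => h /mnmP Eh.
have Rh : h.2 \in rowgrp T.
  by apply/rowgrpP => k; apply: tmon_eqE; have := Eh k; rewrite [in LHS]mnmE.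
set u := \sum_(s in _) _.
have uE m : u@_m = \sum_(s in rowgrp T) (e == m#s)%:R.
  by rewrite raddf_sum; apply: eq_bigr => s _; rewrite /= mcoeff_pe mcoeffX.
apply/mpolyP => m; rewrite mcoeff_wa mcoeffZ.
have -> : u@_(m#(h.2)) = u@_m.
  rewrite !uE [RHS](reindex_inj (mulIg h.2)) /=.
  apply: eq_big => s; first by rewrite rowgrp_mulr.
  by rewrite mpermM.
have [->|um] := eqVneq (u@_m) 0; first by rewrite !mulr0.
congr (_ * _); rewrite (@gsign_parity _ _ T _ (tmon T)); last exact: tmon_parity.
apply: gsign_parity => k.
have [s Rs /eqP E] : exists2 s : 'S_n, s \in rowgrp T & e == m#s.
  apply/exists_inP; apply: contraNT um => /exists_inPn H; apply/eqP.
  by rewrite uE big1 // => s /H /negPf ->.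
have := epar (s^-1 k)%g; rewrite E mnmE permKV => ->.
by have /rowgrpP /(_ k)[->] := rowgrpV Rs.
Qed.

Lemma symmetrize_tmon (T : bitab n) :
  symmetrize T (tmon T) = #|rowgrp T|%:R *: DT R T.
Proof.
rewrite /symmetrize /DT scaler_sumr; apply: eq_bigr => t _.
rewrite -scaler_sumr scalerA mulrC -scalerA; congr (_ *: _).
rewrite (eq_bigr (fun=> wa (pe t) 'X_[tmon T])) => [|s Rs].
  by rewrite sumr_const scaler_nat.
rewrite wa_Xm gsign_pe scale1r; congr (wa _ 'X_[_]); apply/mnmP => k.
by have /rowgrpP /(_ k) := rowgrpV Rs; rewrite !mnmE /= => -[-> ->].
Qed.

(** The coefficient of x^e is a positive number of row permutations: if a column
    permutation t other than 1 contributed, compare the sums of the exponents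
    over the first row that t moves, from which it only moves down to larger
    exponents. *)
Lemma symmetrize_neq0 (lam : bipart n) (T : bitab n) (e : 'X_{1..n}) : is_tableau lam T ->
  (forall k l, samecol T k l -> ((T k).2.1 < (T l).2.1)%N -> (e k < e l)%N) ->
  symmetrize T e != 0.
Proof.
move=> tabT estr.
have t1 (t s : 'S_n) : t \in colgrp T -> s \in rowgrp T -> e == (e#t)#s -> t = 1%g.
  move=> Ct Rs /eqP/mnmP E; apply/eqP; apply: contraT => tn1.
  have [k0 tk0] : exists k, t k != k.
    apply/existsP; rewrite -negb_forall; apply: contra tn1 => /forallP H.
    by apply/eqP/permP => k; rewrite perm1; apply/eqP.
  have [k tk kmin] := @arg_minnP _ k0 (fun k => t k != k) (fun k => val (T k).2.1) tk0.
  (* the first row moved by t; both components together *)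
  pose L := [pred j | (T j).2.1 == (T k).2.1].
  have tE j := colgrpP T t Ct j.
  have lt_e j : L j -> t j != j -> (e j < e (t j))%N.
    move=> /eqP Lj tj; apply: estr.
      by have [e1 e2] := tE j; rewrite /samecol e1 e2 !eqxx.
    rewrite Lj ltn_neqAle; apply/andP; split.
      apply: contra tj => /eqP/val_inj e3; have [e1 e2] := tE j.
      by apply/eqP; apply: (tab_pos_inj tabT) => //; rewrite -e3 -Lj.
    by apply: kmin; rewrite (inj_eq perm_inj).
  have le_e j : L j -> (e j <= e (t j))%N.
    by move=> Lj; have [->//|/(lt_e j Lj)/ltnW] := eqVneq (t j) j.
  have [_] := leqif_sum (fun j Lj => leqif_eq (le_e j Lj)).
  have -> : (\sum_(j | L j) e j == \sum_(j | L j) e (t j))%N.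
    apply/eqP; rewrite [RHS](reindex_inj (@perm_inj _ s)) /=.
    apply: eq_big => j; first by rewrite /L /=; have /rowgrpP /(_ j)[_ ->] := Rs.
    by move=> _; rewrite {1}E !mnmE.
  move/esym/forall_inP => /(_ k); rewrite inE eqxx => /(_ isT).
  by rewrite ltn_eqF // lt_e //=.
apply/negP => /eqP E0; have := congr1 (mcoeff e) E0.
pose F t : P := \sum_(s in rowgrp T) sgp R t *: wa (pe t) (wa (pe s) 'X_[e]).
have FE t : (F t)@_e = \sum_(s in rowgrp T) sgp R t * (e == (e#t)#s)%:R.
  rewrite raddf_sum; apply: eq_bigr => s _.
  by rewrite /= mcoeffZ mcoeff_pe mcoeff_pe mcoeffX.
have -> : (symmetrize T e)@_e = (F 1%g)@_e.
  have -> : symmetrize T e = F 1%g + \sum_(t in colgrp T | t != 1%g) F t.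
    by rewrite /symmetrize (bigD1 1%g) ?colgrp1.
  rewrite mcoeffD [X in _ + X]raddf_sum [X in _ + X]big1 ?addr0 // => t /andP[Ct tn1].
  rewrite /= FE big1 // => s Rs; case: eqP => [/eqP/(t1 t s Ct Rs) E|_]; last by rewrite mulr0.
  by rewrite E eqxx in tn1.
rewrite FE mcoeff0 (eq_bigr (fun s : 'S_n => (e == e#s)%:R)) => [|s _]; last first.
  rewrite /sgp odd_perm1 mul1r; congr (_ == _)%:R.
  by apply/mnmP => k; rewrite !mnmE perm1.
move/eqP; rewrite -natr_sum pnatr_eq0 sum_nat_eq0 => /forall_inP /(_ 1%g (rowgrp1 T)).
suff -> : e == e#(1%g : 'S_n) by [].
by apply/eqP/mnmP => k; rewrite mnmE perm1.
Qed.

End SpechtFormula.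

(** * The index of a standard tableau *)

Section IndexLemmas.

Lemma pmap_index (X Y : eqType) (f : X -> option Y) (s : seq X) x y a b :
  f x = Some a -> f y = Some b -> (forall z, f z = Some a -> z = x) ->
  (forall z, f z = Some b -> z = y) ->
  (index a (pmap f s) < index b (pmap f s))%N = (index x s < index y s)%N.
Proof.
move=> fx fy ax bx; elim: s => //= z s IH.
case fz: (f z) => [c|] /=.
  have -> : (c == a) = (z == x).
    by apply/eqP/eqP => [E|E]; [apply: ax; rewrite fz E | move: fz; rewrite E fx => -[]].
  have -> : (c == b) = (z == y).
    by apply/eqP/eqP => [E|E]; [apply: bx; rewrite fz E | move: fz; rewrite E fy => -[]].
  by case: (z == x); case: (z == y).
have -> : (z == x) = false by apply/eqP => E; rewrite E fx in fz.
have -> : (z == y) = false by apply/eqP => E; rewrite E fy in fz.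
by rewrite ltnS IH.
Qed.

Lemma index_allpairs (X Y Z : eqType) (h : X -> Y -> Z) (s : seq X) (t : seq Y) x y :
  (forall x1 x2 y1 y2, h x1 y1 = h x2 y2 -> x1 = x2 /\ y1 = y2) -> x \in s -> y \in t ->
  index (h x y) [seq h x' y' | x' <- s, y' <- t] = (index x s * size t + index y t)%N.
Proof.
move=> hinj xs yt; elim: s xs => //= z s IH.
have hz : injective (h z) by move=> y1 y2 /hinj[].
rewrite inE index_cat => xs; have [E|zx] := eqVneq z x.
  by rewrite -E map_f // (index_map hz) mul0n.
have -> : (h x y \in [seq h z y' | y' <- t]) = false.
  by apply/mapP => -[y' _ /hinj[E _]]; rewrite E eqxx in zx.
move: xs; rewrite eq_sym (negPf zx) /= => /IH ->.
by rewrite size_map mulSn addnA.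
Qed.

Lemma index_rev_enum n (r : 'I_n) : index r (rev (enum 'I_n)) = (n.-1 - r)%N.
Proof.
have rn := ltn_ord r.
have Er : nth r (rev (enum 'I_n)) (n.-1 - r) = r.
  rewrite nth_rev size_enum_ord; last by lia.
  have -> : (n - (n.-1 - r).+1 = r)%N by lia.
  by rewrite nth_ord_enum.
by rewrite -{1}Er index_uniq ?rev_uniq ?enum_uniq // size_rev size_enum_ord; lia.
Qed.

End IndexLemmas.

Section Words.
Variable n : nat.
Notation pos := ('I_2 * ('I_n * 'I_n))%type.

Definition wordpos : seq pos :=
  [seq (p.1, (r, p.2)) | p <- [seq (nu, c) | nu <- enum 'I_2, c <- enum 'I_n],
                         r <- rev (enum 'I_n)].

Lemma index_wordpos (p : pos) :
  index p wordpos = ((p.1 * n + p.2.2) * n + (n.-1 - p.2.1))%N.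
Proof.
case: p => nu [r c] /=.
rewrite (index_allpairs (h := fun (p : 'I_2 * 'I_n) (r : 'I_n) => (p.1, (r, p.2))) (x := (nu, c))).
- rewrite (index_allpairs (h := fun (nu : 'I_2) (c : 'I_n) => (nu, c))) ?mem_enum //.
    by rewrite !index_enum_ord size_rev !size_enum_ord index_rev_enum.
  by move=> ? ? ? ? [-> ->].
- by move=> [? ?] [? ?] ? ? /= [-> -> ->].
- by apply/allpairsP; exists (nu, c); rewrite !mem_enum.
by rewrite mem_rev mem_enum.
Qed.

Lemma word_index (T : bitab n) k l : injective T ->
  (index (val k) (word T) < index (val l) (word T))%N =
  (index (T k) wordpos < index (T l) wordpos)%N.
Proof.
move=> Tinj; have fT j : omap val [pick i | T i == T j] = Some (val j).
  case: pickP => [i /eqP/Tinj -> //|/(_ j)]; by rewrite eqxx.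
have gT j z : omap val [pick i | T i == z] = Some (val j) -> z = T j.
  by case: pickP => //= i /eqP <- [/val_inj ->].
exact: (@pmap_index _ _ (fun c => omap val [pick i | T i == c]) wordpos (T k) (T l) _ _
          (fT k) (fT l) (gT k) (gT l)).
Qed.

Lemma tindex_mono (T : bitab n) a b : (a <= b)%N -> (tindex T a <= tindex T b)%N.
Proof.
move/subnK <-; elim: (b - a)%N => // m IH; rewrite addSn /=.
exact: leq_trans IH (leq_addr _ _).
Qed.

(** Somewhere between a and b an entry must stand to the left of its
    predecessor. *)
Lemma tindex_descent (T : bitab n) a b : (a < b)%N ->
  (index b (word T) < index a (word T))%N -> (tindex T a < tindex T b)%N.
Proof.
elim: b => // b IH; rewrite ltnS => ab /= lt_ba.
case: (leqP (index a (word T)) (index b (word T))) => lt_ab.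
  by rewrite (leq_trans lt_ba lt_ab) addn1 ltnS tindex_mono.
have ltab : (a < b)%N.
  by rewrite ltn_neqAle ab andbT; apply: contraTneq lt_ab => ->; rewrite ltnn.
exact: leq_trans (IH ltab lt_ab) (leq_addr _ _).
Qed.

Lemma cell_index_entry (S : bitab n) k : injective S -> cell_index S (S k) = tindex S k.
Proof.
move=> Sinj; rewrite /cell_index; case: pickP => [i /eqP/Sinj -> //|/(_ k)].
by rewrite eqxx.
Qed.

Lemma wordpos_lower (p q : pos) : p.1 = q.1 -> p.2.2 = q.2.2 -> (p.2.1 < q.2.1)%N ->
  (index q wordpos < index p wordpos)%N.
Proof.
move=> e1 e2 lt; rewrite !index_wordpos e1 e2 ltn_add2l.
by have := ltn_ord q.2.1; lia.
Qed.

Lemma wordpos_lex (p q : pos) : (p.1 * n + p.2.2 < q.1 * n + q.2.2)%N ->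
  (index p wordpos < index q wordpos)%N.
Proof.
move=> lt; rewrite !index_wordpos.
have /(leq_trans _) := leq_addr (n.-1 - q.2.1) ((q.1 * n + q.2.2) * n); apply.
apply: (@leq_trans ((p.1 * n + p.2.2).+1 * n)%N); last by rewrite leq_mul2r lt orbT.
rewrite mulSn addnC ltn_add2r; have := ltn_ord p.2.1; lia.
Qed.

(** Columns are read from bottom to top, so the entry of a lower cell stands to
    the left of that of a higher one. *)
Lemma spexp_column (lam : bipart n) (S T : bitab n) k l : S \in STab lam ->
  is_tableau lam T -> samecol T k l -> ((T k).2.1 < (T l).2.1)%N ->
  (spexp S T k < spexp S T l)%N.
Proof.
rewrite inE => /andP[tabS stdS] tabT /andP[/eqP e1 /eqP e2] lt_kl.
have [i Ei] : exists i, S i = T k.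
  by rewrite [T k]surjective_pairing; apply: (tab_entry tabS); exact: tab_mem.
have [j Ej] : exists j, S j = T l.
  by rewrite [T l]surjective_pairing; apply: (tab_entry tabS); exact: tab_mem.
have Sinj := tab_inj tabS.
rewrite !mnmE e1 ltn_add2r ltn_mul2l /= -Ei -Ej !cell_index_entry //.
apply: tindex_descent; first by apply: (std_lt stdS); rewrite ?Ei ?Ej.
by rewrite word_index //; apply: wordpos_lower; rewrite ?Ei ?Ej.
Qed.

End Words.

Section RowReading.
Variables (n : nat) (lam : bipart n).
Notation pos := ('I_2 * ('I_n * 'I_n))%type.

(** Positions row by row, in each row the first component and then the second. *)
Definition rowpos : seq pos :=
  [seq (x.2, (x.1, c)) | x <- [seq (r, nu) | r <- enum 'I_n, nu <- enum 'I_2],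
                         c <- enum 'I_n].

Lemma index_rowpos (p : pos) :
  index p rowpos = ((p.2.1 * 2 + p.1) * n + p.2.2)%N.
Proof.
case: p => nu [r c] /=.
rewrite (index_allpairs (h := fun (x : 'I_n * 'I_2) (c : 'I_n) => (x.2, (x.1, c))) (x := (r, nu))).
- rewrite (index_allpairs (h := fun (r : 'I_n) (nu : 'I_2) => (r, nu))) ?mem_enum //.
    by rewrite !index_enum_ord !size_enum_ord.
  by move=> ? ? ? ? [-> ->].
- by move=> [? ?] [? ?] ? ? /= [-> -> ->].
- by apply/allpairsP; exists (r, nu); rewrite !mem_enum.
by rewrite mem_enum.
Qed.

Definition incell (p : pos) := p.2 \in sval lam p.1.
Definition rowcells : seq pos := pmap (fun p => if incell p then Some p else None) rowpos.

Lemma rowcells_index p q : incell p -> incell q ->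
  (index p rowcells < index q rowcells)%N = (index p rowpos < index q rowpos)%N.
Proof.
move=> ip iq; apply: pmap_index; rewrite ?ip ?iq // => z.
  by case: ifP => // _ [].
by case: ifP => // _ [].
Qed.

Lemma mem_rowpos p : p \in rowpos.
Proof.
case: p => nu [r c]; apply/allpairsP; exists ((r, nu), c); split; rewrite ?mem_enum //.
by apply/allpairsP; exists (r, nu); rewrite !mem_enum.
Qed.

Lemma rowpos_uniq : uniq rowpos.
Proof.
apply: allpairs_uniq; rewrite ?enum_uniq //; last by move=> [[? ?] ?] [[? ?] ?] _ _ /= [-> -> ->].
by apply: allpairs_uniq; rewrite ?enum_uniq // => -[? ?] [? ?] _ _ /= [-> ->].
Qed.

Lemma rowcellsE : rowcells = [seq p <- rowpos | incell p].
Proof. by rewrite /rowcells; elim: rowpos => //= p s ->; case: ifP. Qed.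

Lemma mem_rowcells p : (p \in rowcells) = incell p.
Proof. by rewrite rowcellsE mem_filter mem_rowpos andbT. Qed.

Lemma rowcells_uniq : uniq rowcells.
Proof. by rewrite rowcellsE filter_uniq // rowpos_uniq. Qed.

Lemma size_rowcells : size rowcells = n.
Proof.
have /andP[_ /eqP En] := svalP lam; apply: etrans En.
rewrite -(card_uniqP rowcells_uniq).
transitivity (\sum_(p : pos | incell p) 1)%N.
  by rewrite sum1_card; apply: eq_card => p; rewrite mem_rowcells.
rewrite -(pair_big_dep xpredT (fun nu c => c \in sval lam nu) (fun _ _ => 1%N)) /=.
by apply: eq_bigr => nu _; rewrite sum1_card.
Qed.

(** The tableau whose entries increase along [rowpos].  The default value of nth
    is never used, as there are n cells. *)
Definition rowtab : bitab n := [ffun k : 'I_n => nth (0, (k, k)) rowcells k].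

Lemma rowtab_index k : index (rowtab k) rowcells = k.
Proof. by rewrite ffunE index_uniq ?rowcells_uniq // size_rowcells. Qed.

Lemma rowtab_cell k : incell (rowtab k).
Proof. by rewrite -mem_rowcells ffunE mem_nth // size_rowcells. Qed.

Lemma rowtab_inj : injective rowtab.
Proof. by move=> k l E; apply: val_inj; rewrite /= -(rowtab_index k) E rowtab_index. Qed.

Lemma rowtab_lt (k l : 'I_n) : (k < l)%N = (index (rowtab k) rowpos < index (rowtab l) rowpos)%N.
Proof. by rewrite -rowcells_index ?rowtab_cell // !rowtab_index. Qed.

Lemma rowtab_entry p : incell p -> exists k, rowtab k = p.
Proof.
move=> ip; have lt : (index p rowcells < n)%N.
  by apply: leq_trans (_ : size rowcells <= n)%N; rewrite ?index_mem ?mem_rowcells ?size_rowcells.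
by exists (Ordinal lt); rewrite ffunE nth_index // mem_rowcells.
Qed.

Lemma index_rowpos_row (p q : pos) : (p.2.1 < q.2.1)%N ->
  (index p rowpos < index q rowpos)%N.
Proof.
move=> lt; rewrite !index_rowpos.
have [a1 a2] : (p.1 < 2)%N /\ (p.2.2 < n)%N by [].
have : ((p.2.1 * 2 + p.1).+1 * n <= (q.2.1 * 2 + q.1) * n)%N by rewrite leq_mul2r; lia.
rewrite mulSn; lia.
Qed.

Lemma rowtab_STab : rowtab \in STab lam.
Proof.
rewrite inE; apply/andP; split.
  apply/andP; split; first by apply/injectiveP; exact: rowtab_inj.
  apply/forallP => nu; apply/forallP => c; apply/eqP; apply/idP/existsP => [cl|[k /eqP E]].
    by have [k E] := @rowtab_entry (nu, c) cl; exists k; apply/eqP.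
  by have := rowtab_cell k; rewrite E.
apply/forallP => k; apply/forallP => l; apply/implyP => /andP[/eqP e1 H].
rewrite rowtab_lt.
case/orP: H => /andP[/eqP e2 lt]; last exact: index_rowpos_row.
by rewrite !index_rowpos e1 e2 ltn_add2l.
Qed.

(** Consecutive entries lie in the same row, where the later one is read later,
    or in consecutive rows.  In the second case the later one starts a row, and
    its column is not read after that of the last cell of the row above, because
    the cell above it lies in that row; so it is read earlier. *)
Lemma rowtab_tindex k : tindex rowtab (val k) = (rowtab k).2.1.
Proof.
have clos nu (c d : 'I_n * 'I_n) := @young_closed n lam nu c d.
have [m] := ubnP (val k); elim: m k => // m IH k km.
case: k km => -[|j] hk km.
  set p := rowtab _; case E: (val p.2.1) => [|r] //.
  have n0 := ltn_ord p.2.1.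
  have ir : incell (p.1, (Ordinal hk, p.2.2)).
    apply: (clos _ _ _ (rowtab_cell (Ordinal hk))) => //=.
  have := rowcells_index ir (rowtab_cell (Ordinal hk)).
  rewrite rowtab_index ltn0 index_rowpos_row //=; by rewrite -/p E.
have hj : (j < n)%N by exact: ltn_trans (ltnSn j) hk.
rewrite [tindex _ _]/= (IH (Ordinal hj)) //.
set p := rowtab (Ordinal hj); set p' := rowtab (Ordinal hk).
have ip : incell p := rowtab_cell _; have ip' : incell p' := rowtab_cell _.
have lt_pp' : (index p rowpos < index p' rowpos)%N by rewrite -rowtab_lt /=.
have nobetween q : incell q -> (index p rowpos < index q rowpos)%N ->
    (index q rowpos < index p' rowpos)%N -> False.
  move=> iq; rewrite -!rowcells_index // !rowtab_index /=; lia.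
rewrite (word_index (Ordinal hk) (Ordinal hj) rowtab_inj) -/p -/p'.
case: (ltngtP p.2.1 p'.2.1) => [lt_r|lt_r|E]; last 2 first.
- by have := ltn_trans (index_rowpos_row lt_r) lt_pp'; rewrite ltnn.
- have lt_w : (index p (wordpos n) < index p' (wordpos n))%N.
    apply: wordpos_lex; move: lt_pp'; rewrite !index_rowpos E !mulnDl; lia.
  by rewrite -E ltnNge (ltnW lt_w) addn0.
have Er : val p'.2.1 = p.2.1.+1.
  apply/eqP; rewrite eqn_leq lt_r andbT leqNgt; apply/negP => lt2.
  have rn : (p.2.1.+1 < n)%N by exact: ltn_trans lt2 (ltn_ord p'.2.1).
  apply: (nobetween (p'.1, (Ordinal rn, p'.2.2))).
  - by apply: (clos _ _ _ ip') => //=; exact: ltnW.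
  - by apply: index_rowpos_row => /=.
  by apply: index_rowpos_row => /=.
(* the cell above the later one is not after p in the row reading order *)
have iq : incell (p'.1, (p.2.1, p'.2.2)) by apply: (clos _ _ _ ip') => //=; exact: ltnW.
have le_q : (index (p'.1, (p.2.1, p'.2.2)) rowpos <= index p rowpos)%N.
  rewrite leqNgt; apply/negP => lt_q; apply: nobetween iq lt_q _.
  by apply: index_rowpos_row.
have -> : (index p' (wordpos n) < index p (wordpos n))%N = true; last by rewrite addn1 Er.
have le' : (p'.1 * n + p'.2.2 <= p.1 * n + p.2.2)%N.
  move: le_q; rewrite !index_rowpos /= !mulnDl; lia.
move: le'; rewrite leq_eqVlt => /orP[/eqP Eq|]; last exact: wordpos_lex.
have [E1 E2] : p'.1 = p.1 /\ p'.2.2 = p.2.2.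
  have c1 := ltn_ord p.2.2; have c2 := ltn_ord p'.2.2.
  have := congr1 (fun x => x %/ n)%N Eq; have := congr1 (fun x => x %% n)%N Eq.
  rewrite !modnMDl !modn_small // !divnMDl ?(leq_ltn_trans _ c1) // !divn_small // !addn0.
  by move=> ? ?; split; exact: val_inj.
by apply: wordpos_lower; rewrite ?E1 ?E2 ?Er.
Qed.

End RowReading.

Section RowReadingExponents.
Variables (n : nat) (lam : bipart n) (T : bitab n).
Hypothesis tabT : is_tableau lam T.

Lemma spexp_rowtab : spexp (rowtab lam) T = tmon T.
Proof.
apply/mnmP => k; rewrite !mnmE; congr (2 * _ + _)%N.
have [i Ei] := @rowtab_entry n lam (T k) (tab_mem tabT k).
by rewrite -Ei cell_index_entry ?rowtab_tindex //; exact: rowtab_inj.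
Qed.

End RowReadingExponents.

(** * Counting standard tableaux *)

Section Counting.
Variable n : nat.
Notation pos := ('I_2 * ('I_n * 'I_n))%type.
Local Open Scope nat_scope.

Definition lepos (p q : pos) := [&& p.1 == q.1, p.2.1 <= q.2.1 & p.2.2 <= q.2.2].

Lemma leposP (p q : pos) : reflect [/\ p.1 = q.1, p.2.1 <= q.2.1 & p.2.2 <= q.2.2] (lepos p q).
Proof. by apply: (iffP and3P) => -[/eqP ? ? ?]; split. Qed.

(** The cells of a bipartition form an order ideal of positions. *)
Definition ideal (D : {set pos}) := [forall p, forall q, lepos q p && (p \in D) ==> (q \in D)].

Lemma idealP (D : {set pos}) : reflect (forall p q, lepos q p -> p \in D -> q \in D) (ideal D).
Proof.
apply: (iffP idP) => [/forallP H p q qp pD|H].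
  by have /forallP/(_ q)/implyP := H p; apply; rewrite qp.
by apply/forallP => p; apply/forallP => q; apply/implyP => /andP[]; apply: H.
Qed.

Definition addable (D : {set pos}) p :=
  (p \notin D) && [forall q, lepos q p && (q != p) ==> (q \in D)].
Definition removable (D : {set pos}) p :=
  (p \in D) && [forall q, lepos p q && (q \in D) ==> (q == p)].

Lemma addableP (D : {set pos}) p :
  reflect (p \notin D /\ forall q, lepos q p -> q != p -> q \in D) (addable D p).
Proof.
apply: (iffP andP) => -[pD H]; split=> //.
  by move=> q qp nqp; have /implyP := forallP H q; apply; rewrite qp.
by apply/forallP => q; apply/implyP => /andP[]; apply: H.
Qed.

Lemma removableP (D : {set pos}) p :
  reflect (p \in D /\ forall q, lepos p q -> q \in D -> q = p) (removable D p).
Proof.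
apply: (iffP andP) => -[pD H]; split=> //.
  by move=> q pq qD; have /implyP := forallP H q; rewrite pq qD => /(_ isT)/eqP.
by apply/forallP => q; apply/implyP => /andP[pq qD]; apply/eqP; exact: H.
Qed.

Lemma ideal_add D p : ideal D -> addable D p -> ideal (p |: D).
Proof.
move=> /idealP iD /addableP[_ H]; apply/idealP => q r rq; rewrite !in_setU1.
have [//|nrp] := eqVneq r p; case/orP => [/eqP E|qD]; first by apply: H; first by rewrite -E.
exact: iD qD.
Qed.

Lemma ideal_rem D p : ideal D -> removable D p -> ideal (D :\ p).
Proof.
move=> /idealP iD /removableP[pD H]; apply/idealP => q r rq; rewrite !in_setD1.
case/andP => nqp qD; rewrite (iD _ _ rq qD) andbT; apply: contraNneq nqp => E.
by apply/eqP; apply: H; first by rewrite -E.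
Qed.

Lemma add_rem D p : ideal D -> addable D p -> removable (p |: D) p.
Proof.
move=> /idealP iD /addableP[pD _]; apply/removableP; split; first exact: setU11.
move=> q pq; rewrite in_setU1 => /orP[/eqP //|qD]; by rewrite (iD _ _ pq qD) in pD.
Qed.

Lemma rem_add D p : ideal D -> removable D p -> addable (D :\ p) p.
Proof.
move=> /idealP iD /removableP[pD _]; apply/addableP; split; first by rewrite setD11.
by move=> q qp nqp; rewrite in_setD1 nqp; exact: iD pD.
Qed.

Lemma add_rem_commute D p q : ideal D -> p != q ->
  addable D p && removable (p |: D) q = removable D q && addable (D :\ q) p.
Proof.
move=> /idealP iD npq; apply/andP/andP.
  case=> /addableP[pD Hp] /removableP[qD Hq].
  have {}qD : q \in D by move: qD; rewrite in_setU1 eq_sym (negPf npq).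
  split; [apply/removableP | apply/addableP]; split=> //.
  - by move=> r qr rD; apply: Hq; rewrite // in_setU1 rD orbT.
  - by rewrite in_setD1 (negPf pD) andbF.
  move=> r rp nrp; rewrite in_setD1 (Hp _ rp nrp) andbT; apply: contraNneq npq => E.
  by apply/eqP; apply: Hq; [rewrite -E|exact: setU11].
case=> /removableP[qD Hq] /addableP[pD Hp].
have {}pD : p \notin D by move: pD; rewrite in_setD1 npq.
split; [apply/addableP | apply/removableP]; split=> //.
- by move=> r rp nrp; have := Hp _ rp nrp; rewrite in_setD1 => /andP[].
- by rewrite in_setU1 qD orbT.
move=> r qr; rewrite in_setU1 => /orP[/eqP E|]; last exact: Hq.
have := Hp q; rewrite -E qr => /(_ isT); rewrite setD11 => H.
by case: (eqVneq q r) H => // _ /(_ isT).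
Qed.

(** Lists are built by consing the largest element, so this is a linear
    extension read backwards. *)
Fixpoint linext (s : seq pos) : bool :=
  if s is q :: s' then
    [&& q \notin s', [forall p, lepos p q && (p != q) ==> (p \in s')] & linext s']
  else true.

Lemma linext_ideal s : linext s -> forall p q, lepos q p -> p \in s -> q \in s.
Proof.
elim: s => //= r s IH /and3P[rs /forallP H ls] p q qp; rewrite !inE.
have [//|nqr] := eqVneq q r; case/orP => [/eqP E|ps]; last exact: IH qp ps.
by have /implyP := H q; apply; rewrite -E qp E.
Qed.

Definition nlinext k (D : {set pos}) : nat :=
  #|[set t : k.-tuple pos | linext t && ([set x in t] == D)]|.

Lemma nlinext0 : nlinext 0 set0 = 1.
Proof.
apply: etrans (cards1 ([tuple] : 0.-tuple pos)); apply: eq_card => t.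
transitivity true; last by apply/esym/set1P; rewrite (tuple0 t); exact: val_inj.
by rewrite inE (tuple0 t) /=; apply/eqP/setP => x; rewrite !inE.
Qed.

Lemma linext_cons D q (s : seq pos) : ideal D ->
  linext (q :: s) && ([set x in q :: s] == D) =
  removable D q && (linext s && ([set x in s] == D :\ q)).
Proof.
move=> /idealP iD; apply/andP/andP.
  case=> /= /and3P[qs /forallP H ls] /eqP E.
  have Ds : [set x in s] == D :\ q.
    apply/eqP/setP => x; rewrite -E !inE; case: eqVneq => //= ->; exact/negbTE.
  rewrite ls Ds; split=> //; apply/removableP; split; first by rewrite -E !inE eqxx.
  move=> p qp; rewrite -E !inE => /orP[/eqP //|ps].
  by have := linext_ideal ls qp ps; rewrite (negPf qs).
case=> /removableP[qD Hq] /andP[ls /eqP E].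
have Es x : (x \in s) = (x != q) && (x \in D) by have /setP/(_ x) := E; rewrite !inE.
split; last first.
  by apply/eqP/setP => x; rewrite !inE Es; case: eqVneq => //= ->.
apply/and3P; split=> //; first by rewrite Es eqxx.
by apply/forallP => p; apply/implyP => /andP[pq npq]; rewrite Es npq; exact: iD qD.
Qed.

Lemma nlinextS k D : ideal D ->
  nlinext k.+1 D = \sum_(q | removable D q) nlinext k (D :\ q).
Proof.
move=> iD; rewrite /nlinext -sum1_card.
under [RHS]eq_bigr do rewrite -sum1_card.
rewrite (pair_big_dep _ _ (fun _ _ => 1%N)) /=.
rewrite (reindex (fun u : pos * k.-tuple pos => [tuple of u.1 :: u.2])) /=.
  by apply: eq_bigl => -[q t]; rewrite !inE; exact: linext_cons.
exists (fun t : k.+1.-tuple pos => (thead t, [tuple of behead t])) => [[q t]|t] _ /=.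
  by congr (_, _); exact: val_inj.
by rewrite -tuple_eta.
Qed.

Section Corners.
Variables (D : {set pos}) (nu : 'I_2).
Hypothesis iD : ideal D.
Hypothesis Dn : #|D| < n.

Definition rowlen (r : nat) : nat := \sum_(p in D | (p.1 == nu) && (p.2.1 == r :> nat)) 1.

Lemma mem_rowlen (r c : 'I_n) : ((nu, (r, c)) \in D) = (c < rowlen r).
Proof.
have -> : ((nu, (r, c)) \in D) = (c < #|[set c' | (nu, (r, c')) \in D]|).
  rewrite -downclosed_mem ?inE // => j k jk; rewrite !inE; apply: (idealP D iD).
  by apply/leposP; split.
congr (_ < _); rewrite /rowlen sum1_card -(card_imset _ (f := fun c' => (nu, (r, c')))); last first.
  by move=> ? ? [].
apply: eq_card => -[nu' [r' c']]; apply/imsetP/idP => [[x]|].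
  by rewrite inE => xD [-> -> ->]; rewrite unfold_in /= !eqxx !andbT.
rewrite unfold_in /= => /and3P[H /eqP E1 /eqP/val_inj E2].
by exists c'; rewrite ?inE -E1 -E2.
Qed.

Lemma rowlen_lt r : rowlen r < n.
Proof.
apply: leq_ltn_trans Dn; rewrite /rowlen -sum1_card.
by rewrite [leqRHS](bigID (fun p : pos => (p.1 == nu) && (p.2.1 == r :> nat))) /= leq_addr.
Qed.

Lemma rowlen_out r : n <= r -> rowlen r = 0.
Proof.
move=> nr; rewrite /rowlen big1 // => p /andP[_ /andP[_ /eqP E]].
by have := ltn_ord p.2.1; rewrite E ltnNge nr.
Qed.

Lemma rowlenS r : rowlen r.+1 <= rowlen r.
Proof.
have [nr|rn] := leqP n r.+1; first by rewrite rowlen_out.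
have rn' := ltn_trans (ltnSn r) rn.
case E: (rowlen r.+1) => [|c] //.
have cn : c < n by rewrite -ltnS -E ltnW // ltnS rowlen_lt.
have := mem_rowlen (Ordinal rn) (Ordinal cn); rewrite /= E leqnn => H.
rewrite -(mem_rowlen (Ordinal rn') (Ordinal cn)).
by apply: (idealP D iD) H; apply/leposP; split=> //=.
Qed.

(** The last row of the square is empty, as it would need n cells. *)
Lemma rowlen_last : rowlen n.-1 = 0.
Proof.
case n0 : n => [|m]; first by rewrite rowlen_out // n0.
have nm : m < n by rewrite n0.
apply/eqP; rewrite -leqn0 leqNgt; apply/negP => pos_last.
have o0 : 0 < n by rewrite n0.
have H (r : 'I_n) : (nu, (r, Ordinal o0)) \in D.
  apply: (idealP D iD (nu, (Ordinal nm, Ordinal o0))); last by rewrite mem_rowlen.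
  by apply/leposP; split=> //=; have := ltn_ord r; lia.
have : #|[set (nu, (r, Ordinal o0)) | r : 'I_n]| <= #|D|.
  by apply: subset_leq_card; apply/subsetP => _ /imsetP[r _ ->].
rewrite card_imset; last by move=> ? ? [].
by rewrite card_ord leqNgt Dn.
Qed.

Lemma addable_row (r c : 'I_n) : addable D (nu, (r, c)) =
  (c == rowlen r :> nat) && ((r == 0 :> nat) || (rowlen r < rowlen r.-1)).
Proof.
have pn : r.-1 < n by have := ltn_ord r; lia.
apply/addableP/andP => [[pD H]|[/eqP Ec Hr]].
  have le1 : rowlen r <= c by rewrite leqNgt -mem_rowlen.
  have Ec : c = rowlen r :> nat.
    apply/eqP; rewrite eqn_leq le1 andbT; case Ev: (val c) => [|c'] //.
    have E : c = c'.+1 :> nat := Ev.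
    have c'n : c' < n by apply: ltn_trans (ltn_ord c); rewrite E.
    rewrite -(mem_rowlen r (Ordinal c'n)); apply: H; first by apply/leposP; split=> //=; lia.
    by apply/eqP => -[/(congr1 val)/=]; lia.
  split; first exact/eqP.
  case rv: (val r) => [|r'] //=; have r0 : r = r'.+1 :> nat := rv.
  rewrite -rv -Ec.
  have r'n : r' < n by apply: ltn_trans (ltn_ord r); rewrite r0.
  rewrite -(mem_rowlen (Ordinal r'n) c); apply: H; first by apply/leposP; split=> //=; lia.
  by apply/eqP => -[/(congr1 val)/=]; lia.
split=> [|[nu' [r' c']] /leposP/= [-> a b] neq]; first by rewrite mem_rowlen Ec ltnn.
move: (leq_eqVlt r' r); rewrite a => /esym/orP[/eqP/val_inj Er|lt_r].
  rewrite Er mem_rowlen -Ec ltn_neqAle b andbT; apply: contraNneq neq => /val_inj ->.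
  by rewrite Er.
have {}Hr : rowlen r < rowlen r.-1 by case/orP: Hr => // /eqP r0; rewrite r0 in lt_r.
apply: (idealP D iD (nu, (Ordinal pn, c))); last by rewrite mem_rowlen /= Ec.
by apply/leposP; split=> //=; lia.
Qed.

Lemma removable_row (r c : 'I_n) : removable D (nu, (r, c)) =
  (c.+1 == rowlen r) && (rowlen r.+1 < rowlen r).
Proof.
apply/removableP/andP => [[pD H]|[/eqP Ec Hr]].
  have le1 : c < rowlen r by rewrite -mem_rowlen.
  have Ec : c.+1 = rowlen r.
    apply/eqP; rewrite eqn_leq le1 /= leqNgt; apply/negP => lt2.
    have c1n : c.+1 < n by apply: ltn_trans lt2 (rowlen_lt r).
    have := H (nu, (r, Ordinal c1n)); rewrite mem_rowlen lt2 => /(_ _ isT).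
    have -> : lepos (nu, (r, c)) (nu, (r, Ordinal c1n)) by apply/leposP; split=> //=.
    by case/(_ isT) => /(congr1 val)/=; lia.
  split; first exact/eqP.
  rewrite -Ec ltnS leqNgt; apply/negP => lt2.
  have [nr|rn] := leqP n r.+1; first by rewrite rowlen_out in lt2.
  have := H (nu, (Ordinal rn, c)); rewrite mem_rowlen lt2 => /(_ _ isT).
  have -> : lepos (nu, (r, c)) (nu, (Ordinal rn, c)) by apply/leposP; split=> //=.
  by case/(_ isT) => /(congr1 val)/=; lia.
split=> [|[nu' [r' c']] /leposP/= [<- a b]]; first by rewrite mem_rowlen -Ec.
rewrite mem_rowlen => lt.
have Er : r' = r.
  apply: val_inj => /=; apply/eqP; rewrite eqn_leq a andbT leqNgt; apply/negP => lt_r.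
  have mono m : rowlen (r.+1 + m) <= rowlen r.+1.
    by elim: m => [|m IH]; rewrite ?addn0 // addnS; apply: leq_trans (rowlenS _) IH.
  by have := mono (r' - r.+1); rewrite subnKC //; lia.
by rewrite Er in lt *; congr (_, (_, _)); apply: val_inj => /=; lia.
Qed.

(** A removable cell ends row r exactly when a cell can be added to row r + 1,
    and a cell can always be added to the first row. *)
Lemma corners_row : \sum_(rc : 'I_n * 'I_n) addable D (nu, rc) =
  (\sum_(rc : 'I_n * 'I_n) removable D (nu, rc)).+1.
Proof.
have n0 : 0 < n by apply: leq_ltn_trans Dn.
have split2 (F : 'I_n * 'I_n -> nat) : \sum_rc F rc = \sum_r \sum_c F (r, c).
  by rewrite pair_bigA; apply: eq_bigr => -[].
rewrite !split2.
transitivity (\sum_(r < n) ((r == 0 :> nat) || (rowlen r < rowlen r.-1) : nat)).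
  apply: eq_bigr => r _; rewrite (bigD1 (Ordinal (rowlen_lt r))) //= big1 ?addn0.
    by rewrite addable_row eqxx.
  move=> c; rewrite -val_eqE addable_row /= => /negPf ->; by [].
transitivity (\sum_(r < n) (rowlen r.+1 < rowlen r : nat)).+1; last first.
  congr _.+1; apply: eq_bigr => r _.
  have [lt|ge] := ltnP (rowlen r.+1) (rowlen r); last first.
    by rewrite big1 // => c _; rewrite removable_row ltnNge ge andbF.
  have cn : (rowlen r).-1 < n by have := rowlen_lt r; lia.
  rewrite (bigD1 (Ordinal cn)) //= big1 ?addn0.
    by rewrite removable_row lt /= andbT; case: (rowlen r) lt => //= m _; rewrite eqxx.
  move=> c; rewrite -val_eqE removable_row /= => ne; case: eqP => //= E.
  by rewrite -E eqxx in ne.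
move: rowlen_last; case: n n0 => // m _ last.
rewrite big_ord_recl big_ord_recr /= last ltn0 addn0 add1n.
by congr _.+1; apply: eq_bigr => i _; rewrite /bump add1n.
Qed.

End Corners.

(** One more for each of the two components. *)
Lemma corners D : ideal D -> #|D| < n ->
  \sum_p (addable D p : nat) = \sum_p (removable D p : nat) + 2.
Proof.
move=> iD Dn; have split2 (F : pos -> nat) : \sum_p F p = \sum_nu \sum_rc F (nu, rc).
  by rewrite pair_bigA; apply: eq_bigr => -[].
rewrite !split2.
under eq_bigr => nu _ do rewrite corners_row //.
by rewrite !big_ord_recl !big_ord0 !addn0 !addSn !addnS !addn0.
Qed.

(** Remove a cell after adding one: either it is the same cell, or the two
    operations commute. *)
Lemma nlinext_swap k D : ideal D ->
  \sum_(p | addable D p) nlinext k.+1 (p |: D) =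
  (\sum_p (addable D p : nat)) * nlinext k D +
  \sum_(q | removable D q) \sum_(p | addable (D :\ q) p && (p != q)) nlinext k (p |: D :\ q).
Proof.
move=> iD.
transitivity (\sum_(p | addable D p) (nlinext k D +
    \sum_(q | removable (p |: D) q && (q != p)) nlinext k (p |: D :\ q))).
  apply: eq_bigr => p pD; rewrite nlinextS ?ideal_add //.
  have [pnD _] := addableP _ _ pD.
  rewrite (bigD1 p) ?add_rem //= setU1K //; congr addn; apply: eq_bigr => q /andP[_ nqp].
  congr nlinext; apply/setP => x; rewrite !inE.
  by have [->|] := eqVneq x p; rewrite // eq_sym nqp.
rewrite big_split /=; congr addn.
  by rewrite big_mkcond big_distrl /=; apply: eq_bigr => p _; case: ifP; rewrite ?mul1n.
rewrite (exchange_big_dep (removable D)) /=; last first.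
  move=> p q pD /andP[qD nqp]; rewrite eq_sym in nqp.
  by have := add_rem_commute iD nqp; rewrite pD qD => /esym/andP[].
apply: eq_bigr => q qD; apply: eq_bigl => p; have [->|npq] := eqVneq p q; rewrite ?andbF ?andbT //.
by rewrite (add_rem_commute iD npq) qD.
Qed.

Lemma removable0 p : removable set0 p = false.
Proof. by rewrite /removable inE. Qed.

Lemma card_rem (D : {set pos}) q k : #|D| = k.+1 -> removable D q -> #|D :\ q| = k.
Proof. by move=> Dk /removableP[qD _]; apply/eqP; rewrite -eqSS -Dk (cardsD1 q D) qD. Qed.

(** The relation U D = D U + 2 between adding and removing a cell makes each
    step contribute 2, by induction on the number of cells. *)
Lemma nlinext_up k (D : {set pos}) : ideal D -> #|D| = k -> k < n ->
  \sum_(p | addable D p) nlinext k.+1 (p |: D) = 2 * k.+1 * nlinext k D.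
Proof.
elim: k D => [|k IH] D iD Dk kn; rewrite nlinext_swap // corners ?Dk //.
  move/eqP: Dk; rewrite cards_eq0 => /eqP ->.
  rewrite big1 => [|p _]; last by rewrite removable0.
  by rewrite big_pred0 ?addn0 ?muln1 // => p; rewrite removable0.
set X := (X in _ + X = _); set m := \sum_p _.
suff : X + m * nlinext k.+1 D = 2 * k.+1 * nlinext k.+1 D by lia.
rewrite [in RHS]nlinextS // big_distrr /= /X /m big_distrl /=.
rewrite [X in _ + X = _](bigID (removable D)) /= [X in _ + (_ + X) = _]big1 ?addn0; last first.
  by move=> p /negPf ->.
rewrite -big_split /=; apply: eq_bigr => q qD.
rewrite -(IH (D :\ q)) ?ideal_rem ?(card_rem Dk) ?(ltnW kn) //.
rewrite [RHS](bigD1 q) ?rem_add //= qD mul1n addnC; congr addn.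
by rewrite setD1K //; case/removableP: qD.
Qed.

(** Passing from k to k + 1 cells, expand one factor by its removable cells and
    sum the other one by [nlinext_up]. *)
Lemma nlinext_sqr k : k <= n ->
  \sum_(D : {set pos} | ideal D && (#|D| == k)) nlinext k D ^ 2 = 2 ^ k * k`!.
Proof.
elim: k => [_|k IH kn].
  rewrite (bigD1 set0) /=; last first.
    by rewrite cards0 eqxx andbT; apply/idealP => p q _; rewrite inE.
  rewrite nlinext0 big1 // => D /andP[/andP[_ D0]]; by rewrite -cards_eq0 D0.
rewrite factS expnS mulnACA -IH ?(ltnW kn) // big_distrr /=.
transitivity (\sum_(D : {set pos} | ideal D && (#|D| == k.+1))
    \sum_(q | removable D q) nlinext k.+1 D * nlinext k (D :\ q)).
  by apply: eq_bigr => D /andP[iD _]; rewrite expnS expn1 [X in _ * X = _]nlinextS // big_distrr.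
transitivity (\sum_(D : {set pos} | ideal D && (#|D| == k))
    \sum_(p | addable D p) nlinext k.+1 (p |: D) * nlinext k D); last first.
  by apply: eq_bigr => D /andP[iD /eqP Dk]; rewrite -big_distrl /= nlinext_up // -mulnA.
rewrite !pair_big_dep /=.
rewrite (reindex_onto (fun u : {set pos} * pos => (u.2 |: u.1, u.2))
   (fun u : {set pos} * pos => (u.1 :\ u.2, u.2))) /=; last first.
  by move=> [D q] /andP[_ qD] /=; rewrite setD1K //; case/removableP: qD.
apply: eq_big => [[D p]|[D p]] /=; last first.
  by case/andP => _ /eqP[->].
apply/idP/idP.
  case/andP => /andP[/andP[iD Dk] pD] /eqP[E]; rewrite -{1 2 3}E ideal_rem // rem_add //.
  by rewrite (card_rem (eqP Dk) pD) eqxx.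
case/andP => /andP[iD /eqP Dk] pD; have [pnD _] := addableP _ _ pD.
by rewrite ideal_add // add_rem // cardsU1 pnD Dk add1n setU1K // !eqxx.
Qed.

Definition cells (lam : bipart n) : {set pos} := [set p | p.2 \in sval lam p.1].

Lemma cells_ideal lam : ideal (cells lam).
Proof.
apply/idealP => p q /leposP[e1 a b]; rewrite !inE e1 => H.
exact: (young_closed H).
Qed.

Lemma card_cells lam : #|cells lam| = n.
Proof.
have /andP[_ /eqP En] := svalP lam; apply: etrans En.
rewrite -sum1_card; under eq_bigl do rewrite inE.
rewrite -(pair_big_dep xpredT (fun nu c => c \in sval lam nu) (fun _ _ => 1%N)) /=.
by apply: eq_bigr => nu _; rewrite sum1_card.
Qed.

Lemma cells_inj : injective cells.
Proof.
move=> lam mu E; apply: val_inj; apply/ffunP => nu; apply/setP => c.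
by have /setP/(_ (nu, c)) := E; rewrite !inE.
Qed.

Lemma ideal_cells D : ideal D -> #|D| = n -> exists lam, D = cells lam.
Proof.
move=> /idealP iD Dn.
pose f : {ffun 'I_2 -> {set 'I_n * 'I_n}} := [ffun nu => [set c | (nu, c) \in D]].
have fP : [forall nu, is_young (f nu)] && ((\sum_nu #|f nu|) == n).
  apply/andP; split.
    apply/forallP => nu; apply/forallP => c; apply/implyP; rewrite ffunE inE => cD.
    apply/forallP => d; apply/implyP => /andP[a b]; rewrite inE; apply: iD cD.
    by apply/leposP.
  apply/eqP; rewrite -[RHS]Dn -sum1_card -[RHS]/(\sum_(p | p \in D) 1)%N.
  transitivity (\sum_(nu : 'I_2) \sum_(c : 'I_n * 'I_n | (nu, c) \in D) 1).
    by apply: eq_bigr => nu _; rewrite sum1_card; apply: eq_card => c; rewrite ffunE inE.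
  by rewrite pair_big_dep /=; apply: eq_bigl => -[nu c].
by exists (exist _ f fP); apply/setP => -[nu c]; rewrite !inE /= ffunE inE.
Qed.

Definition tab_seq (T : bitab n) : n.-tuple pos := [tuple T (rev_ord k) | k < n].

Lemma linextP (s : seq pos) : linext s <->
  uniq s /\ forall p q, lepos p q -> q \in s -> p \in s /\ index q s <= index p s.
Proof.
elim: s => [|r s IH] /=; first by split.
split.
  case/and3P => rs /forallP H /IH[us Hs]; split; first by rewrite rs.
  move=> p q pq; rewrite !inE [r == q]eq_sym [r == p]eq_sym.
  have [Eq|nq] := eqVneq q r; have [Ep|np] := eqVneq p r => //=.
  - by move=> _; split=> //; have /implyP := H p; apply; rewrite np -Eq pq.
  - by move=> /(Hs _ _ pq)[]; rewrite Ep (negPf rs).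
  by move=> /(Hs _ _ pq)[].
case=> /andP[rs us] H; rewrite rs /=; apply/andP; split.
  apply/forallP => p; apply/implyP => /andP[pr np].
  by have := H p r pr; rewrite !inE eqxx (negPf np) => /(_ isT)[].
apply/IH; split=> // p q pq qs; have := H p q pq; rewrite !inE qs orbT => /(_ isT).
have -> : r == q = false by apply: contraNF rs => /eqP ->.
case: (eqVneq p r) => [E|np] /=; last by rewrite ltnS.
by case.
Qed.

(** The conditions of a standard tableau only compare cells in the same row or
    column; two comparable cells in general position are compared through the
    corner of the rectangle they span. *)
Lemma STab_linext lam (T : bitab n) :
  (T \in STab lam) = linext (tab_seq T) && ([set x in tab_seq T] == cells lam).
Proof.
have idx : injective T -> forall k, index (T k) (tab_seq T) = n - k.+1.
  move=> Tinj k; have := ltn_ord k => kn.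
  have E : tnth (tab_seq T) (rev_ord k) = T k by rewrite tnth_mktuple rev_ordK.
  rewrite -E (tnth_nth (T k)) index_uniq ?size_tuple ?ltn_ord //.
  by rewrite map_inj_uniq ?enum_uniq // => x y /Tinj/rev_ord_inj.
have memT p : (p \in tab_seq T) = [exists k, T k == p].
  apply/tnthP/existsP => [[i ->]|[k /eqP <-]].
    by exists (rev_ord i); rewrite tnth_mktuple.
  by exists (rev_ord k); rewrite tnth_mktuple rev_ordK.
rewrite inE; apply/andP/andP => [[tabT std]|[/linextP[us H] /eqP/setP E]].
  have Tinj := tab_inj tabT.
  have mem_cells p : (p \in tab_seq T) = (p \in cells lam).
    by case: p => nu c; rewrite memT inE (tab_cell tabT).
  split; last by apply/eqP/setP => p; rewrite inE mem_cells.
  apply/linextP; split.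
    by rewrite map_inj_uniq ?enum_uniq // => x y /Tinj/rev_ord_inj.
  move=> p q pq qs.
  have ps : p \in tab_seq T.
    by rewrite mem_cells; apply: (idealP _ (cells_ideal lam) q p pq); rewrite -mem_cells.
  split=> //; move: ps qs pq; rewrite !memT => /existsP[k /eqP <-] /existsP[l /eqP <-].
  rewrite !idx // => /leposP[e1 a b]; suff : k <= l by lia.
  have Hm := @tab_mem n lam T tabT.
  (* the corner of the rectangle spanned by the two cells *)
  have [m Em] : exists m, T m = ((T l).1, ((T k).2.1, (T l).2.2)).
    apply: (tab_entry tabT); exact: (young_closed (Hm l)).
  have km : k <= m.
    have [Eb|nb] := eqVneq (T k).2.2 (T l).2.2.
      suff -> : k = m by [].
      by apply: Tinj; rewrite Em -Eb -e1; case: (T k) => ? [].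
    apply: ltnW; apply: (std_row_lt (T := T)) => //; rewrite ?Em //=.
    by rewrite ltn_neqAle nb.
  apply: leq_trans km _.
  have [Ea|na] := eqVneq (T k).2.1 (T l).2.1.
    suff -> : m = l by [].
    by apply: Tinj; rewrite Em Ea; case: (T l) => ? [].
  apply: ltnW; apply: (std_lt (T := T)) => //; rewrite ?Em //=.
  by rewrite ltn_neqAle na.
have Tinj : injective T.
  move=> k l Ekl; apply: rev_ord_inj; apply: (elimT (tuple_uniqP _) us).
  by rewrite !tnth_mktuple !rev_ordK.
split.
  apply/andP; split; first exact/injectiveP.
  apply/forallP => nu; apply/forallP => c; apply/eqP.
  by have := E (nu, c); rewrite !inE memT => <-.
apply/forallP => k; apply/forallP => l; apply/implyP => /andP[/eqP e1 K].
have pq : lepos (T k) (T l).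
  by apply/leposP; split=> //; case/orP: K => /andP[/eqP e2 e3]; rewrite ?e2 // ltnW.
have ql : T l \in tab_seq T by rewrite memT; apply/existsP; exists l.
have [_] := H _ _ pq ql; rewrite !idx // => le.
rewrite ltn_neqAle; apply/andP; split; last by have := ltn_ord k; have := ltn_ord l; lia.
by apply: contraTneq K => /val_inj ->; rewrite !ltnn !andbF.
Qed.

Lemma ftab_nlinext lam : ftab lam = nlinext n (cells lam).
Proof.
rewrite /ftab /nlinext -(card_imset _ (f := tab_seq)); last first.
  move=> T T' E; apply/ffunP => k; have := congr1 (fun t => tnth t (rev_ord k)) E.
  by rewrite !tnth_mktuple rev_ordK.
apply: eq_card => t; apply/imsetP/idP => [[T TS ->]|]; first by rewrite inE -STab_linext.
rewrite inE => lt; have Et : tab_seq [ffun k => tnth t (rev_ord k)] = t.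
  by apply: eq_from_tnth => i; rewrite tnth_mktuple ffunE rev_ordK.
by exists [ffun k => tnth t (rev_ord k)]; rewrite ?STab_linext Et.
Qed.

Theorem sum_ftab_sqr : \sum_(lam : bipart n) ftab lam ^ 2 = #|[set: Bn n]|.
Proof.
have -> : #|[set: Bn n]| = 2 ^ n * n`!.
  by rewrite cardsT card_prod card_ffun card_bool card_ord card_Sn.
rewrite -nlinext_sqr //; under eq_bigr do rewrite ftab_nlinext.
rewrite -(big_imset (fun D => nlinext n D ^ 2) (h := cells) (A := predT)) /=; last first.
  by move=> ? ? _ _; exact: cells_inj.
apply: eq_bigl => D; apply/imsetP/andP => [[lam _ ->]|[iD /eqP Dn]].
  by rewrite cells_ideal card_cells.
by have [lam ->] := ideal_cells iD Dn; exists lam.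
Qed.

End Counting.

(** * Orthogonality of matrix representations *)

Section MatrixReps.
Variables (R : realType) (n : nat).
Local Notation C := R[i].
Local Notation P := {mpoly C[n]}.
Local Notation W := (Bn n).
Local Notation A := {ffun W -> C}.

Definition morphmx m (r : W -> 'M[C]_m) :=
  r 1%g = 1%:M /\ forall g h, r (g * h)%g = r g *m r h.

(** The extension of r to the group algebra. *)
Definition repalg m (r : W -> 'M[C]_m) (a : A) : 'M[C]_m := \sum_g a g *: r g.

(** The representation r is cyclic, generated by a vector xi that satisfies all
    relations of f; for f = [DT T] it is the irreducible representation
    generated by f. *)
Definition typed (f : P) m (r : W -> 'M[C]_m) := exists xi : 'cV[C]_m,
  [/\ xi != 0, forall eta : 'cV[C]_m, exists a, eta = repalg r a *m xi &
      forall a, pact a f = 0 -> repalg r a *m xi = 0].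

Section One.
Variables (m : nat) (r : W -> 'M[C]_m).
Hypothesis mr : morphmx r.

Lemma repalg_conv a b : repalg r (gconv a b) = repalg r a *m repalg r b.
Proof.
rewrite /repalg mulmx_suml; under eq_bigr do rewrite ffunE scaler_suml.
rewrite exchange_big; apply: eq_bigr => h _.
rewrite (reindex_inj (mulgI h)) mulmx_sumr; apply: eq_bigr => g _ /=.
by rewrite mulKg (proj2 mr) -scalemxAl -scalemxAr scalerA.
Qed.

Lemma repalgB a b : repalg r (a - b) = repalg r a - repalg r b.
Proof. by rewrite /repalg -sumrB; apply: eq_bigr => g _; rewrite !ffunE scalerBl. Qed.

Lemma repalgZ c a : repalg r (c *: a) = c *: repalg r a.
Proof. by rewrite /repalg scaler_sumr; apply: eq_bigr => g _; rewrite !ffunE scalerA. Qed.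

Lemma repalg_delta g : repalg r (gdelta R g) = r g.
Proof.
rewrite /repalg (bigD1 g) //= big1 => [|h hg]; first by rewrite ffunE eqxx scale1r addr0.
by rewrite ffunE (negPf hg) scale0r.
Qed.

Lemma repalg1 : repalg r (gone R n) = 1%:M.
Proof. by rewrite gone_delta repalg_delta (proj1 mr). Qed.

Lemma morphmxV g : r g^-1%g *m r g = 1%:M.
Proof. by rewrite -(proj2 mr) mulVg (proj1 mr). Qed.

Lemma repalg_commute m' (r' : W -> 'M[C]_m') (X : 'M[C]_(m, m')) a :
  (forall g, r g *m X = X *m r' g) -> repalg r a *m X = X *m repalg r' a.
Proof.
move=> H; rewrite mulmx_suml mulmx_sumr; apply: eq_bigr => g _.
by rewrite -scalemxAl H scalemxAr.
Qed.

(** If a f <> 0 then b a f = f for some b, a relation which xi satisfies. *)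
Lemma typed_ann (lam : bipart n) T (xi : 'cV[C]_m) a : is_tableau lam T -> xi != 0 ->
  (forall a, pact a (DT R T) = 0 -> repalg r a *m xi = 0) ->
  repalg r a *m xi = 0 -> pact a (DT R T) = 0.
Proof.
move=> tabT xi0 H axi; apply/eqP; apply: contraTT xi0 => aT; rewrite negbK.
have [b Hb] := irreducible tabT aT.
have := H (gconv b a - gone R n); rewrite pactDl pactNl pact1 pact_conv Hb subrr => /(_ erefl).
by rewrite repalgB repalg_conv repalg1 mulmxBl -mulmxA axi mulmx0 mul1mx sub0r => /eqP;
  rewrite oppr_eq0.
Qed.

End One.

(** An intertwiner X <> 0 maps the generator xi' to some b xi, and [DT T'] has
    then a nonzero image b (DT T). *)
Lemma schur_diff (lam mu : bipart n) T T' m m' r r' (X : 'M[C]_(m, m')) :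
  is_tableau lam T -> is_tableau mu T' -> morphmx r -> morphmx r' ->
  typed (DT R T) r -> typed (DT R T') r' ->
  (forall g, r g *m X = X *m r' g) -> X != 0 -> lam = mu.
Proof.
move=> tabT tabT' mr mr' [xi [xi0 cyc ann]] [xi' [xi0' cyc' ann']] H X0.
have Xxi : X *m xi' != 0.
  apply: contraNneq X0 => E; apply/eqP/matrixP => i j; rewrite mxE.
  have [a Ea] := cyc' (delta_mx j 0).
  have : X *m delta_mx j 0 = 0 :> 'cV_m.
    by rewrite Ea mulmxA -(repalg_commute a H) -mulmxA E mulmx0.
  by move/matrixP/(_ i 0); rewrite -colE !mxE.
have [b Eb] := cyc (X *m xi').
apply/esym; apply: (@distinct_shapes _ _ mu lam T' T b tabT' tabT).
  move=> a aT'; rewrite -pact_conv; apply: (typed_ann mr tabT xi0 ann).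
  by rewrite repalg_conv // -mulmxA -Eb mulmxA (repalg_commute a H) -mulmxA ann' ?mulmx0.
by apply: contraNneq Xxi => E; rewrite Eb ann.
Qed.

(** The vector xi is fixed by [eps T], a projector of rank one by [anti_scalar];
    as X commutes with it, X xi is a multiple of xi. *)
Lemma schur_same (lam : bipart n) T m (r : W -> 'M[C]_m) (X : 'M[C]_m) :
  is_tableau lam T -> morphmx r -> typed (DT R T) r ->
  (forall g, r g *m X = X *m r g) -> exists c, X = c%:M.
Proof.
move=> tabT mr [xi [xi0 cyc ann]] H; have [b Eb] := cyc (X *m xi).
have fix1 : repalg r (eps R T) *m xi = xi.
  have := ann (eps R T - gone R n).
  rewrite pactDl pactNl pact1 eps_DT subrr => /(_ erefl)/eqP.
  by rewrite repalgB repalg1 // mulmxBl mul1mx subr_eq0 => /eqP.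
set p := pact (eps R T) (pact b (DT R T)).
have pE : p = p@_(tmon T) *: DT R T.
  apply: (anti_scalar tabT); first exact: eps_anti.
  move=> k; apply: orb_mdeg; apply: orb_pact; apply: orb_pact; exact: orb_DT.
exists (p@_(tmon T)).
have Xxi : X *m xi = p@_(tmon T) *: xi.
  have := ann (gconv (eps R T) b - p@_(tmon T) *: gone R n).
  rewrite pactDl pactNl pactZl pact1 pact_conv -/p -pE subrr => /(_ erefl)/eqP.
  rewrite repalgB repalgZ repalg1 // mulmxBl -scalemxAl mul1mx subr_eq0 => /eqP <-.
  rewrite repalg_conv // -mulmxA -Eb mulmxA (repalg_commute _ H) -mulmxA fix1 //.
apply/matrixP => i j; have [a Ea] := cyc (delta_mx j 0).
have : X *m delta_mx j 0 = p@_(tmon T) *: (delta_mx j 0 : 'cV_m).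
  by rewrite Ea mulmxA -(repalg_commute a H) -mulmxA Xxi -scalemxAr.
move/matrixP/(_ i 0); rewrite -colE !mxE eqxx andbT => ->.
by rewrite mulr_natr.
Qed.

Lemma mul_delta_entry m m' (X : 'M[C]_m) (Y : 'M[C]_m') i j k l :
  (X *m delta_mx j k *m Y) i l = X i j * Y k l.
Proof.
rewrite !mxE (bigD1 k) //= [X in _ + X]big1 ?addr0 => [|k' /negPf nk].
  by rewrite !mxE (bigD1 j) //= [X in _ + X]big1 ?addr0 => [|j' /negPf nj];
    rewrite !mxE ?eqxx ?mulr1 // nj mulr0.
by rewrite !mxE big1 ?mul0r // => j' _; rewrite !mxE nk andbF mulr0.
Qed.

Let avg m m' (r : W -> 'M[C]_m) (r' : W -> 'M[C]_m') (E : 'M[C]_(m, m')) :=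
  \sum_h r h *m E *m r' h^-1%g.

Let avg_commute m m' (r : W -> 'M[C]_m) (r' : W -> 'M[C]_m') E :
  morphmx r -> morphmx r' -> forall g, r g *m avg r r' E = avg r r' E *m r' g.
Proof.
move=> mr mr' g; rewrite mulmx_sumr mulmx_suml (reindex_inj (mulgI g^-1%g)) /=.
apply: eq_bigr => h _.
by rewrite !mulmxA -(proj2 mr) mulKVg -[in RHS]mulmxA -(proj2 mr') invMg invgK.
Qed.

(** Averaging an elementary matrix over the group gives an intertwiner. *)
Lemma ortho_diff (lam mu : bipart n) T T' m m' r r' (i j : 'I_m) (k l : 'I_m') :
  is_tableau lam T -> is_tableau mu T' -> morphmx r -> morphmx r' ->
  typed (DT R T) r -> typed (DT R T') r' -> lam != mu ->
  \sum_h r h i j * r' h^-1%g k l = 0.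
Proof.
move=> tabT tabT' mr mr' tr tr' ne.
have E : avg r r' (delta_mx j k) = 0.
  apply/eqP; apply: contraNT ne => X0; apply/eqP.
  exact: (schur_diff tabT tabT' mr mr' tr tr' (avg_commute _ mr mr') X0).
transitivity (avg r r' (delta_mx j k) i l); last by rewrite E mxE.
by rewrite /avg summxE; apply: eq_bigr => h _; rewrite mul_delta_entry.
Qed.

(** The average of an elementary matrix is scalar, and its trace is known. *)
Lemma ortho_same (lam : bipart n) T m (r : W -> 'M[C]_m) (i j k l : 'I_m) :
  is_tableau lam T -> morphmx r -> typed (DT R T) r ->
  \sum_h r h i j * r h^-1%g k l = ((i == l) && (j == k))%:R * (#|[set: W]|%:R / m%:R).
Proof.
move=> tabT mr tr; have [c Ec] := schur_same tabT mr tr (avg_commute (delta_mx j k) mr mr).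
have m0 : m%:R != 0 :> C by rewrite pnatr_eq0; case: m i {r mr tr j k l c Ec} => [[]|].
have trc : c * m%:R = (j == k)%:R * #|[set: W]|%:R.
  rewrite mulr_natr -mxtrace_scalar -Ec /avg raddf_sum /=.
  under eq_bigr => h _ do rewrite mxtrace_mulC mulmxA morphmxV // mul1mx.
  rewrite sumr_const cardsT mulr_natr; congr (_ *+ _).
  rewrite /mxtrace (bigD1 j) //= big1 => [|x /negPf xj]; first by rewrite !mxE eqxx addr0.
  by rewrite mxE xj.
have := congr1 (fun X : 'M[C]_m => X i l) Ec; rewrite /avg summxE [RHS]mxE.
under eq_bigr do rewrite mul_delta_entry; move=> ->.
have -> : c = (j == k)%:R * (#|[set: W]|%:R / m%:R) by rewrite mulrA -trc mulfK.
by case: (i == l); case: (j == k); rewrite ?mulr1n ?mulr0n ?mul1r ?mul0r.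
Qed.

End MatrixReps.

Section Inverses.
Variables (F : fieldType) (I J : finType) (X : I -> J -> F) (Y : J -> I -> F).
Hypothesis XY : forall i k, \sum_j X i j * Y j k = (i == k)%:R.

Let mX : 'M[F]_(#|I|, #|J|) := \matrix_(i, j) X (enum_val i) (enum_val j).
Let mY : 'M[F]_(#|J|, #|I|) := \matrix_(i, j) Y (enum_val i) (enum_val j).

Let mXY : mX *m mY = 1%:M.
Proof.
apply/matrixP => i k; rewrite !mxE -(inj_eq enum_val_inj) -XY.
rewrite [RHS](reindex_onto enum_val enum_rank) /=; last by move=> j _; rewrite enum_rankK.
by apply: eq_big => j; [rewrite enum_valK eqxx|rewrite !mxE].
Qed.

Lemma left_inverse_card : (#|I| <= #|J|)%N.
Proof. exact: mulmx1_min mXY. Qed.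

Lemma left_inverse_right : #|I| = #|J| -> forall j l, \sum_i Y j i * X i l = (j == l)%:R.
Proof.
move=> IJ j l; have mYX : mY *m mX = 1%:M.
  by move: mXY; move: mX mY; rewrite IJ => A B; exact: mulmx1C.
have := congr1 (fun Z : 'M[F]_#|J| => Z (enum_rank j) (enum_rank l)) mYX.
rewrite !mxE (inj_eq enum_rank_inj) => <-.
rewrite (reindex_onto enum_val enum_rank) /=; last by move=> i _; rewrite enum_rankK.
by apply: eq_big => i; [rewrite enum_valK eqxx|rewrite !mxE !enum_rankK].
Qed.

End Inverses.

(** * Dimensions of the representations *)

Section Bases.
Variables (R : realType) (n : nat).
Local Notation C := R[i].
Local Notation P := {mpoly C[n]}.
Local Notation W := (Bn n).
Local Notation A := {ffun W -> C}.

Definition indep m (F : 'I_m -> P) :=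
  forall c : 'I_m -> C, \sum_i c i *: F i = 0 -> forall i, c i = 0.

Lemma indep_eq m (F : 'I_m -> P) (c d : 'I_m -> C) : indep F ->
  \sum_i c i *: F i = \sum_i d i *: F i -> c =1 d.
Proof.
move=> iF E i; apply/eqP; rewrite -subr_eq0; apply/eqP.
apply: (iF (fun i => c i - d i)); under eq_bigr do rewrite scalerBl.
by rewrite sumrB E subrr.
Qed.

Lemma rep_of_basis m (F : 'I_m -> P) : indep F ->
  (forall g k, exists c : 'I_m -> C, wa g (F k) = \sum_i c i *: F i) ->
  exists2 r : W -> 'M[C]_m, morphmx r & forall g k, wa g (F k) = \sum_i r g i k *: F i.
Proof.
move=> iF st.
have /fin_all_exists [c Ec] : forall u : W * 'I_m, exists c : 'I_m -> C,
    wa u.1 (F u.2) = \sum_i c i *: F i by move=> [g k]; exact: st.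
pose r (g : W) : 'M[C]_m := \matrix_(i, k) c (g, k) i.
have Er g k : wa g (F k) = \sum_i r g i k *: F i.
  by rewrite (Ec (g, k)); apply: eq_bigr => i _; rewrite mxE.
exists r => //; split=> [|g h]; apply/matrixP => i k; move: i.
  apply: (indep_eq iF); rewrite -Er wa1 (bigD1 k) //= big1 => [|i /negPf ik].
    by rewrite mxE eqxx scale1r addr0.
  by rewrite mxE ik scale0r.
apply: (indep_eq iF); rewrite -Er waM Er wa_sum.
under eq_bigr do rewrite waZ Er scaler_sumr.
rewrite exchange_big; apply: eq_bigr => i _ /=.
by rewrite mxE scaler_suml; apply: eq_bigr => j _; rewrite scalerA mulrC.
Qed.

Section Coordinates.
Variables (m : nat) (F : 'I_m -> P) (r : W -> 'M[C]_m).
Hypothesis Er : forall g k, wa g (F k) = \sum_i r g i k *: F i.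

(** The polynomial with given coordinates in the family F. *)
Definition vec (eta : 'cV[C]_m) : P := \sum_k eta k 0 *: F k.

Lemma vec_act a eta : pact a (vec eta) = vec (repalg r a *m eta).
Proof.
have EF k : pact a (F k) = \sum_i repalg r a i k *: F i.
  rewrite pactE; under eq_bigr do rewrite Er scaler_sumr.
  rewrite exchange_big; apply: eq_bigr => i _ /=.
  by rewrite summxE scaler_suml; apply: eq_bigr => g _; rewrite mxE scalerA.
rewrite /vec linear_sum /=; under eq_bigr do rewrite linearZ /= EF scaler_sumr.
rewrite exchange_big; apply: eq_bigr => i _ /=.
by rewrite mxE scaler_suml; apply: eq_bigr => k _; rewrite scalerA mulrC.
Qed.

Lemma basis_typed f xi : indep F -> f = vec xi -> f != 0 ->
  (forall k, exists a, F k = pact a f) -> typed f r.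
Proof.
move=> iF Ef f0 cyc; exists xi.
have vec_inj eta eta' : vec eta = vec eta' -> eta = eta'.
  by move=> E; apply/matrixP => i j; rewrite (ord1 j); apply: (indep_eq iF E).
have vec0 : vec 0 = 0 by rewrite /vec big1 // => k _; rewrite mxE scale0r.
split=> [|eta|a].
- by apply: contraNneq f0 => E; rewrite Ef E vec0.
- have /fin_all_exists [a Ea] := cyc.
  exists (\sum_k eta k 0 *: a k); apply: vec_inj; rewrite -vec_act -Ef pact_suml.
  by apply: eq_bigr => k _; rewrite pactZl -Ea.
by rewrite Ef vec_act -vec0 => /vec_inj.
Qed.
End Coordinates.

(** Choose rows of maximal rank in the matrix of coordinates on monomials. *)
Lemma span_basis (I : finType) (u : I -> P) : exists (m : nat) (f : 'I_m -> I),
  indep (u \o f) /\ forall i, exists c : 'I_m -> C, u i = \sum_k c k *: u (f k).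
Proof.
have [N [mon [X [mon_inj Eu]]]] := mpoly_coords u.
pose M : 'M[C]_(#|I|, N) := \matrix_(i, j) X (enum_val i) j.
have coord m (c : 'rV[C]_m) (f : 'I_m -> 'I_#|I|) :
   \sum_k c 0 k *: u (enum_val (f k)) = \sum_j (c *m rowsub f M) 0 j *: 'X_[mon j].
  under eq_bigr do rewrite Eu scaler_sumr; rewrite exchange_big; apply: eq_bigr => j _ /=.
  by rewrite mxE scaler_suml; apply: eq_bigr => k _; rewrite !mxE scalerA.
exists (\rank M), (enum_val \o maxrankfun M); split.
  move=> c E0 i; pose v : 'rV[C]_(\rank M) := \row_k c k.
  suff v0 : v = 0 by have := congr1 (fun w : 'rV_(\rank M) => w 0 i) v0; rewrite !mxE.
  apply: (row_free_inj (maxrowsub_free M)); rewrite mul0mx.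
  apply/rowP => j; rewrite [RHS]mxE.
  rewrite -(mcoeff_sumX (fun j => (v *m rowsub (maxrankfun M) M) 0 j) j mon_inj).
  rewrite -coord; under eq_bigr do rewrite mxE; by rewrite E0 mcoeff0.
move=> i; have /submxP [D ED] : (row (enum_rank i) M <= rowsub (maxrankfun M) M)%MS.
  by rewrite eq_maxrowsub row_sub.
exists (fun k => D 0 k); rewrite /= coord -ED Eu; apply: eq_bigr => j _.
by rewrite !mxE enum_rankK.
Qed.

End Bases.

Section Degrees.
Variables (R : realType) (n : nat).
Local Notation C := R[i].
Local Notation P := {mpoly C[n]}.
Local Notation W := (Bn n).
Local Notation A := {ffun W -> C}.

Lemma tableau_relabel (lam : bipart n) T T' : is_tableau lam T -> is_tableau lam T' ->
  exists w : 'S_n, forall k, T' (w k) = T k.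
Proof.
move=> tabT tabT'; have ex k : exists k', T' k' = T k.
  by rewrite [T k]surjective_pairing; apply: (tab_entry tabT'); exact: tab_mem.
have [f Ef] := fin_all_exists ex.
have finj : injective f by move=> k l E; apply: (tab_inj tabT); rewrite -!Ef E.
by exists (perm finj) => k; rewrite permE.
Qed.

Lemma rowgrp_neq0 (T : bitab n) : (#|rowgrp T|%:R : C) != 0.
Proof. by rewrite pnatr_eq0 -lt0n; apply/card_gt0P; exists 1%g; exact: rowgrp1. Qed.

Lemma DT_relabel (T T' : bitab n) (w : 'S_n) : (forall k, T' (w k) = T k) ->
  exists b, DT R T' = pact b (DT R T).
Proof.
move=> Ew; have Em : (tmon T')#w = tmon T by apply/mnmP => k; rewrite !mnmE Ew.
exists ((#|rowgrp T'|%:R)^-1 *: (#|rowgrp T|%:R *: gdelta R (pe w))).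
rewrite !pactZl pact_delta; apply: (scalerI (rowgrp_neq0 T')).
have H := symmetrize_tmon R T'; rewrite -H.
have H1 := symmetrize_relabel R (tmon T') Ew; rewrite H1 Em.
have H2 := symmetrize_tmon R T; rewrite H2 waZ [RHS]scalerA divff ?rowgrp_neq0 //.
by rewrite scale1r.
Qed.

Lemma specht_relabel (lam : bipart n) (S T T' : bitab n) (w : 'S_n) : (forall k, T' (w k) = T k) ->
  exists b, specht lam S T' = pact b (specht (R := R) lam S T).
Proof.
move=> Ew; have Em : (spexp S T')#w = spexp S T by apply/mnmP => k; rewrite !mnmE Ew.
have [c c0 Ec] := specht_symmetrize R lam S T.
have [c' c0' Ec'] := specht_symmetrize R lam S T'.
exists (c' *: (c^-1 *: gdelta R (pe w))); rewrite !pactZl pact_delta Ec Ec' waZ.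
have H1 := symmetrize_relabel R (spexp S T') Ew; rewrite H1 Em.
by rewrite [c^-1 *: _]scalerA mulVf // scale1r.
Qed.

Lemma translates_rep (lam : bipart n) T : is_tableau lam T ->
  exists (m : nat) (r : W -> 'M[C]_m) (F : 'I_m -> P),
  [/\ morphmx r, typed (DT R T) r, indep F,
      forall k, exists g, F k = wa g (DT R T) &
      forall a, exists c : 'I_m -> C, pact a (DT R T) = \sum_k c k *: F k].
Proof.
move=> tabT; have [m [f [iF sp]]] := span_basis (fun g : W => wa g (DT R T)).
pose F k := wa (f k) (DT R T).
have spa a : exists c : 'I_m -> C, pact a (DT R T) = \sum_k c k *: F k.
  have [c Ec] := fin_all_exists sp; exists (fun k => \sum_g a g * c g k).
  rewrite pactE; under eq_bigr do rewrite Ec scaler_sumr.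
  rewrite exchange_big; apply: eq_bigr => k _ /=.
  by rewrite scaler_suml; apply: eq_bigr => g _; rewrite scalerA.
have [r mr Er] : exists2 r : W -> 'M[C]_m, morphmx r &
    forall g k, wa g (F k) = \sum_i r g i k *: F i.
  apply: rep_of_basis => // g k; have [c Ec] := spa (gdelta R (g * f k)%g).
  by exists c; rewrite -Ec pact_delta waM.
exists m, r, F; split=> //; last by move=> k; exists (f k).
have [c Ec] := spa (gone R n); rewrite pact1 in Ec.
apply: (basis_typed Er (xi := \col_k c k)) => //.
- by rewrite /vec; rewrite [LHS]Ec; apply: eq_bigr => k _; rewrite mxE.
- apply/eqP => E; have := DT_tmon R tabT; rewrite E mcoeff0 => /esym/eqP.
  by rewrite oner_eq0.
by move=> k; exists (gdelta R (f k)); rewrite pact_delta.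
Qed.

Definition std (lam : bipart n) (i : 'I_(ftab lam)) : bitab n := enum_val i.

Lemma std_STab (lam : bipart n) (i : 'I_(ftab lam)) : std i \in STab lam.
Proof. exact: enum_valP. Qed.

Lemma STab_tab (lam : bipart n) T : T \in STab lam -> is_tableau lam T.
Proof. by rewrite inE => /andP[]. Qed.

Lemma DT_indep (lam : bipart n) (s : 'I_(ftab lam) -> bitab n) : injective s ->
  (forall i, s i \in STab lam) -> indep (fun i => DT R (s i)).
Proof.
move=> sinj sS c E i.
pose d T := if [pick j | s j == T] is Some j then c j else 0.
have ds j : d (s j) = c j by rewrite /d; case: pickP => [k /eqP/sinj -> //|/(_ j)]; rewrite eqxx.
rewrite -ds; apply: (@DT_independent R n lam d) => //.
have Es : STab lam = [set s j | j : 'I_(ftab lam)].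
  apply/esym/eqP; rewrite eqEcard card_imset // card_ord leqnn andbT.
  by apply/subsetP => _ /imsetP[j _ ->].
rewrite Es big_imset /=; last by move=> ? ? _ _; exact: sinj.
by rewrite -[RHS]E; apply: eq_bigr => j _; rewrite ds.
Qed.

(** The translates of [DT T] contain the independent family of all [DT T'] for
    T' standard, and the matrix coefficients of these representations are
    independent functions on the group; the two bounds coincide by
    [sum_ftab_sqr]. *)
Lemma translates_dim : exists (m : bipart n -> nat) (r : forall lam, W -> 'M[C]_(m lam))
    (F : forall lam, 'I_(m lam) -> P),
  forall lam, m lam = ftab lam /\
  [/\ morphmx (r lam), typed (DT R (rowtab lam)) (r lam), indep (F lam),
      forall k, exists g, F lam k = wa g (DT R (rowtab lam)) &
      forall a, exists c : 'I_(m lam) -> C, pact a (DT R (rowtab lam)) = \sum_k c k *: F lam k].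
Proof.
have tabT lam := STab_tab (rowtab_STab lam).
have ex lam : exists u : {m : nat & (W -> 'M[C]_m) * ('I_m -> P)}%type,
  let r := (projT2 u).1 in let F := (projT2 u).2 in
  [/\ morphmx r, typed (DT R (rowtab lam)) r, indep F,
      forall k, exists g, F k = wa g (DT R (rowtab lam)) &
      forall a, exists c : 'I_(projT1 u) -> C, pact a (DT R (rowtab lam)) = \sum_k c k *: F k].
  have [m [r [F H]]] := translates_rep (tabT lam).
  by exists (existT _ m (r, F)).
have [u Hu] := fin_all_exists ex.
exists (fun lam => projT1 (u lam)), (fun lam => (projT2 (u lam)).1),
  (fun lam => (projT2 (u lam)).2).
suff dim lam : projT1 (u lam) = ftab lam by move=> lam; split=> //; exact: Hu.
have le_f mu : (ftab mu <= projT1 (u mu))%N.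
  have [mr tr iF _ sp] := Hu mu.
  have ex2 (i : 'I_(ftab mu)) : exists c : 'I_(projT1 (u mu)) -> C,
      DT R (std i) = \sum_k c k *: (projT2 (u mu)).2 k.
    have [w Ew] := tableau_relabel (tabT mu) (STab_tab (std_STab i)).
    by have [b ->] := DT_relabel Ew; exact: sp.
  have [c Ec] := fin_all_exists ex2.
  pose M : 'M[C]_(ftab mu, projT1 (u mu)) := \matrix_(i, k) c i k.
  have /eqP <- : row_free M; last exact: rank_leq_col.
  apply: inj_row_free => v vM; apply/rowP => i; rewrite mxE.
  apply: (DT_indep (s := @std mu) enum_val_inj (@std_STab mu) (c := fun i => v 0 i)).
  under eq_bigr do rewrite Ec scaler_sumr.
  rewrite exchange_big big1 // => k _ /=.
  have := congr1 (fun w : 'rV_(projT1 (u mu)) => w 0 k) vM; rewrite !mxE => E.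
  rewrite -[RHS](scale0r ((projT2 (u mu)).2 k)) -E scaler_suml.
  by apply: eq_bigr => j _; rewrite mxE scalerA.
pose I := {mu : bipart n & ('I_(projT1 (u mu)) * 'I_(projT1 (u mu)))%type}.
pose X (x : I) (h : W) : C := (projT2 (u (tag x))).1 h (tagged x).1 (tagged x).2.
pose Y (h : W) (x : I) : C := (projT1 (u (tag x)))%:R / #|[set: W]|%:R *
   (projT2 (u (tag x))).1 h^-1%g (tagged x).2 (tagged x).1.
have W0 : #|[set: W]|%:R != 0 :> C by rewrite pnatr_eq0 -lt0n; apply/card_gt0P; exists 1%g.
have XY x y : \sum_h X x h * Y h y = (x == y)%:R.
  rewrite /X /Y; case: x => mu [i j]; case: y => nu [k l] /=.
  have [mr tr _ _ _] := Hu mu; have [mr' tr' _ _ _] := Hu nu.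
  under eq_bigr do rewrite mulrCA; rewrite -big_distrr /=.
  have [E|ne] := eqVneq mu nu; last first.
    rewrite (ortho_diff i j l k (tabT mu) (tabT nu) mr mr' tr tr' ne) mulr0.
    by rewrite -tag_eqE /tag_eq /= (negPf ne).
  case: nu / E k l {mr' tr'} => k l.
  rewrite (ortho_same i j l k (tabT mu) mr tr) eq_Tagged /= -pair_eqE /=.
  have d0 : (projT1 (u mu))%:R != 0 :> C by rewrite pnatr_eq0; case: (projT1 _) i => [[]|].
  rewrite mulrCA [X in _ * X = _](_ : _ = 1) ?mulr1 //.
  by rewrite mulrA divfK // divff.
have := left_inverse_card XY.
have -> : #|{: I}| = (\sum_mu projT1 (u mu) ^ 2)%N.
  by rewrite card_tagged sumnE big_map big_enum /=; apply: eq_bigr => mu _;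
     rewrite card_prod card_ord.
rewrite -[leqRHS]cardsT -sum_ftab_sqr => le_sum.
apply/eqP; rewrite eqn_leq le_f andbT leqNgt; apply/negP => lt_f.
move: le_sum; rewrite leqNgt => /negP; apply.
rewrite [ltnLHS](bigD1 lam) // [ltnRHS](bigD1 lam) //= -addSn leq_add //.
  by rewrite ltn_sqr.
by apply: leq_sum => mu _; rewrite leq_sqr.
Qed.

End Degrees.

(** * Higher Specht polynomials modulo the coinvariant ideal *)

Section Spans.
Variables (R : realType) (n : nat).
Local Notation C := R[i].
Local Notation P := {mpoly C[n]}.
Local Notation W := (Bn n).
Local Notation A := {ffun W -> C}.

Lemma indep_exchange m (F G : 'I_m -> P) : indep G ->
  (forall i, exists c : 'I_m -> C, G i = \sum_k c k *: F k) ->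
  forall k, exists c : 'I_m -> C, F k = \sum_i c i *: G i.
Proof.
move=> iG /fin_all_exists [c Ec] k; pose M : 'M[C]_m := \matrix_(i, k) c i k.
have EG (v : 'rV[C]_m) : \sum_i v 0 i *: G i = \sum_k (v *m M) 0 k *: F k.
  under eq_bigr do rewrite Ec scaler_sumr.
  rewrite exchange_big; apply: eq_bigr => j _ /=; rewrite mxE scaler_suml.
  by apply: eq_bigr => i _; rewrite mxE scalerA.
have uM : M \in unitmx.
  rewrite -row_free_unit; apply: inj_row_free => v vM; apply/rowP => i; rewrite mxE.
  apply: (iG (fun i => v 0 i)); rewrite EG vM; apply: big1 => j _.
  by rewrite mxE scale0r.
exists (fun i => ((delta_mx 0 k : 'rV_m) *m invmx M) 0 i); rewrite EG mulmxKV //.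
rewrite (bigD1 k) //= big1 => [|j /negPf jk]; first by rewrite mxE !eqxx scale1r addr0.
by rewrite mxE jk andbF scale0r.
Qed.

(** The [DT T] for T standard are as many as the dimension of the space
    generated by one of them, hence a basis of it. *)
Lemma DT_span (lam : bipart n) (s : 'I_(ftab lam) -> bitab n) a : injective s ->
  (forall i, s i \in STab lam) ->
  exists c : 'I_(ftab lam) -> C, pact a (DT R (rowtab lam)) = \sum_i c i *: DT R (s i).
Proof.
move=> sinj sS; have [m [r [F H]]] := translates_dim R n; have [Em] := H lam.
move: (F lam) (r lam); rewrite Em => {H}{}F {}r [_ _ _ _ sp].
have exG i : exists c : 'I_(ftab lam) -> C, DT R (s i) = \sum_k c k *: F k.
  have [w Ew] := tableau_relabel (STab_tab (rowtab_STab lam)) (STab_tab (sS i)).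
  by have [b ->] := DT_relabel R Ew; exact: sp.
have [d Ed] := fin_all_exists (indep_exchange (DT_indep sinj sS) exG).
have [c ->] := sp a; exists (fun i => \sum_k c k * d k i).
under eq_bigr do rewrite Ed scaler_sumr.
rewrite exchange_big; apply: eq_bigr => i _ /=.
by rewrite scaler_suml; apply: eq_bigr => k _; rewrite scalerA.
Qed.

Lemma annleZ c (f h : P) : annle f h -> annle f (c *: h).
Proof. by move=> fh a /fh E; rewrite linearZ /= E scaler0. Qed.

Lemma annle_specht (lam : bipart n) S T : annle (DT R T) (specht (R := R) lam S T).
Proof.
have [c _ ->] := specht_symmetrize R lam S T; apply: annleZ; apply: annle_symmetrize => k.
by rewrite mnmE oddD oddM.
Qed.

Lemma specht_neq0 (lam : bipart n) S T : S \in STab lam -> T \in STab lam ->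
  specht (R := R) lam S T != 0.
Proof.
move=> SS TS; have [c c0 ->] := specht_symmetrize R lam S T.
rewrite scaler_eq0 negb_or c0 /=.
apply: (symmetrize_neq0 R (STab_tab TS)) => k l; exact: (spexp_column SS (STab_tab TS)).
Qed.

Lemma specht_annle (lam : bipart n) S T : S \in STab lam -> T \in STab lam ->
  annle (specht (R := R) lam S T) (DT R T).
Proof.
move=> SS TS.
exact: (irreducible_ann (STab_tab TS) (@annle_specht lam S T) (specht_neq0 SS TS)).
Qed.

Lemma specht_rowtab (lam : bipart n) T : is_tableau lam T -> exists2 c : C, c != 0 &
  specht lam (rowtab lam) T = c *: DT R T.
Proof.
move=> tabT; have [c c0 ->] := specht_symmetrize R lam (rowtab lam) T.
exists (c * #|rowgrp T|%:R); first by rewrite mulf_neq0 ?rowgrp_neq0.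
by rewrite -scalerA; f_equal; rewrite (spexp_rowtab tabT); exact: symmetrize_tmon.
Qed.

Lemma specht_rowtab_indep (lam : bipart n) (s : 'I_(ftab lam) -> bitab n) : injective s ->
  (forall i, s i \in STab lam) -> indep (fun i => specht (R := R) lam (rowtab lam) (s i)).
Proof.
move=> sinj sS; have /fin_all_exists2 [c c0 Ec] i := specht_rowtab (STab_tab (sS i)).
move=> d E i; have := DT_indep sinj sS (c := fun i => d i * c i).
have -> : \sum_i (d i * c i) *: DT R (s i) = 0.
  by rewrite -[RHS]E; apply: eq_bigr => j _; rewrite Ec scalerA.
by move=> /(_ erefl i)/eqP; rewrite mulf_eq0 (negPf (c0 i)) orbF => /eqP.
Qed.

Lemma specht_rowtab_span (lam : bipart n) (s : 'I_(ftab lam) -> bitab n) a T : injective s ->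
  (forall i, s i \in STab lam) -> T \in STab lam ->
  exists c : 'I_(ftab lam) -> C,
    pact a (specht (R := R) lam (rowtab lam) T) =
    \sum_i c i *: specht lam (rowtab lam) (s i).
Proof.
move=> sinj sS TS; have /fin_all_exists2 [c c0 Ec] i := specht_rowtab (STab_tab (sS i)).
have [d d0 ->] := specht_rowtab (STab_tab TS).
have [w Ew] := tableau_relabel (STab_tab (rowtab_STab lam)) (STab_tab TS).
have [b ->] := DT_relabel R Ew.
rewrite linearZ /= -pact_conv.
have [e ->] := DT_span (gconv a b) sinj sS.
exists (fun i => d * e i / c i); rewrite scaler_sumr; apply: eq_bigr => i _.
by rewrite Ec !scalerA divfK.
Qed.

Lemma coinv0 : coinv_ideal (0 : P).
Proof.
exists 0%N, (fun _ => 0), (fun _ => 0); split; first by case.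
by rewrite big_ord0.
Qed.

Lemma coinvD (f h : P) : coinv_ideal f -> coinv_ideal h -> coinv_ideal (f + h).
Proof.
move=> [m1 [a1 [h1 [H1 ->]]]] [m2 [a2 [h2 [H2 ->]]]].
exists (m1 + m2)%N, (fun k => match split k with inl i => a1 i | inr j => a2 j end),
  (fun k => match split k with inl i => h1 i | inr j => h2 j end).
split; first by move=> k; case: (split k).
rewrite big_split_ord /=; apply: f_equal2; apply: eq_bigr => i _.
  by rewrite -[lshift _ i]/(unsplit (inl i)) unsplitK.
by rewrite -[rshift _ i]/(unsplit (inr i)) unsplitK.
Qed.

Lemma coinv_sum (I : finType) (F : I -> P) :
  (forall i, coinv_ideal (F i)) -> coinv_ideal (\sum_i F i).
Proof.
move=> H; apply: (big_ind (@coinv_ideal R n)) => [||i _]; [exact: coinv0|exact: coinvD|exact: H].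
Qed.

Lemma coinvZ c (f : P) : coinv_ideal f -> coinv_ideal (c *: f).
Proof.
move=> [m [a [h [H ->]]]]; exists m, (fun k => c *: a k), h; split=> //.
by rewrite scaler_sumr; apply: eq_bigr => k _; rewrite scalerAl.
Qed.

Lemma coinv_wa g (f : P) : coinv_ideal f -> coinv_ideal (wa g f).
Proof.
move=> [m [a [h [H ->]]]]; exists m, (fun k => wa g (a k)), h; split=> //.
rewrite wa_sum; apply: eq_bigr => k _; apply: (etrans (wa_mul _ _ _)).
apply: f_equal; rewrite -wa_wact; exact: (proj1 (H k)).
Qed.

Lemma coinv_pact a (f : P) : coinv_ideal f -> coinv_ideal (pact a f).
Proof.
move=> If; rewrite pactE; apply: coinv_sum => g; apply: coinvZ; exact: coinv_wa.
Qed.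

(** Applying [eps T] to an expression of [DT T] in the ideal makes the factors
    of the invariants antisymmetric along the columns.  By [anti_mdeg] they
    already have at least the degree of [DT T], and the invariants have no
    constant term. *)
Lemma DT_notin_coinv (lam : bipart n) T : is_tableau lam T -> ~ coinv_ideal (DT R T).
Proof.
move=> tabT [m [a [h [H E]]]]; have := DT_tmon R tabT.
have -> : DT R T = \sum_k pact (eps R T) (a k) * h k.
  rewrite -{1}eps_DT E linear_sum /=; apply: eq_bigr => k _.
  have Hk g : wa g (h k) = h k by rewrite -wa_wact; exact: (proj1 (H k)).
  apply: etrans (f_equal _ (mulrC _ _)) _; apply: etrans (pact_inv _ _ Hk) _.
  exact: mulrC.
rewrite linear_sum /= big1 => [/esym/eqP|k _]; first by rewrite oner_eq0.
rewrite mcoeffM big1 // => -[k1 k2] /= /eqP Ek.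
have [->|n1] := eqVneq ((pact (eps R T) (a k))@_k1) 0; first by rewrite mul0r.
have [k20|nk2] := eqVneq (val k2) 0%MM.
  by have /= := proj2 (H k); rewrite -k20 => ->; rewrite mulr0.
have [le _] := anti_mdeg tabT (@eps_anti R n T (a k)) n1.
have : (0 < mdeg k2)%N by rewrite lt0n mdeg_eq0.
by have := congr1 mdeg Ek; rewrite mdegD => Em; move: le; rewrite {1}Em; lia.
Qed.
End Spans.

(** * Matrix representations realized by higher Specht polynomials *)

Section Realizations.
Variables (R : realType) (n : nat).
Local Notation C := R[i].
Local Notation P := {mpoly C[n]}.
Local Notation W := (Bn n).
Local Notation A := {ffun W -> C}.

Lemma STab_image (lam : bipart n) (s : 'I_(ftab lam) -> bitab n) : injective s ->
  (forall i, s i \in STab lam) -> STab lam = [set s j | j : 'I_(ftab lam)].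
Proof.
move=> sinj sS; apply/esym/eqP; rewrite eqEcard card_imset // card_ord leqnn andbT.
by apply/subsetP => _ /imsetP[j _ ->].
Qed.

Lemma STab_sum (lam : bipart n) (s : 'I_(ftab lam) -> bitab n) (G : bitab n -> P) : injective s ->
  (forall i, s i \in STab lam) -> \sum_(T in STab lam) G T = \sum_i G (s i).
Proof.
move=> sinj sS; rewrite (STab_image sinj sS) big_imset // => ? ? _ _; exact: sinj.
Qed.

Definition at_index (lam : bipart n) (s : 'I_(ftab lam) -> bitab n) (c : 'I_(ftab lam) -> C) T :=
  if [pick j | s j == T] is Some j then c j else 0.

Lemma at_indexE (lam : bipart n) (s : 'I_(ftab lam) -> bitab n) c j : injective s ->
  at_index s c (s j) = c j.
Proof.
move=> sinj; rewrite /at_index.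
by case: pickP => [k /eqP/sinj -> //|/(_ j)]; rewrite eqxx.
Qed.

Lemma ftab_gt0 (lam : bipart n) : (0 < ftab lam)%N.
Proof. by apply/card_gt0P; exists (rowtab lam); exact: rowtab_STab. Qed.

Lemma mx_rep_morph m (rho : mx_representation C [set: W]%G m) : morphmx (fun g => rho g).
Proof. by split=> [|g h]; [exact: repr_mx1|rewrite repr_mxM ?inE]. Qed.

Lemma specht_generates (lam : bipart n) S f : S \in STab lam -> specht_span lam S f ->
  exists a, f = pact a (specht (R := R) lam S (rowtab lam)).
Proof.
move=> SS [c ->].
have ex T : exists b, T \in STab lam ->
    specht lam S T = pact b (specht (R := R) lam S (rowtab lam)).
  have [TS|] := boolP (T \in STab lam); last by exists 0.
  have [w Ew] := tableau_relabel (STab_tab (rowtab_STab lam)) (STab_tab TS).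
  by have [b Eb] := specht_relabel R lam S Ew; exists b.
have [b Eb] := fin_all_exists ex.
exists (\sum_T (if T \in STab lam then c T else 0) *: b T); rewrite pact_suml big_mkcond.
apply: eq_bigr => T _; rewrite pactZl; case: ifP => TS; last by rewrite scale0r.
by rewrite Eb.
Qed.

(** The generator xi is given by the coordinates of one higher Specht polynomial
    modulo the coinvariant ideal; the others are obtained from it by
    relabelling. *)
Lemma realizes_typed (lam : bipart n) (rho : mx_representation C [set: W]%G (ftab lam)) :
  realizes rho -> typed (DT R (rowtab lam)) (fun g => rho g).
Proof.
move=> [S SS [v [vS vI sp act]]].
have act_vec a eta : coinv_ideal (pact a (vec v eta) - vec v (repalg (fun g => rho g) a *m eta)).
  have Ek k : coinv_ideal (pact a (v k) - \sum_i repalg (fun g => rho g) a i k *: v i).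
    have -> : pact a (v k) - \sum_i repalg (fun g => rho g) a i k *: v i =
        \sum_g a g *: (wa g (v k) - \sum_i rho g i k *: v i).
      under [in RHS]eq_bigr do rewrite scalerBr scaler_sumr.
      rewrite sumrB -pactE; congr (_ - _); rewrite exchange_big; apply: eq_bigr => i _ /=.
      by rewrite summxE scaler_suml; apply: eq_bigr => g _; rewrite mxE scalerA.
    by apply: coinv_sum => g; apply: coinvZ; rewrite -wa_wact; exact: act.
  have -> : pact a (vec v eta) - vec v (repalg (fun g => rho g) a *m eta) =
      \sum_k eta k 0 *: (pact a (v k) - \sum_i repalg (fun g => rho g) a i k *: v i).
    under [in RHS]eq_bigr do rewrite scalerBr.
    rewrite sumrB /vec linear_sum /=; congr (_ - _).
      by apply: eq_bigr => k _; rewrite linearZ.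
    under [RHS]eq_bigr do rewrite scaler_sumr.
    rewrite exchange_big; apply: eq_bigr => i _ /=.
    by rewrite mxE scaler_suml; apply: eq_bigr => k _; rewrite scalerA mulrC.
  by apply: coinv_sum => k; apply: coinvZ; exact: Ek.
have vec_inj eta eta' : coinv_ideal (vec v eta - vec v eta') -> eta = eta'.
  have -> : vec v eta - vec v eta' = \sum_i (eta i 0 - eta' i 0) *: v i.
    by rewrite /vec -sumrB; apply: eq_bigr => i _; rewrite scalerBl.
  move=> /vI H; apply/matrixP => i j; rewrite (ord1 j).
  by apply/eqP; rewrite -subr_eq0 H.
set F := specht (R := R) lam S (rowtab lam).
have F_span : specht_span lam S F.
  exists (fun T => (T == rowtab lam)%:R).
  rewrite (bigD1 (rowtab lam)) ?rowtab_STab //= eqxx scale1r big1 ?addr0 // => T /andP[_ /negPf ->].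
  by rewrite scale0r.
have [c Fc] := sp _ F_span; pose xi : 'cV[C]_(ftab lam) := \col_i c i.
have {}Fc : coinv_ideal (F - vec v xi).
  by move: Fc; rewrite /vec; under [in X in _ -> X]eq_bigr do rewrite mxE.
have F_act a : coinv_ideal (pact a F - vec v (repalg (fun g => rho g) a *m xi)).
  have -> : pact a F - vec v (repalg (fun g => rho g) a *m xi) = pact a (F - vec v xi) +
     (pact a (vec v xi) - vec v (repalg (fun g => rho g) a *m xi)).
    by rewrite linearB /= addrA subrK.
  by apply: coinvD; [exact: coinv_pact|exact: act_vec].
have cyc eta : exists a, eta = repalg (fun g => rho g) a *m xi.
  have /fin_all_exists [a Ea] k : exists a, v k = pact a F := specht_generates SS (vS k).
  exists (\sum_k eta k 0 *: a k); apply: vec_inj.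
  have -> : vec v eta = pact (\sum_k eta k 0 *: a k) F; last exact: F_act.
  by rewrite pact_suml; apply: eq_bigr => k _; rewrite pactZl -Ea.
exists xi; split=> //.
  apply/eqP => xi0; have [a] := cyc (const_mx 1); rewrite xi0 mulmx0.
  by move/matrixP/(_ (Ordinal (ftab_gt0 lam)) 0)/eqP; rewrite !mxE oner_eq0.
move=> a aT; apply: vec_inj; have := F_act a.
rewrite (annle_specht lam S aT) sub0r => H.
have -> : vec v 0 = 0 by rewrite /vec big1 // => k _; rewrite mxE scale0r.
by rewrite subr0 -[vec _ _]opprK -scaleN1r; apply: coinvZ.
Qed.

(** If a nonzero combination were in the ideal, so would be [DT (rowtab lam)], by
    irreducibility. *)
Lemma rowtab_coinv_indep (lam : bipart n) (s : 'I_(ftab lam) -> bitab n) (c : 'I_(ftab lam) -> C) :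
  injective s -> (forall i, s i \in STab lam) ->
  coinv_ideal (\sum_i c i *: specht lam (rowtab lam) (s i)) -> forall i, c i = 0.
Proof.
move=> sinj sS If; apply: (specht_rowtab_indep sinj sS).
set f := \sum_i _ in If *.
have span_f : specht_span lam (rowtab lam) f.
  exists (at_index s c); rewrite (STab_sum _ sinj sS).
  by apply: eq_bigr => i _; rewrite at_indexE.
have [a Ea] := specht_generates (rowtab_STab lam) span_f.
have tab0 := STab_tab (rowtab_STab lam).
have [d d0 Ed] := specht_rowtab R tab0.
rewrite Ed linearZ /= -pactZl in Ea.
apply/eqP/negPn/negP => f0; rewrite Ea in f0.
have [b Eb] := irreducible tab0 f0.
by apply: (DT_notin_coinv tab0 (R := R)); rewrite -Eb -Ea; exact: coinv_pact.
Qed.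

Local Notation conj_tr X := (map_mx (@conjc R) X)^T.

Lemma sum_norm_eq0 (I : finType) (F : I -> C) : \sum_i F i * (F i)^* = 0 -> forall i, F i = 0.
Proof.
have E i : F i * (F i)^* = `|F i| ^+ 2 by rewrite normCK.
under eq_bigr do rewrite E; move=> /eqP.
rewrite psumr_eq0 => [/allP H i|i _]; last by rewrite exprn_ge0.
by have := H i (mem_index_enum i); rewrite /= expf_eq0 /= normr_eq0 => /eqP.
Qed.

(** Let r be the matrix representation on the F_i = F_{S,T_i} for S = rowtab lam.
    The element of the group algebra with coefficients (f / |W|) r(g^-1)_ii
    projects onto the line of F_i; the idempotent [mx_idem rho i] is of this
    form for rho = conjugate transpose of r(g^-1).  This rho is equivalent to
    r through the invariant hermitian form H, so that it is realized in the
    basis with coordinates H. *)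
Lemma dual_realization (lam : bipart n) (s : 'I_(ftab lam) -> bitab n) :
  injective s -> (forall i, s i \in STab lam) ->
  exists rho : mx_representation C [set: W]%G (ftab lam), realizes rho /\
    forall i, pact (mx_idem rho i) (specht lam (rowtab lam) (s i)) =
              specht lam (rowtab lam) (s i).
Proof.
move=> sinj sS; pose F i := specht (R := R) lam (rowtab lam) (s i).
have iF : indep F := specht_rowtab_indep sinj sS.
have tab0 := STab_tab (rowtab_STab lam).
have [r mr Er] : exists2 r : W -> 'M[C]_(ftab lam), morphmx r &
    forall g k, wa g (F k) = \sum_i r g i k *: F i.
  apply: rep_of_basis => // g k.
  have [c Ec] := specht_rowtab_span (gdelta R g) sinj sS (sS k).
  by exists c; rewrite -Ec pact_delta.
have tr : typed (DT R (rowtab lam)) r.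
  have [d d0 Ed] := specht_rowtab R tab0.
  have [c Ec] := specht_rowtab_span (d^-1 *: gone R n) sinj sS (rowtab_STab lam).
  apply: (basis_typed Er (xi := \col_i c i)) => //.
  - rewrite /vec; under eq_bigr do rewrite mxE; rewrite -Ec pactZl pact1 Ed scalerA.
    by rewrite mulVf // scale1r.
  - apply/eqP => E; have := DT_tmon R tab0; rewrite E mcoeff0 => /esym/eqP.
    by rewrite oner_eq0.
  move=> k; have [w Ew] := tableau_relabel tab0 (STab_tab (sS k)).
  have [b Eb] := DT_relabel R Ew; have [e e0 Ee] := specht_rowtab R (STab_tab (sS k)).
  by exists (e *: b); rewrite pactZl -Eb /F Ee.
pose rho0 (g : W) := conj_tr (r g^-1%g).
have rho_mx : mx_repr [set: W]%G rho0.
  split=> [|g h _ _]; rewrite /rho0.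
    by rewrite invg1 (proj1 mr) map_mx1 trmx1.
  by rewrite invMg (proj2 mr) map_mxM trmx_mul.
pose rho := MxRepresentation rho_mx; exists rho.
(* the sum of the translates of the standard hermitian form *)
pose H := \sum_h r h *m conj_tr (r h).
have HrhoE g : r g *m H = H *m rho g.
  rewrite mulmx_suml mulmx_sumr [RHS](reindex_inj (mulgI g)); apply: eq_bigr => h _ /=.
  rewrite (proj2 mr) map_mxM trmx_mul -!mulmxA; do 2! congr (_ *m _).
  by rewrite /rho0 -trmx_mul -map_mxM (morphmxV mr) map_mx1 trmx1 mulmx1.
have uH : H \in unitmx.
  rewrite -row_free_unit; apply: inj_row_free => u uH.
  have /sum_norm_eq0 u0 :
    \sum_(x : W * 'I_(ftab lam)) (u *m r x.1) 0 x.2 * ((u *m r x.1) 0 x.2)^* = 0.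
    rewrite -(pair_bigA _ (fun h k => (u *m r h) 0 k * ((u *m r h) 0 k)^*)) /=.
    transitivity ((u *m H *m conj_tr u) 0 0); last by rewrite uH mul0mx mxE.
    rewrite mulmx_sumr mulmx_suml summxE; apply: eq_bigr => h _.
    rewrite mulmxA -mulmxA -trmx_mul -map_mxM [RHS]mxE; apply: eq_bigr => k _.
    by congr (_ * _); rewrite !mxE.
  by apply/rowP => i; have := u0 (1%g, i); rewrite /= (proj1 mr) mulmx1 mxE.
pose v j := \sum_i H i j *: F i.
have Ev (c : 'I_(ftab lam) -> C) : \sum_j c j *: v j = \sum_i (H *m \col_j c j) i 0 *: F i.
  under eq_bigr do rewrite scaler_sumr; rewrite exchange_big; apply: eq_bigr => i _ /=.
  by rewrite mxE scaler_suml; apply: eq_bigr => j _; rewrite !mxE scalerA mulrC.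
split.
  exists (rowtab lam); first exact: rowtab_STab.
  exists v; split.
  - move=> j; exists (at_index s (fun i => H i j)); rewrite (STab_sum _ sinj sS).
    by apply: eq_bigr => i _; rewrite at_indexE.
  - move=> c; rewrite Ev => /(rowtab_coinv_indep sinj sS) E0 i.
    have : H *m \col_j c j = 0.
      by apply/matrixP => k l; rewrite (ord1 l) E0 mxE.
    move/(congr1 (mulmx (invmx H))); rewrite mulKmx // mulmx0 => /matrixP/(_ i 0).
    by rewrite !mxE.
  - move=> f [d ->]; exists (fun j => (invmx H *m \col_i d (s i)) j 0).
    rewrite Ev (STab_sum _ sinj sS).
    have -> : \col_j (invmx H *m \col_i d (s i)) j 0 = invmx H *m \col_i d (s i).
      by apply/matrixP => i j; rewrite (ord1 j) mxE.
    rewrite mulKVmx //; under [X in _ - X]eq_bigr do rewrite mxE.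
    by rewrite subrr; exact: coinv0.
  move=> g j; rewrite Ev wa_wact.
  suff -> : wa g (v j) = \sum_i (H *m \col_i rho g i j) i 0 *: F i.
    by rewrite subrr; exact: coinv0.
  rewrite /v wa_sum; under eq_bigr do rewrite waZ Er scaler_sumr.
  rewrite exchange_big; apply: eq_bigr => i _ /=.
  have -> : (H *m \col_i rho g i j) i 0 = (H *m rho g) i j.
    by rewrite !mxE; apply: eq_bigr => k _; rewrite !mxE.
  rewrite -HrhoE mxE scaler_suml; apply: eq_bigr => k _.
  by rewrite scalerA mulrC.
move=> i; rewrite -/(F i) pactE.
under eq_bigr do rewrite Er scaler_sumr; rewrite exchange_big /=.
transitivity (\sum_l (l == i)%:R *: F l); last first.
  by rewrite (bigD1 i) //= eqxx scale1r big1 ?addr0 // => l /negPf ->; rewrite scale0r.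
apply: eq_bigr => l _; under eq_bigr do rewrite scalerA; rewrite -scaler_suml; congr (_ *: _).
transitivity ((ftab lam)%:R / #|[set: W]|%:R * \sum_g r g l i * r g^-1%g i i).
  rewrite big_distrr /=; apply: eq_bigr => g _; rewrite ffunE.
  have -> : (rho g i i)^*%R = r g^-1%g i i.
    by rewrite /= /rho0 !mxE; exact: conjcK.
  by apply: etrans (esym (mulrA _ _ _)) _; f_equal; exact: mulrC.
transitivity ((ftab lam)%:R / #|[set: W]|%:R *
  ((l == i)%:R * (#|[set: W]|%:R / (ftab lam)%:R)) : C).
  by congr (_ * _); have := ortho_same l i i i tab0 mr tr; rewrite eqxx andbT.
rewrite mulrCA [X in _ * X = _](_ : _ = 1) ?mulr1 //.
have W0 : #|[set: W]|%:R != 0 :> C by rewrite pnatr_eq0 -lt0n; apply/card_gt0P; exists 1%g.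
by rewrite mulrA divfK // divff // pnatr_eq0 -lt0n ftab_gt0.
Qed.

End Realizations.

(** * Matrix units of the group algebra *)

Section MatrixUnits.
Variables (R : realType) (n : nat).
Local Notation C := R[i].
Local Notation W := (Bn n).
Local Notation A := {ffun W -> C}.
Local Notation rep lam := (mx_representation C [set: W]%G (ftab lam)).

Let W0 : #|[set: W]|%:R != 0 :> C.
Proof. by rewrite pnatr_eq0 -lt0n; apply/card_gt0P; exists 1%g. Qed.

Let f0 (lam : bipart n) : (ftab lam)%:R != 0 :> C.
Proof. by rewrite pnatr_eq0 -lt0n ftab_gt0. Qed.

Let rep_ortho (lam : bipart n) (rho : rep lam) i j k l : realizes rho ->
  \sum_h rho h i j * rho h^-1%g k l = ((i == l) && (j == k))%:R * (#|[set: W]|%:R / (ftab lam)%:R).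
Proof.
move=> real; exact: (ortho_same i j k l (STab_tab (rowtab_STab lam)) (mx_rep_morph rho)
  (realizes_typed real)).
Qed.

Let rep_ortho_diff (lam mu : bipart n) (rho : rep lam) (rho' : rep mu) i j k l :
  realizes rho -> realizes rho' -> lam != mu -> \sum_h rho h i j * rho' h^-1%g k l = 0.
Proof.
move=> real real'; exact: (ortho_diff i j k l (STab_tab (rowtab_STab lam))
  (STab_tab (rowtab_STab mu)) (mx_rep_morph rho) (mx_rep_morph rho')
  (realizes_typed real) (realizes_typed real')).
Qed.

Let conj_ratio (a b : nat) : (a%:R / b%:R : C)^*%R = a%:R / b%:R.
Proof. by rewrite fmorph_div !rmorph_nat. Qed.

Let conj_bool (b : bool) : (b%:R : C)^*%R = b%:R.
Proof. exact: rmorph_nat. Qed.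

Definition munit (lam : bipart n) (rho : rep lam) (i j : 'I_(ftab lam)) : A :=
  [ffun g => (ftab lam)%:R / #|[set: W]|%:R * (rho g i j)^*%R].

Lemma mx_idem_munit (lam : bipart n) (rho : rep lam) i : mx_idem rho i = munit rho i i.
Proof. by []. Qed.

Let munit_conv (lam mu : bipart n) (rho : rep lam) (rho' : rep mu) i j k l g :
  gconv (munit rho i j) (munit rho' k l) g =
  (ftab lam)%:R / #|[set: W]|%:R * ((ftab mu)%:R / #|[set: W]|%:R) *
  \sum_m (\sum_h rho h i j * rho' h^-1%g k m)^*%R * (rho' g m l)^*%R.
Proof.
rewrite ffunE; under eq_bigr => h _ do
  rewrite !ffunE mulrACA (repr_mxM rho') ?inE // mxE rmorph_sum /=.
rewrite -big_distrr /=; congr (_ * _).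
under eq_bigr do rewrite big_distrr /=; rewrite exchange_big; apply: eq_bigr => m _ /=.
rewrite rmorph_sum big_distrl /=; apply: eq_bigr => h _.
by rewrite !rmorphM mulrA.
Qed.

Lemma munitM (lam : bipart n) (rho : rep lam) i j k l : realizes rho ->
  gconv (munit rho i j) (munit rho k l) = (j == k)%:R *: munit rho i l.
Proof.
move=> real; have orth i' j' k' l' := rep_ortho i' j' k' l' real.
apply/ffunP => g; rewrite munit_conv !ffunE (bigD1 i) //= [X in _ + X]big1 => [|m mi].
  rewrite orth eqxx /= addr0 rmorphM /= conj_ratio conj_bool.
  have E : (ftab lam)%:R / #|[set: W]|%:R * (#|[set: W]|%:R / (ftab lam)%:R) = 1 :> C.
    by rewrite mulrA divfK // divff.
  rewrite /GRing.scale /=; move: E (rho g i l)^*%R; move: (_ / _) (_ / _) => x y E z.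
  case: (j == k); last by rewrite !mul0r mulr0.
  by rewrite !mul1r mulrACA E mul1r.
by rewrite orth eq_sym (negPf mi) mul0r rmorph0 mul0r.
Qed.

Lemma munit_orth (lam mu : bipart n) (rho : rep lam) (rho' : rep mu) i j k l :
  realizes rho -> realizes rho' -> lam != mu -> gconv (munit rho i j) (munit rho' k l) = 0.
Proof.
move=> real real' ne; apply/ffunP => g; rewrite munit_conv [RHS]ffunE.
rewrite [X in _ * X]big1 ?mulr0 // => m _.
by rewrite rep_ortho_diff // rmorph0 mul0r.
Qed.

Lemma munit_compress (lam : bipart n) (rho : rep lam) i a : realizes rho ->
  exists c, gconv (munit rho i i) (gconv a (munit rho i i)) = c *: munit rho i i.
Proof.
move=> real; exists (\sum_x a x * (rho x^-1%g i i)^*%R).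
rewrite {1}(ffun_delta a) gconv_suml gconv_sumr scaler_suml; apply: eq_bigr => x _.
rewrite gconvZl gconvZr -scalerA; congr (_ *: _).
have -> : gconv (gdelta R x) (munit rho i i) = \sum_m (rho x^-1%g i m)^*%R *: munit rho m i.
  apply/ffunP => g; rewrite gconv_deltal ffunE repr_mxM ?inE // mxE rmorph_sum big_distrr /=.
  rewrite sum_ffunE; apply: eq_bigr => m _; rewrite !ffunE rmorphM /GRing.scale /=.
  by rewrite mulrCA.
rewrite gconv_sumr (bigD1 i) //= big1 ?addr0 => [|m mi].
  by have E := munitM i i i i real; rewrite gconvZr E eqxx scale1r.
by have E := munitM i i m i real; rewrite gconvZr E eq_sym (negPf mi) scale0r scaler0.
Qed.

Lemma munit_primitive (lam : bipart n) (rho : rep lam) i : realizes rho ->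
  primitive_idempotent (mx_idem rho i).
Proof.
move=> real; rewrite mx_idem_munit; set e := munit rho i i.
have ee : gconv e e = e by rewrite munitM // eqxx scale1r.
have e0 : e != 0.
  apply/eqP => /ffunP/(_ 1%g); rewrite !ffunE repr_mx1 mxE eqxx rmorph1 mulr1 => /eqP.
  by rewrite mulf_eq0 invr_eq0 (negPf (f0 lam)) (negPf W0).
split=> // a b [aa bb ab ba] eab.
have ea : gconv e (gconv a e) = a by rewrite eab gconvDr aa ab addr0 gconvDl aa ba addr0.
have [c Ec] := munit_compress i a real; rewrite -/e ea in Ec.
have := aa; rewrite Ec gconvZl gconvZr ee scalerA => /eqP.
rewrite -subr_eq0 -scalerBl scaler_eq0 (negPf e0) orbF -[X in _ - X]mulr1 -mulrBr mulf_eq0.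
case/orP => [/eqP c0|]; first by left; rewrite c0 scale0r.
rewrite subr_eq0 => /eqP c1; right; have /eqP := eab; rewrite Ec c1 scale1r.
by rewrite -subr_eq0 opprD addrA subrr sub0r oppr_eq0 => /eqP.
Qed.

(** The matrix of all matrix coefficients is square, by [sum_ftab_sqr], and the
    orthogonality relations give an inverse on one side; that it is an inverse on
    the other side is the completeness relation. *)
Lemma munit_complete (rho : forall lam, rep lam) : (forall lam, realizes (rho lam)) ->
  \sum_lam \sum_i mx_idem (rho lam) i = gone R n.
Proof.
move=> real; pose I := {mu : bipart n & ('I_(ftab mu) * 'I_(ftab mu))%type}.
pose X (x : I) (h : W) : C := rho (tag x) h (tagged x).1 (tagged x).2.
pose Y (h : W) (x : I) : C := (ftab (tag x))%:R / #|[set: W]|%:R *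
   rho (tag x) h^-1%g (tagged x).2 (tagged x).1.
have XY x y : \sum_h X x h * Y h y = (x == y)%:R.
  rewrite /X /Y; case: x => mu [i j]; case: y => nu [k l] /=.
  under eq_bigr do rewrite mulrCA; rewrite -big_distrr /=.
  have [E|ne] := eqVneq mu nu; last first.
    by rewrite rep_ortho_diff // mulr0 -tag_eqE /tag_eq /= (negPf ne).
  case: nu / E k l => k l.
  rewrite rep_ortho // eq_Tagged /= -pair_eqE /= mulrCA [X in _ * X = _](_ : _ = 1) ?mulr1 //.
  by rewrite mulrA divfK // divff.
have cardI : #|{: I}| = #|{: W}|.
  rewrite -[RHS]cardsT -sum_ftab_sqr card_tagged sumnE big_map big_enum /=.
  by apply: eq_bigr => mu _; rewrite card_prod card_ord.
apply/ffunP => g; rewrite [RHS]ffunE.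
have -> : (g == 1%g)%:R = \sum_x (Y 1%g x * X x g)^*%R.
  by rewrite -rmorph_sum (left_inverse_right XY cardI) /= conj_bool eq_sym.
rewrite sum_ffunE.
under eq_bigr do rewrite sum_ffunE.
pose G mu (i j : 'I_(ftab mu)) : C :=
  (Y 1%g (existT _ mu (i, j)) * X (existT _ mu (i, j)) g)^*%R.
transitivity (\sum_mu \sum_(ij : 'I_(ftab mu) * 'I_(ftab mu)) G mu ij.1 ij.2); last first.
  by rewrite sig_big_dep /=; apply: eq_bigr => -[mu [i j]].
apply: eq_bigr => mu _; rewrite -pair_bigA; rewrite /G {G}.
apply: eq_bigr => i _; rewrite ffunE (bigD1 i) //= big1 => [|j ji].
  by rewrite addr0 /X /Y /= invg1 repr_mx1 mxE eqxx mulr1 rmorphM /= conj_ratio.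
by rewrite /Y /= invg1 repr_mx1 mxE (negPf ji) mulr0 mul0r rmorph0.
Qed.

End MatrixUnits.

(** * Modules over the differential operators *)

Section Modules.
Variables (R : realType) (n : nat).
Local Notation C := R[i].
Local Notation P := {mpoly C[n]}.
Local Notation W := (Bn n).
Local Notation A := {ffun W -> C}.
Local Notation rep lam := (mx_representation C [set: W]%G (ftab lam)).

Variables (K : zmodType) (act : A -> K -> K) (O : K -> Prop) (D : (K -> K) -> Prop).
Variable io : P -> K.
Hypothesis actD : forall a, {morph act a : u v / u + v}.
Hypothesis act_conv : forall a b u, act (gconv a b) u = act a (act b u).
Hypothesis act0l : forall u, act 0 u = 0.
Hypothesis act1 : forall u, act (gone R n) u = u.
Hypothesis act_suml : forall (I : finType) (F : I -> A) u,
  act (\sum_i F i) u = \sum_i act (F i) u.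
Hypothesis O0 : O 0.
Hypothesis OD : forall f h, O f -> O h -> O (f + h).
Hypothesis Oact : forall a f, O f -> O (act a f).
Hypothesis OQ : forall Q f, D Q -> O f -> O (Q f).
Hypothesis Oio : forall p, O (io p).
Hypothesis actQ : forall a Q f, D Q -> act a (Q f) = Q (act a f).
Hypothesis transfer : forall f h, O f -> O h -> (forall a, act a f = 0 -> act a h = 0) ->
  exists2 Q, D Q & Q f = h.
Hypothesis prim : forall e f a, O f -> primitive_idempotent e -> act e f = f -> f != 0 ->
  act a f = 0 -> gconv a e = 0.
Hypothesis act_io : forall a p, act a (io p) = io (pact a p).
Hypothesis io_neq0 : forall p, p != 0 -> io p != 0.

(** The notions of the statement, over an abstract additive group K with an
    action of the group algebra, a class O of elements and a class D of
    operators, of which only the properties above matter. *)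
Definition meO (e : A) (f : K) : Prop := exists2 h, O h & f = act e h.
Definition msameset (M N : K -> Prop) : Prop := forall f, M f <-> N f.
Definition msubmod (M : K -> Prop) : Prop :=
  [/\ forall f, M f -> O f, M 0, forall f g, M f -> M g -> M (f + g) &
      forall Q f, D Q -> M f -> M (Q f)].
Definition msimple (M : K -> Prop) : Prop :=
  [/\ msubmod M, exists2 f, M f & f != 0 &
      forall N, msubmod N -> (forall f, N f -> M f) ->
        (forall f, N f -> f = 0) \/ msameset N M].
Definition mgen (F : K) (f : K) : Prop := exists2 Q, D Q & f = Q F.
Definition miso (M N : K -> Prop) (phi : K -> K) : Prop :=
  [/\ forall f, M f -> N (phi f),
      forall f g, M f -> M g -> phi (f + g) = phi f + phi g,
      forall Q f, D Q -> M f -> phi (Q f) = Q (phi f),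
      forall f g, M f -> M g -> phi f = phi g -> f = g &
      forall h, N h -> exists2 f, M f & phi f = h].
Definition mdirect_sum (N : forall lam : bipart n, 'I_(ftab lam) -> K -> Prop) : Prop :=
  forall f, O f ->
  exists u : forall lam : bipart n, 'I_(ftab lam) -> K,
  [/\ forall lam i, N lam i (u lam i),
      f = \sum_lam \sum_i u lam i &
      forall u' : forall lam : bipart n, 'I_(ftab lam) -> K,
        (forall lam i, N lam i (u' lam i)) ->
        f = \sum_lam \sum_i u' lam i -> forall lam i, u' lam i = u lam i].
Definition mdecomposition (M : bipart n -> K -> Prop) : Prop :=
  exists N : forall lam : bipart n, 'I_(ftab lam) -> K -> Prop,
    (forall lam i, msubmod (N lam i) /\ exists phi, miso (M lam) (N lam i) phi)
    /\ mdirect_sum N.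

Lemma mact0 (a : A) : act a 0 = 0.
Proof. by apply: (@addrI _ (act a 0)); rewrite -actD !addr0. Qed.

Lemma mactN (a : A) u : act a (- u) = - act a u.
Proof. by apply/eqP; rewrite -addr_eq0 -actD addNr mact0. Qed.

Lemma mact_sum (a : A) (I : finType) (F : I -> K) : act a (\sum_i F i) = \sum_i act a (F i).
Proof. by apply: (big_morph (act a)); [exact: actD|exact: mact0]. Qed.

Lemma ON f : O f -> O (- f).
Proof.
move=> Of; suff <- : act (- gone R n) f = - f by exact: Oact.
have := act_suml (fun b : bool => if b then - gone R n else gone R n) f.
by rewrite !big_bool /= addNr act0l act1 => /esym/eqP; rewrite addr_eq0 => /eqP.
Qed.

Lemma eO_submod e : msubmod (meO e).
Proof.
split.
- by move=> f [h Oh ->]; exact: Oact.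
- by exists 0; [exact: O0|rewrite mact0].
- by move=> f g [h Oh ->] [k Ok ->]; exists (h + k); [exact: OD|rewrite actD].
by move=> Q f dQ [h Oh ->]; exists (Q h); [exact: OQ|rewrite actQ].
Qed.

Lemma eO_fix e f : gconv e e = e -> meO e f -> act e f = f.
Proof. by move=> ee [h _ ->]; rewrite -act_conv ee. Qed.

(** A primitive idempotent has the same annihilator as any nonzero element that
    it fixes; such an element can therefore be transferred to every element of
    the image of the idempotent. *)
Lemma primitive_transfer e f h : primitive_idempotent e -> O f ->
  act e f = f -> f != 0 -> meO e h -> exists2 Q, D Q & Q f = h.
Proof.
move=> pe Of ef f0 [k Ok ->]; apply: (transfer Of); first exact: Oact.
by move=> a af; rewrite -act_conv (prim Of pe ef f0 af) act0l.
Qed.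

Lemma primitive_gen e f : primitive_idempotent e -> O f ->
  act e f = f -> f != 0 -> msameset (meO e) (mgen f).
Proof.
move=> pe Of ef f0 h; split=> [eh|[Q dQ ->]].
  by have [Q dQ E] := primitive_transfer pe Of ef f0 eh; exists Q.
by exists (Q f); [exact: OQ|rewrite actQ // ef].
Qed.

Lemma primitive_simple e f : primitive_idempotent e -> meO e f -> f != 0 ->
  msimple (meO e).
Proof.
move=> pe ef f0; have [_ ee _] := pe.
split; [exact: eO_submod|by exists f|] => N [NO N0 ND NQ] sub.
have [all0|] := boolp.pselect (forall h, N h -> h = 0); first by left.
case/boolp.existsNP => h /boolp.not_implyP[Nh /eqP h0]; right=> g; split; first exact: sub.
move=> eg; have [Q dQ <-] := primitive_transfer pe (NO h Nh) (eO_fix ee (sub h Nh)) h0 eg.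
exact: NQ.
Qed.

(** An element h of the module generated by f is fixed by w, so that e h = 0
    with h <> 0 would give e w = 0. *)
Lemma primitive_iso e w f : primitive_idempotent e -> primitive_idempotent w ->
  gconv e w != 0 -> O f -> act w f = f -> f != 0 ->
  act e f != 0 /\ miso (mgen f) (meO e) (act e).
Proof.
move=> pe pw ew Of wf f0; have [_ ee _] := pe.
have inj h : O h -> act w h = h -> act e h = 0 -> h = 0.
  move=> Oh wh eh; apply/eqP; apply: contraNT ew => h0; apply/eqP.
  exact: (prim Oh pw wh h0 eh).
have ef0 : act e f != 0 by apply: contraNneq f0 => E; apply/eqP; exact: inj.
have genO h : mgen f h -> O h /\ act w h = h.
  by move=> [Q dQ ->]; split; [exact: OQ|rewrite actQ // wf].
split=> //; split.
- by move=> h /genO[Oh _]; exists h.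
- by move=> h k _ _; exact: actD.
- by move=> Q h dQ _; exact: actQ.
- move=> h k /genO[Oh wh] /genO[Ok wk] E; apply/eqP; rewrite -subr_eq0; apply/eqP.
  by apply: inj; rewrite ?actD ?mactN ?wh ?wk ?E ?subrr //; apply: OD => //; exact: ON.
move=> h eh; have eef : act e (act e f) = act e f by rewrite -act_conv ee.
have [Q dQ <-] := primitive_transfer pe (Oact e Of) eef ef0 eh.
by exists (Q f); [exists Q|rewrite actQ].
Qed.

Lemma units_iso e e' u v : gconv e e = e -> gconv e' u = u -> gconv u e = u ->
  gconv v u = e -> gconv u v = e' -> gconv e v = v -> miso (meO e) (meO e') (act u).
Proof.
move=> ee eu ue vu uv ev; split.
- move=> _ [h Oh ->]; exists (act u (act e h)); first by apply/Oact/Oact.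
  by rewrite -[RHS]act_conv eu.
- by move=> f g _ _; exact: actD.
- by move=> Q f dQ _; exact: actQ.
- move=> f g ef eg E; rewrite -(eO_fix ee ef) -(eO_fix ee eg).
  by rewrite -vu !act_conv E.
move=> _ [h Oh ->]; exists (act v h); last by rewrite -act_conv uv.
by exists (act v h); [exact: Oact|rewrite -act_conv ev].
Qed.

(** For fixed T all F_{S,T} have the annihilator of [DT T]. *)
Lemma specht_fixed (lam : bipart n) S S' T a : S \in STab lam -> S' \in STab lam ->
  T \in STab lam -> pact a (specht (R := R) lam S T) = specht lam S T ->
  pact a (specht lam S' T) = specht (R := R) lam S' T.
Proof.
move=> SS SS' TS E; apply: annle_fix E => b bS.
by apply: annle_specht; exact: (specht_annle SS TS).
Qed.

(** Some summand of 1 = sum of the [mx_idem rho i] is not killed by e. *)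
Lemma primitive_specht e : primitive_idempotent e ->
  exists (lam : bipart n) (S T : bitab n), [/\ S \in STab lam, T \in STab lam,
    act e (io (specht lam S T)) != 0 &
    miso (mgen (io (specht lam S T))) (meO e) (act e)].
Proof.
move=> pe; have ex lam : exists rho : rep lam, realizes rho /\
    forall i, pact (mx_idem rho i) (specht lam (rowtab lam) (std i)) =
              specht lam (rowtab lam) (std i).
  exact: dual_realization enum_val_inj (@std_STab n lam).
have [rho Hrho] := fin_all_exists ex.
have [e0 _ _] := pe.
have [lam [i ew]] : exists lam i, gconv e (mx_idem (rho lam) i) != 0.
  apply: boolp.contrapT => none; case/eqP: e0.
  rewrite -[e]gconv1r -(munit_complete (fun lam => proj1 (Hrho lam))).
  rewrite gconv_sumr big1 // => lam _; rewrite gconv_sumr big1 // => i _.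
  by apply/eqP/negPn/negP => H; apply: none; exists lam, i.
have F0 := specht_neq0 R (rowtab_STab lam) (std_STab i).
have wF : act (mx_idem (rho lam) i) (io (specht lam (rowtab lam) (std i))) =
  io (specht lam (rowtab lam) (std i)) by rewrite act_io (proj2 (Hrho lam)).
have [eF iso] := primitive_iso pe (munit_primitive i (proj1 (Hrho lam))) ew (Oio _) wF (io_neq0 F0).
by exists lam, (rowtab lam), (std i); split=> //; [exact: rowtab_STab|exact: std_STab].
Qed.

(** The matrix units permute the summands e^lambda_i O of a given lambda, and
    the idempotents e^lambda_i are orthogonal with sum 1. *)
Lemma abstract_decomposition (s : forall lam : bipart n, 'I_(ftab lam) -> bitab n)
    (rho : forall lam, rep lam) (i1 : forall lam : bipart n, 'I_(ftab lam))
    (T1 : bipart n -> bitab n) :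
  (forall lam, realizes (rho lam)) ->
  (forall lam, msameset (meO (mx_idem (rho lam) (i1 lam)))
     (mgen (io (specht lam (s lam (i1 lam)) (T1 lam))))) ->
  mdecomposition (fun lam => mgen (io (specht lam (s lam (i1 lam)) (T1 lam)))).
Proof.
move=> real gen; exists (fun lam i => meO (mx_idem (rho lam) i)); split.
  move=> lam i; split; first exact: eO_submod.
  pose u j k := munit (rho lam) j k.
  have uM j k l m : gconv (u j k) (u l m) = (k == l)%:R *: u j m := munitM j k l m (real lam).
  have [maps add lin inj sur] : miso (meO (u (i1 lam) (i1 lam))) (meO (u i i)) (act (u i (i1 lam))).
    by apply: (units_iso (v := u (i1 lam) i)); rewrite uM eqxx scale1r.
  exists (act (u i (i1 lam))); split.
  - by move=> f /gen; exact: maps.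
  - by move=> f g _ _; exact: actD.
  - by move=> Q f dQ _; exact: actQ.
  - by move=> f g /gen ef /gen eg; exact: inj.
  by move=> h /sur[f ef <-]; exists f => //; apply/gen.
move=> f Of; have fE : f = \sum_lam \sum_i act (mx_idem (rho lam) i) f.
  rewrite -{1}[f]act1 -(munit_complete real) act_suml; apply: eq_bigr => lam _.
  by rewrite act_suml.
exists (fun lam i => act (mx_idem (rho lam) i) f); split=> // [lam i|u' Nu' fE' lam i].
  by exists f.
rewrite [in RHS]fE' mact_sum (bigD1 lam) //= [X in _ + X]big1 ?addr0 => [|mu ne].
  rewrite mact_sum (bigD1 i) //= [X in _ + X]big1 ?addr0 => [|j ji].
    apply/esym; apply: eO_fix (Nu' lam i).
    by have E := munitM i i i i (real lam); rewrite eqxx scale1r in E.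
  have [h _ ->] := Nu' lam j; rewrite -act_conv.
  have E := munitM i i j j (real lam); rewrite eq_sym (negPf ji) scale0r in E.
  by rewrite E act0l.
rewrite mact_sum big1 // => j _; have [h _ ->] := Nu' mu j; rewrite -act_conv.
have E := munit_orth i i j j (real lam) (real mu).
by rewrite E ?act0l // eq_sym.
Qed.

Lemma abstract_corollary :
  (forall e : A, primitive_idempotent e ->
     [/\ msimple (meO e),
         exists (lam : bipart n) (S T : bitab n),
           [/\ S \in STab lam, T \in STab lam,
               miso (mgen (io (specht lam S T))) (meO e) (act e) &
               msameset (meO e) (mgen (act e (io (specht lam S T))))] &
         forall (lam : bipart n) (S T : bitab n),
           S \in STab lam -> T \in STab lam ->
           act e (io (specht lam S T)) = io (specht lam S T) ->
           msameset (meO e) (mgen (io (specht lam S T)))])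
  /\
  (forall s : forall lam : bipart n, 'I_(ftab lam) -> bitab n,
     (forall lam, injective (s lam)) ->
     (forall lam i, s lam i \in STab lam) ->
     (forall lam : bipart n,
        exists rho : rep lam,
          realizes rho /\
          forall i, exists2 T, T \in STab lam &
            msameset (meO (mx_idem rho i)) (mgen (io (specht lam (s lam i) T))))
     /\
     (forall (rho : forall lam : bipart n, rep lam)
             (i1 : forall lam : bipart n, 'I_(ftab lam))
             (T1 : bipart n -> bitab n),
        (forall lam, realizes (rho lam)) ->
        (forall lam, i1 lam = 0%N :> nat) ->
        (forall lam, T1 lam \in STab lam) ->
        (forall lam, msameset (meO (mx_idem (rho lam) (i1 lam)))
           (mgen (io (specht lam (s lam (i1 lam)) (T1 lam))))) ->
        mdecomposition
          (fun lam => mgen (io (specht lam (s lam (i1 lam)) (T1 lam)))))).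
Proof.
split=> [e pe|s sinj sS].
  have [_ ee _] := pe; have [lam [S [T [SS TS eF iso]]]] := primitive_specht pe.
  have OeF : O (act e (io (specht lam S T))) by apply: Oact.
  split.
  - apply: (primitive_simple (f := act e (io (specht lam S T)))) => //.
    by exists (io (specht lam S T)).
  - by exists lam, S, T; split=> //; apply: primitive_gen; rewrite -?act_conv ?ee.
  move=> mu S' T' SS' TS' fixF; apply: primitive_gen => //.
  exact/io_neq0/specht_neq0.
split=> [lam|rho i1 T1 real _ _ gen]; last exact: abstract_decomposition.
have [rho [real fixF]] := dual_realization R (sinj lam) (sS lam).
exists rho; split=> // i; exists (s lam i) => //.
apply: primitive_gen => //; first exact: munit_primitive.
  by rewrite act_io (specht_fixed (rowtab_STab lam) (sS lam i) (sS lam i) (fixF i)).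
exact/io_neq0/specht_neq0.
Qed.

End Modules.

Theorem corollary5p2 (R : realType) (n : nat) (c0 : R[i])
    (n_gt0 : (0 < n)%N) (c0_neq0 : c0 != 0) :

  (* every primitive idempotent e: e O_X is simple, generated by (the image
     under e of) a higher Specht polynomial F_{S,T}, f |-> e f being an
     isomorphism from D_Y F_{S,T}; it is generated by F_{S,T} itself as soon
     as e fixes F_{S,T} *)
  (forall e : {ffun Bn n -> R[i]}, primitive_idempotent e ->
     [/\ Dsimple c0 (eO c0 e),
         exists (lam : bipart n) (S T : bitab n),
           [/\ S \in STab lam, T \in STab lam,
               Diso c0 (Dgen c0 (tofrac (specht lam S T))) (eO c0 e) (aact e) &
               sameset (eO c0 e)
                 (Dgen c0 (aact e (tofrac (specht lam S T))))] &
         forall (lam : bipart n) (S T : bitab n),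
           S \in STab lam -> T \in STab lam ->
           aact e (tofrac (specht lam S T)) = tofrac (specht lam S T) ->
           sameset (eO c0 e) (Dgen c0 (tofrac (specht lam S T)))])
  /\
  (* for every enumeration s lam of STab(lam) *)
  (forall s : forall lam : bipart n, 'I_(ftab lam) -> bitab n,
     (forall lam, injective (s lam)) ->
     (forall lam i, s lam i \in STab lam) ->
     (* the polynomials F_{lam,i}, in particular the F_{lam,1}, exist *)
     (forall lam : bipart n,
        exists rho : mx_representation R[i] [set: Bn n]%G (ftab lam),
          realizes rho /\
          forall i, exists2 T, T \in STab lam &
            sameset (eO c0 (mx_idem rho i))
                    (Dgen c0 (tofrac (specht lam (s lam i) T))))
     /\
     (* the decomposition, for every choice of the F_{lam,1} *)
     (forall (rho : forall lam : bipart n,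
                mx_representation R[i] [set: Bn n]%G (ftab lam))
             (i1 : forall lam : bipart n, 'I_(ftab lam))
             (T1 : bipart n -> bitab n),
        (forall lam, realizes (rho lam)) ->
        (forall lam, i1 lam = 0%N :> nat) ->
        (forall lam, T1 lam \in STab lam) ->
        (forall lam, sameset (eO c0 (mx_idem (rho lam) (i1 lam)))
           (Dgen c0 (tofrac (specht lam (s lam (i1 lam)) (T1 lam))))) ->
        Otil_decomposition c0
          (fun lam =>
             Dgen c0 (tofrac (specht lam (s lam (i1 lam)) (T1 lam)))))).
Proof.
have neq0 (p : {mpoly R[i][n]}) : p != 0 -> (tofrac p : {fraction {mpoly R[i][n]}}) != 0.
  by apply: contraNneq => E; apply/eqP; apply: (@tofrac_inj R n); rewrite E tofrac0.
exact: (@abstract_corollary R n {fraction {mpoly R[i][n]}} (@aact R n) (@Otil R n c0)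
  (@Dtil R n c0) (@tofrac _) (@aactD R n) (@aact_conv R n) (@aact0l R n) (@aact1 R n)
  (@aact_suml R n) (@Otil0 R n c0) (@OtilD R n c0 c0_neq0) (@Otil_aact R n c0 c0_neq0)
  (@Otil_Dtil R n c0 c0_neq0) (@Otil_poly R n c0) (@aact_Dtil R n c0)
  (@Otil_transfer R n c0 c0_neq0) (@primitive_aact R n c0 c0_neq0) (@aact_poly R n) neq0).
Qed.
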